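(* Let $r$ and $s$ be positive integers with $s>r$. Let $f\in R^\circ_r(\zeta)$ with $\mathrm{ord}(f)=-s/r$. Then $E_f\in\mathcal{C}_\infty^{>1}$ and $$\mathcal{F}^{(\infty,\infty)}(E_f)\simeq E_g,$$ where $g\in R^\circ_{s-r}(\hat\zeta)$ is determined by the system of equations $$f=z\hat z,\qquad g=-f+\frac{s}{2(s-r)}.$$ Here $z=1/\zeta$, $\hat\zeta=1/\hat z$, and the system is read as follows: the first equation is solved to express $\zeta$ in terms of $\hat\zeta^{1/(s-r)}$, and this expression is substituted in the second equation to obtain $g$ in terms of $\hat\zeta^{1/(s-r)}$. Explicitly, choose a representative $f=F(\zeta^{1/r})$ with $F\in\Bbbk((t))$ of order $-s$, let $u\in\Bbbk((\hat\zeta^{1/(s-r)}))$ (playing the role of $\zeta^{1/r}$), of order $1/(s-r)$ in $\hat\zeta$, be a solution of $u^rF(u)=\hat\zeta^{-1}$; then $g$ is the class of $-F(u)+\frac{s}{2(s-r)}$. (Different choices of the solution $u$ give the same Galois orbit.)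
   Context: $\Bbbk$ is an algebraically closed field of characteristic zero. For a local coordinate $x$ put $K=\Bbbk((x))$ and, for a positive integer $q$, $K_q=\Bbbk((x^{1/q}))$, with $\mathrm{ord}$ the order in $x$ (so $\mathrm{ord}(x^{1/q})=1/q$). A connection on a finite-dimensional $K$-vector space $V$ is a $\Bbbk$-linear map $\nabla:V\to V$ with $\nabla(hv)=h\nabla(v)+\frac{dh}{dx}v$ for $h\in K$, $v\in V$. $\mathcal{C}$ is the category of pairs $(V,\nabla)$, with morphisms the $K$-linear maps commuting with the connections. $\mathcal{C}_\infty$ denotes $\mathcal{C}$ with the coordinate at infinity ($\zeta=1/z$, or $\hat\zeta=1/\hat z$ on the Fourier side); $\mathcal{C}_\infty^{>1}$ is the full subcategory of $\mathcal{C}_\infty$ of connections all of whose irreducible components have slope greater than one (irreducible components $E_f$ with $\mathrm{ord}(f)<-1$). For $f\in K_q$, $E_f=E_{f,q}=\left(K_q,\frac{d}{dx}+x^{-1}f\right)\in\mathcal{C}$ (with $K_q$ viewed as a $K$-vector space). $R_q(x)$ is the set of orbits of $\mathrm{Gal}(K_q/K)$ (the $q$-th roots of unity $\eta\in\Bbbk$, acting by $f(x^{1/q})\mapsto f(\eta x^{1/q})$) on the quotient $$\Bbbk((x^{1/q}))\Big/\left(x^{1/q}\Bbbk[[x^{1/q}]]+\tfrac1q\mathbb{Z}\right).$$ $R_q^\circ(x)\subset R_q(x)$ is the set of $f\in R_q(x)$ that cannot be represented by elements of $K_{q'}$ for any $0<q'<q$ (equivalently, the locus where $\mathrm{Gal}(K_q/K)$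 acts freely). The isomorphism class of $E_f$ depends only on the class of $f$ in $R_q(x)$. Local Fourier transform $\mathcal{F}^{(\infty,\infty)}$: let $E=(V,\nabla_\zeta)\in\mathcal{C}_\infty^{>1}$. The operator $\zeta^2\nabla_\zeta$ on $V$ is invertible. Define $\Bbbk$-linear operators on $V$ by $\hat\zeta=(\zeta^2\nabla_\zeta)^{-1}$ (so $\hat z=\hat\zeta^{-1}=\zeta^2\nabla_\zeta$) and $\hat\nabla_{\hat\zeta}=-\hat\zeta^{-2}\zeta^{-1}$ (so that $\zeta^{-1}=-\hat\zeta^{2}\hat\nabla_{\hat\zeta}$). The operator $\hat\zeta$ extends to an action of $\Bbbk((\hat\zeta))$ on $V$ with $\dim_{\Bbbk((\hat\zeta))}V<\infty$, and $\hat\nabla_{\hat\zeta}$ is a connection on the resulting $\Bbbk((\hat\zeta))$-vector space $V_{\hat\zeta}$. Then $\mathcal{F}^{(\infty,\infty)}(E):=(V_{\hat\zeta},\hat\nabla_{\hat\zeta})\in\mathcal{C}_\infty^{>1}$. *)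

(* Defs.v *)
From HB Require Import structures.
From mathcomp Require Import all_boot all_order all_algebra.
From mathcomp Require Import boolp classical_sets functions cardinality fsbigop.
From mathcomp Require Import zify ring.

Set Implicit Arguments.
Unset Strict Implicit.
Unset Printing Implicit Defensive.

Import Order.TTheory GRing.Theory Num.Theory.

Local Open Scope classical_set_scope.
Local Open Scope ring_scope.
Local Open Scope quotient_scope.

Definition zero_below (k : nmodType) (N : int) (c : int -> k) : Prop :=
  forall i, i < N -> c i = 0.

Record laurent (k : nmodType) := Laurent {
  lcoef : int -> k;
  lcoef_bounded : exists N, zero_below N lcoef }.

HB.instance Definition _ (k : nmodType) := gen_eqMixin (laurent k).
HB.instance Definition _ (k : nmodType) := gen_choiceMixin (laurent k).

Lemma laurentP (k : nmodType) (f g : laurent k) :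
  (forall i, lcoef f i = lcoef g i) -> f = g.
Proof.
case: f g => [f hf] [g hg] /= /funext fg; rewrite {}fg in hf *.
by congr Laurent; apply: Prop_irrelevance.
Qed.

Lemma zero_below_le (k : nmodType) (M N : int) (c : int -> k) :
  M <= N -> zero_below N c -> zero_below M c.
Proof. by move=> MN cN i /lt_le_trans/(_ MN)/cN. Qed.

Section Additive.
Context (k : zmodType).
Implicit Types f g h : laurent k.

Fact laurent0_bounded : exists N, zero_below N (fun _ : int => 0 : k).
Proof. by exists 0. Qed.
Definition laurent0 := Laurent laurent0_bounded.

Fact laurentD_bounded f g :
  exists N, zero_below N (fun i => lcoef f i + lcoef g i).
Proof.
case: f g => [f [a fa]] [g [b gb]] /=; exists (Num.min a b) => i.
by rewrite lt_min => /andP[/fa -> /gb ->]; rewrite addr0.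
Qed.
Definition laurentD f g := Laurent (laurentD_bounded f g).

Fact laurentN_bounded f : exists N, zero_below N (fun i => - lcoef f i).
Proof. by case: f => [f [a fa]] /=; exists a => i /fa ->; rewrite oppr0. Qed.
Definition laurentN f := Laurent (laurentN_bounded f).

Fact laurentDA : associative laurentD.
Proof. by move=> f g h; apply: laurentP => i /=; rewrite addrA. Qed.
Fact laurentDC : commutative laurentD.
Proof. by move=> f g; apply: laurentP => i /=; rewrite addrC. Qed.
Fact laurent0D : left_id laurent0 laurentD.
Proof. by move=> f; apply: laurentP => i /=; rewrite add0r. Qed.
Fact laurentND : left_inverse laurent0 laurentN laurentD.
Proof. by move=> f; apply: laurentP => i /=; rewrite addNr. Qed.

HB.instance Definition _ :=
  GRing.isZmodule.Build (laurent k) laurentDA laurentDC laurent0D laurentND.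

Lemma lcoef0 i : lcoef (0 : laurent k) i = 0. Proof. by []. Qed.
Lemma lcoefD f g i : lcoef (f + g) i = lcoef f i + lcoef g i.
Proof. by []. Qed.
Lemma lcoefN f i : lcoef (- f) i = - lcoef f i. Proof. by []. Qed.
Lemma lcoefB f g i : lcoef (f - g) i = lcoef f i - lcoef g i.
Proof. by []. Qed.
End Additive.

Definition box (M : nat) : seq int := [seq i%:Z - M%:Z | i <- iota 0 (M.*2).+1].

Lemma mem_box M i : (i \in box M) = (`|i|%N <= M)%N.
Proof.
apply/mapP/idP => [[j]|]; first by rewrite mem_iota => ? ->; lia.
by move=> iM; exists (absz (i + M%:Z)); [rewrite mem_iota; lia|lia].
Qed.

Lemma box_uniq M : uniq (box M).
Proof. by rewrite map_inj_uniq ?iota_uniq // => i j; lia. Qed.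

Lemma fsum_box (k : nmodType) M (F : int -> k) :
  (forall i, (M < `|i|)%N -> F i = 0) ->
  \sum_(i \in [set: int]) F i = \sum_(i <- box M) F i.
Proof.
move=> FM; rewrite (fsbigE (box M)) ?box_uniq //; last first.
  by move=> i _; rewrite mem_box -ltnNge; apply: FM.
by apply: eq_bigl => i; rewrite in_setT.
Qed.

Section Ring.
Context (k : fieldType).
Implicit Types f g h : laurent k.

Let conv (c d : int -> k) (n : int) : k := \sum_(i \in [set: int]) c i * d (n - i).

Let conv_box a b (c d : int -> k) n M : zero_below a c -> zero_below b d ->
    (`|a| + `|b| + `|n| <= M)%N ->
  conv c d n = \sum_(i <- box M) c i * d (n - i).
Proof.
move=> ca db hM; apply: fsum_box => i Mi.
have [ia|ai] := ltP i a; first by rewrite ca // mul0r.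
by rewrite db ?mulr0 //; lia.
Qed.

Let conv_low a b (c d : int -> k) : zero_below a c -> zero_below b d ->
  zero_below (a + b) (conv c d).
Proof.
move=> ca db n nab; apply: fsbig1 => i _.
have [ia|ai] := ltP i a; first by rewrite ca // mul0r.
by rewrite db ?mulr0 //; lia.
Qed.

Fact laurentM_bounded f g :
  exists N, zero_below N
    (fun n => \sum_(i \in [set: int]) lcoef f i * lcoef g (n - i)).
Proof.
by case: f g => [f [a fa]] [g [b gb]] /=; exists (a + b); apply: conv_low.
Qed.
Definition laurentM f g := Laurent (laurentM_bounded f g).

Fact lmonom_bounded (n : int) :
  exists N, zero_below N (fun i : int => (i == n)%:R : k).
Proof. by exists n => i; rewrite lt_neqAle => /andP[/negbTE ->]. Qed.
Definition lmonom n := Laurent (lmonom_bounded n).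

Fact lconst_bounded (a : k) :
  exists N, zero_below N (fun i : int => if i == 0 then a else 0).
Proof. by exists 0 => i; rewrite lt_neqAle => /andP[/negbTE ->]. Qed.
Definition lconst a := Laurent (lconst_bounded a).

Fact laurentMC : commutative laurentM.
Proof.
move=> f g; apply: laurentP => n /=.
rewrite (reindex_fsbigT (fun i : int => n - i)) //=; last first.
  by exists (fun i : int => n - i) => i; lia.
by apply: eq_fsbigr => i _; rewrite mulrC; congr (lcoef _ _ * _); lia.
Qed.

Fact laurentM1 : left_id (lmonom 0) laurentM.
Proof.
move=> f; apply: laurentP => n /=.
rewrite -(fsbig_widen [set 0] setT) ?fsbig_set1 //= ?eqxx ?mul1r ?subr0 //.
by move=> i [_ /= /eqP/negbTE ->]; rewrite mul0r.
Qed.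

Fact laurentMDl : left_distributive laurentM +%R.
Proof.
case=> [f [a fa]] [g [b gb]] [h [c hc]]; apply: laurentP => n.
set ab := Num.min a b; pose M := (`|ab| + `|c| + `|n|)%N.
have fab : zero_below ab f by apply: zero_below_le fa; rewrite ge_min lexx.
have gab : zero_below ab g by apply: zero_below_le gb; rewrite ge_min lexx orbT.
rewrite lcoefD /= -/(conv _ _ _) -/(conv f h n) -/(conv g h n).
rewrite !(@conv_box ab c _ _ n M) // -?big_split.
  by apply: eq_bigr => i _; rewrite mulrDl.
by move=> i iab; rewrite fab ?gab ?addr0.
Qed.

Fact laurentMA : associative laurentM.
Proof.
case=> [f [a fa]] [g [b gb]] [h [c hc]]; apply: laurentP => n /=.
pose M := (`|a| + `|b| + `|c| + `|n|)%N.
have gh := conv_low gb hc; have fg := conv_low fa gb.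
rewrite -/(conv f (conv g h) n) -/(conv (conv f g) h n).
rewrite (@conv_box a (b + c) _ _ n M) //; last by rewrite /M; lia.
rewrite (@conv_box (a + b) c _ _ n M) //; last by rewrite /M; lia.
transitivity (\sum_(i <- box M) \sum_(j <- box M) f i * g (j - i) * h (n - j)).
  apply: eq_bigr => i _; have [/fa fi0|ai] := ltP i a.
    by rewrite fi0 mul0r big1 // => j _; rewrite !mul0r.
  rewrite /conv (reindex_fsbigT (fun j : int => j - i)) //=; last first.
    by exists (fun j : int => j + i) => j; lia.
  rewrite (fsum_box (M := M)) => [|j Mj]; last first.
    have [/gb ->|] := ltP (j - i) b; first by rewrite mul0r.
    by move=> bij; rewrite hc ?mulr0 //; move: Mj; rewrite /M; lia.
  rewrite big_distrr; apply: eq_bigr => j _ /=.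
  by rewrite mulrA; congr (_ * h _); lia.
rewrite exchange_big; apply: eq_bigr => j _ /=.
have [/hc hj0|cj] := ltP (n - j) c.
  by rewrite hj0 mulr0 big1 // => i _; rewrite mulr0.
rewrite /conv (fsum_box (M := M)) => [|i Mi]; first by rewrite big_distrl.
have [/fa ->|ai] := ltP i a; first by rewrite mul0r.
by rewrite gb ?mulr0 //; move: Mi; rewrite /M; lia.
Qed.

Fact lmonom0_neq0 : lmonom 0 != 0.
Proof.
by apply/eqP => /(congr1 (fun f => lcoef f 0)) /= /eqP; rewrite oner_eq0.
Qed.

HB.instance Definition _ := GRing.Zmodule_isComNzRing.Build (laurent k)
  laurentMA laurentMC laurentM1 laurentMDl lmonom0_neq0.

Lemma lcoefM f g n :
  lcoef (f * g) n = \sum_(i \in [set: int]) lcoef f i * lcoef g (n - i).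
Proof. by []. Qed.

Lemma lcoefM_box a b f g n M : zero_below a (lcoef f) -> zero_below b (lcoef g) ->
    (`|a| + `|b| + `|n| <= M)%N ->
  lcoef (f * g) n = \sum_(i <- box M) lcoef f i * lcoef g (n - i).
Proof. exact: conv_box. Qed.

Lemma zero_belowM a b f g : zero_below a (lcoef f) -> zero_below b (lcoef g) ->
  zero_below (a + b) (lcoef (f * g)).
Proof. exact: conv_low. Qed.

Lemma lcoef_monomM m f n : lcoef (lmonom m * f) n = lcoef f (n - m).
Proof.
rewrite lcoefM -(fsbig_widen [set m] setT) //=; last first.
  by move=> i [_ /= /eqP/negbTE ->]; rewrite mul0r.
by rewrite fsbig_set1 eqxx mul1r.
Qed.

Lemma lmonomD m n : lmonom (m + n) = lmonom m * lmonom n.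
Proof.
by apply: laurentP => i; rewrite lcoef_monomM /= [m + n]addrC subr_eq.
Qed.

Lemma lcoef_constM (a : k) f n : lcoef (lconst a * f) n = a * lcoef f n.
Proof.
rewrite lcoefM -(fsbig_widen [set 0] setT) //=; last first.
  by move=> i [_ /= /eqP/negbTE ->]; rewrite mul0r.
by rewrite fsbig_set1 eqxx subr0.
Qed.

Fact lconst_is_zmod_morphism : zmod_morphism lconst.
Proof. by move=> a b; apply: laurentP => i /=; case: ifP; rewrite ?subr0. Qed.
Fact lconst_is_monoid_morphism : monoid_morphism lconst.
Proof.
split=> [|a b]; apply: laurentP => i; first by rewrite /=; case: ifP.
by rewrite lcoef_constM /=; case: ifP; rewrite ?mulr0.
Qed.
HB.instance Definition _ :=
  GRing.isZmodMorphism.Build k (laurent k) lconst lconst_is_zmod_morphism.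
HB.instance Definition _ :=
  GRing.isMonoidMorphism.Build k (laurent k) lconst lconst_is_monoid_morphism.

(** The order of a Laurent series; [lord 0 = 0] is a default value. *)
Definition lord f : int :=
  xget 0 [set n | lcoef f n != 0 /\ zero_below n (lcoef f)].

Lemma lordP f : f != 0 -> lcoef f (lord f) != 0 /\ zero_below (lord f) (lcoef f).
Proof.
move=> f0; apply: (@xgetPex _ 0 [set n | lcoef f n != 0 /\ zero_below n (lcoef f)]); case: f f0 => [f [a fa]] f0.
have fn : exists n : nat, f (a + n%:Z) != 0.
  case: (pselect (exists n : nat, f (a + n%:Z) != 0)) => // fn.
  case/eqP: f0; apply: laurentP => i /=.
  have [/fa //|ai] := ltP i a; have [//|fi] := eqVneq (f i) 0; case: fn.
  by exists (absz (i - a)); rewrite (_ : a + _ = i) //; lia.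
exists (a + (ex_minn fn)%:Z) => /=; case: ex_minnP => n fn0 nmin; split=> // i ian.
have [/fa //|ai] := ltP i a; have [//|fi] := eqVneq (f i) 0.
have := nmin (absz (i - a)); rewrite (_ : a + _ = i); last by lia.
by move=> /(_ fi); lia.
Qed.

(** Coefficients of the inverse of a power series with invertible constant
    coefficient [c 0], as the list of the first [n] of them. *)
Let inv_rec (c : nat -> k) : nat -> seq k := fix F n :=
  if n is n'.+1 then
    let s := F n' in
    rcons s (if n' is 0 then (c 0)^-1
             else - (c 0)^-1 * \sum_(j < n') c (n' - j)%N * s`_j)
  else [::].

Let inv_rec_size c n : size (inv_rec c n) = n.
Proof. by elim: n => //= n IHn; rewrite size_rcons IHn. Qed.

Let inv_rec_nth c m n j : (j < m)%N -> (m <= n)%N ->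
  (inv_rec c n)`_j = (inv_rec c m)`_j.
Proof.
move=> jm; elim: n => [|n IHn]; first by rewrite leqn0 => /eqP ->.
rewrite leq_eqVlt => /predU1P[-> //|]; rewrite ltnS => mn.
by rewrite [inv_rec c n.+1]/= nth_rcons inv_rec_size (leq_trans jm mn) IHn.
Qed.

Let inv_coef c n := (inv_rec c n.+1)`_n.

Let inv_coefE c n : c 0 != 0 ->
  \sum_(j < n.+1) c (n - j)%N * inv_coef c j = (n == 0)%:R.
Proof.
move=> c0; rewrite big_ord_recr /= subnn /inv_coef [inv_rec c n.+1]/=.
rewrite nth_rcons inv_rec_size ltnn eqxx.
case: n => [|n]; first by rewrite big_ord0 add0r mulfV.
rewrite mulrA mulrN mulfV // mulN1r; apply/eqP; rewrite subr_eq0; apply/eqP.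
apply: eq_bigr => j _; congr (_ * _); symmetry; apply: inv_rec_nth => //.
Qed.

Lemma lcoefM_shift a b f g (n : nat) :
    zero_below a (lcoef f) -> zero_below b (lcoef g) ->
  lcoef (f * g) (a + b + n%:Z) =
  \sum_(j < n.+1) lcoef f (a + j%:Z) * lcoef g (b + (n - j)%N%:Z).
Proof.
move=> fa gb; rewrite lcoefM (fsbigE [seq a + j%:Z | j <- iota 0 n.+1]) //.
- under eq_bigl do rewrite in_setT.
  rewrite big_map -[iota _ _]/(index_iota 0 n.+1) big_mkord.
  by apply: eq_bigr => j _; congr (_ * lcoef g _); have := ltn_ord j; lia.
- by rewrite map_inj_uniq ?iota_uniq // => i j; lia.
move=> i _ iN; have [/fa ->|ai] := ltP i a; first by rewrite mul0r.
have [/gb ->|bi] := ltP (a + b + n%:Z - i) b; first by rewrite mulr0.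
case/mapP: iN; exists (absz (i - a)); last by lia.
by rewrite mem_iota; lia.
Qed.

Fact laurent_inv_ex f : f != 0 -> exists g, g * f = 1.
Proof.
move=> /lordP[]; set a := lord f => fa0 fa.
pose c n := lcoef f (a + n%:Z); have c0 : c 0 != 0 by rewrite /c addr0.
pose d (i : int) := if 0 <= i + a then inv_coef c (absz (i + a)) else 0.
have dP : zero_below (- a) d.
  by move=> i ia; rewrite /d ifF //; apply/negbTE; rewrite -ltNge; lia.
pose g := @Laurent k d (ex_intro _ (- a) dP).
exists g; apply: laurentP => n; have gP : zero_below (- a) (lcoef g) by exact: dP.
have [n0|n0] := ltP n 0.
  rewrite (zero_belowM gP fa) ?addNr //=.
  by rewrite (_ : (n == 0) = false) //; apply/negbTE; lia.
have -> : n = - a + a + (absz n)%:Z by rewrite addNr add0r; lia.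
rewrite lcoefM_shift //= addNr add0r.
under eq_bigr => j _.
  rewrite /d (_ : (0 <= _) = true); last by lia.
  rewrite (_ : absz _ = j); last by lia.
  rewrite mulrC -/(c _); over.
by rewrite inv_coefE.
Qed.

Definition laurentV f : laurent k :=
  if f == 0 then 0 else xget 0 [set g | g * f = 1].

Fact laurentVf f : f != 0 -> laurentV f * f = 1.
Proof.
move=> f0; rewrite /laurentV (negbTE f0).
by apply: (@xgetPex _ 0 [set g | g * f = 1]); apply: laurent_inv_ex.
Qed.
Fact laurentV0 : laurentV 0 = 0.
Proof. by rewrite /laurentV eqxx. Qed.

HB.instance Definition _ :=
  GRing.ComNzRing_isField.Build (laurent k) laurentVf laurentV0.
End Ring.

Section Calculus.
Context (k : fieldType).
Implicit Types f g h : laurent k.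

Fact lderiv_bounded f :
  exists N, zero_below N (fun i => (i + 1)%:~R * lcoef f (i + 1)).
Proof.
case: f => [f [a fa]]; exists (a - 1) => i /= ia.
by rewrite fa ?mulr0 //; lia.
Qed.
Definition lderiv f := Laurent (lderiv_bounded f).

Fact lderivD f g : lderiv (f + g) = lderiv f + lderiv g.
Proof. by apply: laurentP => i /=; rewrite mulrDr. Qed.

Fact lderivM f g : lderiv (f * g) = lderiv f * g + f * lderiv g.
Proof.
case: f g => [f [a fa]] [g [b gb]]; apply: laurentP => n.
pose M := (`|a| + `|b| + `|n| + 2)%N.
rewrite lcoefD [LHS]/= (fsum_box (M := M)) => [|i Mi]; last first.
  have [/fa ->|ai] := ltP i a; first by rewrite mul0r.
  by rewrite gb ?mulr0 //; move: Mi; rewrite /M; lia.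
rewrite ![lcoef (_ * _) _]/=.
rewrite (reindex_fsbigT (fun i : int => i - 1)) //=; last first.
  by exists (fun i : int => i + 1) => i; rewrite ?addrK ?subrK.
rewrite !(fsum_box (M := M)) => [|i Mi|i Mi]; first last.
- rewrite subrK; have [/fa ->|ai] := ltP i a; first by rewrite mulr0 mul0r.
  by rewrite gb ?mulr0 //; move: Mi; rewrite /M; lia.
- have [/fa ->|ai] := ltP i a; first by rewrite mul0r.
  by rewrite gb ?mulr0 //; move: Mi; rewrite /M; lia.
rewrite -big_split big_distrr; apply: eq_bigr => i _ /=.
rewrite subrK (_ : n - (i - 1) = n + 1 - i); last by lia.
rewrite (_ : n - i + 1 = n + 1 - i); last by lia.
rewrite [(n + 1 - i)%:~R]intrB; ring.
Qed.

(** [lexpand q_gt0 f] is [f(t^q)]: under [x = t^q] it realizes the inclusion of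
    [k((x))] in [k((t)) = k((x^(1/q)))]. *)
Context (q : nat) (q_gt0 : (0 < q)%N).

Fact lexpand_bounded f :
  exists N, zero_below N
    (fun i => if (q %| i)%Z then lcoef f (i %/ q)%Z else 0).
Proof.
case: f => [f [a fa]]; exists (a * q%:Z) => i ia /=; case: ifP => // _.
by rewrite fa // ltz_divLR.
Qed.
Definition lexpand f := Laurent (lexpand_bounded f).

Lemma lcoef_expandM h v n :
  lcoef (lexpand h * v) n =
  \sum_(m \in [set: int]) lcoef h m * lcoef v (n - q%:Z * m).
Proof.
have q0 : q%:Z != 0 by lia.
rewrite lcoefM -(fsbig_widen [set q%:Z * m | m in [set: int]] setT) //; last first.
  move=> i [_ Ni] /=; case: ifP => [/dvdzP[m im]|]; last by rewrite mul0r.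
  by case: Ni; exists m => //; rewrite mulrC im.
rewrite fsbig_image; last by move=> i j _ _ /(mulfI q0).
by apply: eq_fsbigr => m _ /=; rewrite dvdz_mulr // mulKz.
Qed.

Fact lexpand_is_zmod_morphism : zmod_morphism lexpand.
Proof. by move=> f g; apply: laurentP => i /=; case: ifP; rewrite ?subr0. Qed.
Fact lexpand_is_monoid_morphism : monoid_morphism lexpand.
Proof.
have q0 : q%:Z != 0 by lia.
split=> [|f g]; apply: laurentP => n.
  rewrite /=; case: ifP => [/dvdzP[m ->]|]; first by rewrite mulzK // mulf_eq0 (negbTE q0) orbF.
  by case: eqP => // ->; rewrite dvdz0.
rewrite lcoef_expandM /=; case: ifPn => [/dvdzP[m ->]|qn].
  rewrite mulzK //; apply: eq_fsbigr => i _ /=.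
  by rewrite [m * _]mulrC -mulrBr dvdz_mulr // mulKz.
rewrite fsbig1 // => i _; rewrite ifF ?mulr0 //.
by apply/negbTE; rewrite rpredBr // dvdz_mulr.
Qed.
HB.instance Definition _ := GRing.isZmodMorphism.Build (laurent k) (laurent k)
  lexpand lexpand_is_zmod_morphism.
HB.instance Definition _ := GRing.isMonoidMorphism.Build (laurent k) (laurent k)
  lexpand lexpand_is_monoid_morphism.

Lemma lderiv_expand h :
  lderiv (lexpand h) =
  lconst q%:R * lmonom k (q%:Z - 1) * lexpand (lderiv h).
Proof.
have q0 : q%:Z != 0 by lia.
apply: laurentP => n; rewrite -mulrA lcoef_constM lcoef_monomM /=.
have -> : n - (q%:Z - 1) = (n + 1) - q%:Z by lia.
rewrite rpredBr //; case: ifP => [/dvdzP[m ->]|_]; last by rewrite !mulr0.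
rewrite (_ : m * q%:Z - q%:Z = (m - 1) * q%:Z); last by lia.
rewrite !mulzK // subrK.
by rewrite intrM mulrA [q%:R * _]mulrC.
Qed.

Lemma lderiv_const (a : k) : lderiv (lconst a) = 0.
Proof.
apply: laurentP => i /=; case: eqP => [->|]; rewrite ?mulr0 //.
exact: mul0r.
Qed.
End Calculus.

(** [K_q = k((x^(1/q)))], coordinatized by [t = x^(1/q)], as a vector space over
    [K = k((x))]. *)
Definition ramified (k : fieldType) (q : nat) (q_gt0 : (0 < q)%N) := laurent k.

Section Ramified.
Context (k : fieldType) (q : nat) (q_gt0 : (0 < q)%N).
Local Notation Kq := (@ramified k q q_gt0).

HB.instance Definition _ := GRing.Field.on Kq.

Definition ramified_scale (h : laurent k) (v : Kq) : Kq := lexpand q_gt0 h * v.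

Fact ramified_scaleA a b v :
  ramified_scale a (ramified_scale b v) = ramified_scale (a * b) v.
Proof. by rewrite /ramified_scale rmorphM mulrA. Qed.
Fact ramified_scale1 : left_id 1 ramified_scale.
Proof. by move=> v; rewrite /ramified_scale rmorph1 mul1r. Qed.
Fact ramified_scaleDr : right_distributive ramified_scale +%R.
Proof. by move=> a v w; rewrite /ramified_scale mulrDr. Qed.
Fact ramified_scaleDl v : {morph ramified_scale^~ v : a b / a + b}.
Proof. by move=> a b; rewrite /ramified_scale rmorphD mulrDl. Qed.

HB.instance Definition _ := GRing.Zmodule_isLmodule.Build (laurent k) Kq
  ramified_scaleA ramified_scale1 ramified_scaleDr ramified_scaleDl.

Lemma ramified_scaleE (h : laurent k) (v : Kq) : h *: v = lexpand q_gt0 h * v.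
Proof. by []. Qed.

(** The basis is [1, t, ..., t^(q-1)]. *)
Fact slice_bounded (v : Kq) (j : 'I_q) :
  exists N, zero_below N (fun n => lcoef v (n * q%:Z + j%:Z)).
Proof.
case: v => [v [a va]] /=; exists (- (absz a)%:Z - 1) => n na.
by apply: va; have := ltn_ord j; nia.
Qed.
Definition slices (v : Kq) : 'rV[laurent k]_q :=
  \row_j Laurent (slice_bounded v j).

Fact slices_linear : linear slices.
Proof.
move=> a v w; apply/rowP => j; rewrite !mxE; apply: laurentP => n.
transitivity (lcoef (lexpand q_gt0 a * v) (n * q%:Z + j%:Z) +
              lcoef w (n * q%:Z + j%:Z)) => //.
rewrite lcoef_expandM lcoefD lcoefM; congr (_ + _).
apply: eq_fsbigr => i _ /=; congr (_ * lcoef _ _); lia.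
Qed.

Fact slices_bijective : bijective slices.
Proof.
have q0 : q%:Z != 0 by lia.
have modq n : (absz (n %% q%:Z)%Z < q)%N.
  by have := ltz_pmod n (d := q%:Z); have := modz_ge0 n q0; lia.
pose c (w : 'rV[laurent k]_q) (n : int) :=
  lcoef (w 0 (Ordinal (modq n))) (n %/ q%:Z)%Z.
have cP w : exists N, zero_below N (c w).
  have /choice[b wb] j := lcoef_bounded (w 0 j).
  exists (- (\sum_j (absz (b j))%:Z) * q%:Z - q%:Z) => n nlt.
  apply: wb; set j := Ordinal _.
  have bj : (absz (b j))%:Z <= \sum_j (absz (b j))%:Z.
    by rewrite (bigD1 j) //= lerDl sumr_ge0.
  rewrite ltz_divLR; last by lia.
  nia.
exists (fun w => Laurent (cP w)) => [v|w].
  apply: laurentP => n; rewrite /= /c mxE /=.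
  congr (lcoef v _); rewrite [RHS](divz_eq n q%:Z); congr (_ + _).
  by have := modz_ge0 n q0; lia.
apply/rowP => j; rewrite mxE; apply: laurentP => n; rewrite /= /c.
have jq : (j%:Z %/ q%:Z)%Z = 0 by apply: divz_small; have := ltn_ord j; lia.
have mj : ((n * q%:Z + j%:Z) %% q%:Z)%Z = j%:Z.
  by rewrite modzMDl modz_small //; have := ltn_ord j; lia.
rewrite divzMDl // jq addr0; congr (lcoef (w 0 _) n); apply: val_inj => /=.
by rewrite mj.
Qed.

HB.instance Definition _ := Lmodule_hasFinDim.Build (laurent k) Kq
  (exist2 _ _ slices slices_linear slices_bijective : Vector.axiom q Kq).
End Ramified.

Section Convergence.
Context (k : fieldType).

(** Convergence of a sequence in the [x]-adic topology of [k((x))]. *)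
Definition lcvg (f_ : nat -> laurent k) (f : laurent k) : Prop :=
  forall N : int, exists n0 : nat, forall n, (n0 <= n)%N ->
    zero_below N (lcoef (f_ n - f)).

(** [F(u)], the sum of the series [\sum_i F_i u^i]; it converges when [u] has
    positive order. *)
Definition lcomp (F u : laurent k) : laurent k :=
  xget 0 [set w | lcvg (fun n => \sum_(j < n)
    lconst (lcoef F (lord F + j%:Z)) * u ^ (lord F + j%:Z)) w].

(** Convergence in a finite-dimensional [k((x))]-vector space: coordinatewise,
    the basis being irrelevant. *)
Definition vcvg (V : vectType (laurent k)) (v_ : nat -> V) (v : V) : Prop :=
  forall i, lcvg (fun n => coord (vbasis {:V}) i (v_ n))
                 (coord (vbasis {:V}) i v).
End Convergence.

Definition is_connection (k : fieldType) (V : lmodType (laurent k))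
    (D : V -> V) : Prop :=
  (forall (a : k) v w, D (lconst a *: v + w) = lconst a *: D v + D w) /\
  (forall (h : laurent k) v, D (h *: v) = h *: D v + lderiv h *: v).

Record connection (k : fieldType) := Connection {
  cn_space :> vectType (laurent k);
  nabla : cn_space -> cn_space;
  nablaP : is_connection nabla }.

Arguments nabla {k} c v.

Section Category.
Context (k : fieldType).
Implicit Types E S U : connection k.

Definition horizontal E S (phi : 'Hom(E, S)) : Prop :=
  forall v, phi (nabla E v) = nabla S (phi v).

Definition connection_iso E S : Prop :=
  exists phi : 'Hom(E, S), horizontal phi /\ bijective phi.

Definition irreducible E : Prop :=
  ({:E} != 0)%VS /\
  forall W : {vspace E}, (forall v, v \in W -> nabla E v \in W) ->
    W = 0%VS \/ W = {:E}%VS.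

(** [S] is a subquotient of [E]: a quotient of a subobject [U]. *)
Definition subquotient S E : Prop :=
  exists U (i : 'Hom(U, E)) (p : 'Hom(U, S)),
    [/\ horizontal i, injective i, horizontal p & forall s, exists u, p u = s].

Definition irreducible_component S E : Prop := irreducible S /\ subquotient S E.

Fact zero_is_connection : is_connection (id : 'rV[laurent k]_0 -> 'rV[laurent k]_0).
Proof. by split=> *; apply/rowP; case. Qed.
Definition zero_connection : connection k := Connection zero_is_connection.
End Category.

Section Elementary.
Context (k : fieldType) (k_char0 : [pchar k] =i pred0).
Context (q : nat) (q_gt0 : (0 < q)%N).
Local Notation Kq := (@ramified k q q_gt0).

(** [d/dx] on [K_q]: by the chain rule for [x = t^q], it is
    [(1/q) t^(1-q) d/dt]. *)
Definition ramified_deriv (v : Kq) : Kq :=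
  lconst (q%:R^-1) * lmonom k (1 - q%:Z) * lderiv v.

(** The operator [d/dx + x^-1 f]; the scaling by [lmonom k (-1)] is by [x^-1],
    an element of [K]. *)
Definition E_nabla (f v : Kq) : Kq :=
  ramified_deriv v + lmonom k (-1) *: (f * v).

Fact E_is_connection (f : Kq) : is_connection (E_nabla f).
Proof.
have q0 : q%:R != 0 :> k by move/pcharf0P: k_char0 => ->; rewrite -lt0n.
have key h v : E_nabla f (h *: v) = h *: E_nabla f v + lderiv h *: v.
  rewrite /E_nabla /ramified_deriv !ramified_scaleE lderivM lderiv_expand.
  set c := lconst q%:R^-1; set C := lconst q%:R.
  set m := lmonom k (1 - q%:Z); set M := lmonom k (q%:Z - 1).
  have cC : c * C = 1 by rewrite -rmorphM mulVf ?rmorph1.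
  have mM : m * M = 1 by rewrite -lmonomD addrC subrKA subrr.
  transitivity (c * C * (m * M) * lexpand q_gt0 (lderiv h) * v
     + lexpand q_gt0 h * (c * m * lderiv v
     + lexpand q_gt0 (lmonom k (-1)) * (f * v))); first by ring.
  by rewrite cC mM; ring.
have addE v w : E_nabla f (v + w) = E_nabla f v + E_nabla f w.
  by rewrite /E_nabla /ramified_deriv lderivD !mulrDr scalerDr addrACA.
split=> // a v w; rewrite addE key; congr (_ + _).
by rewrite lderiv_const scale0r addr0.
Qed.

Definition E_ (f : Kq) : connection k := Connection (E_is_connection f).

Definition ramified_ord (f : Kq) : rat := (lord f)%:~R / q%:R.
End Elementary.

Arguments ramified_ord {k q} q_gt0 f.

(** Membership in [C^{>1}]; the irreducible connection [E_f] has slope [- ord f].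
    As [ramified_ord 0 = 0], the zero series is never counted as having order
    [< -1]. *)
Definition slopes_gt1 (k : fieldType) (k_char0 : [pchar k] =i pred0)
    (E : connection k) : Prop :=
  forall S : connection k, irreducible_component S E ->
    exists (q : nat) (q_gt0 : (0 < q)%N) (f : ramified k q_gt0),
      connection_iso S (E_ k_char0 f) /\ ramified_ord q_gt0 f < -1.

Section Orbits.
Context (k : fieldType) (q : nat) (q_gt0 : (0 < q)%N).
Implicit Types f g h : ramified k q_gt0.

Fact ltwist_bounded (eta : k) f :
  exists N, zero_below N (fun i => eta ^ i * lcoef f i).
Proof. by case: f => [f [a fa]]; exists a => i /fa /= ->; rewrite mulr0. Qed.
Definition ltwist eta f : ramified k q_gt0 := Laurent (ltwist_bounded eta f).

(** The orbits of this relation form [R_q]: [f] and [eta g] agree modulo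
    [t k[[t]] + (1/q)Z] for some [q]-th root of unity [eta]. *)
Definition same_orbit_prop f g : Prop :=
  exists (eta : k) (m : int), eta ^+ q = 1 /\
    zero_below 1 (lcoef (f - ltwist eta g - lconst (m%:~R / q%:R))).

Definition same_orbit : rel (ramified k q_gt0) :=
  fun f g => `[< same_orbit_prop f g >].

Let same_orbitE f g : same_orbit_prop f g <->
  exists (eta : k) (m : int), eta ^+ q = 1 /\
    forall i, i < 1 ->
      lcoef f i = eta ^ i * lcoef g i + (if i == 0 then m%:~R / q%:R else 0).
Proof.
split=> -[eta [m [etaq fg]]]; exists eta, m; split=> // i i1.
  by apply/eqP; rewrite -subr_eq0 opprD addrA; apply/eqP; apply: fg.
by rewrite !lcoefB (fg i i1) /= -addrA -opprD subrr.
Qed.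

Let root_neq0 (eta : k) : eta ^+ q = 1 -> eta != 0.
Proof.
move=> etaq; apply/eqP => eta0; move/eqP: etaq.
by rewrite eta0 expr0n gtn_eqF // eq_sym oner_eq0.
Qed.

Fact same_orbit_refl : reflexive same_orbit.
Proof.
move=> f; apply/asboolP/same_orbitE; exists 1, 0; split=> [|i _].
  exact: expr1n.
by rewrite exp1rz mul1r mul0r if_same addr0.
Qed.

Fact same_orbit_sym : symmetric same_orbit.
Proof.
suff sym f g : same_orbit f g -> same_orbit g f.
  by move=> f g; apply/idP/idP; apply: sym.
move=> /asboolP/same_orbitE[eta [m [etaq fg]]]; have eta0 := root_neq0 etaq.
apply/asboolP/same_orbitE; exists eta^-1, (- m); split=> [|i i1].
  by rewrite exprVn etaq invr1.
rewrite (fg i i1) mulrDr mulrA -expfzMl mulVf // exp1rz mul1r.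
case: eqP => [->|]; last by rewrite mulr0 !addr0.
by rewrite expr0z mul1r mulrNz mulNr addrK.
Qed.

Fact same_orbit_trans : transitive same_orbit.
Proof.
move=> g f h /asboolP/same_orbitE[eta [m [etaq fg]]].
move=> /asboolP/same_orbitE[theta [n [thetaq gh]]].
apply/asboolP/same_orbitE; exists (eta * theta), (m + n); split=> [|i i1].
  by rewrite exprMn etaq thetaq mulr1.
rewrite (fg i i1) (gh i i1) mulrDr mulrA -expfzMl -addrA; congr (_ + _).
case: eqP => [->|]; last by rewrite mulr0 addr0.
by rewrite expr0z mul1r rmorphD mulrDl addrC.
Qed.

Canonical same_orbit_equiv :=
  EquivRel same_orbit same_orbit_refl same_orbit_sym same_orbit_trans.

Definition orbits := {eq_quot same_orbit_equiv}.
HB.instance Definition _ := EqQuotient.on orbits.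

(** [f] lies in [K_q'], inside a common extension of [K_q] and [K_q']:
    every exponent [i/q] of [f] belongs to [(1/q')Z]. *)
Definition in_ramified (q' : nat) f : Prop :=
  forall i, lcoef f i != 0 -> (q%:Z %| i * q'%:Z)%Z.

(** The subset [R_q^o] of [R_q]. *)
Definition primitive_orbit (c : orbits) : Prop :=
  forall q', (0 < q' < q)%N ->
    forall f, \pi_(orbits) f = c -> ~ in_ramified q' f.

(** Independent of the representative as soon as it is negative. *)
Definition orbit_ord (c : orbits) : rat := ramified_ord q_gt0 (repr c).
End Orbits.

Arguments orbits k {q} q_gt0.

Section Fourier.
Context (k : fieldType) (E : connection k).

(** [zhat = zeta^2 nabla_zeta]; the coordinate of [laurent k] acting on [E] is
    [zeta]. *)
Definition zhat (v : E) : E := lmonom k 2 *: nabla E v.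

(** [nablahat = - zetahat^-2 zeta^-1]. *)
Definition nablahat (v : E) : E := - zhat (zhat (lmonom k (-1) *: v)).

(** Integer powers of [zetahat], whose inverse is [zhat]. *)
Definition zetahat_exp (zetahat : E -> E) (i : int) (v : E) : E :=
  match i with
  | Posz n => iter n zetahat v
  | Negz n => iter n.+1 zhat v
  end.

(** The extension of [zetahat := zhat^-1] to an action of [k((zetahat))]: a series
    in [zetahat] acts as the [zeta]-adic limit of its partial sums. *)
Record hat_action := HatAction {
  zetahat : E -> E;
  zetahatK : cancel zetahat zhat;
  zhatK : cancel zhat zetahat;
  hat_act : laurent k -> E -> E;
  hat_act_cvg : forall h v,
    vcvg (fun n => \sum_(j < n) lconst (lcoef h (lord h + j%:Z)) *:
                     zetahat_exp zetahat (lord h + j%:Z) v)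
         (hat_act h v);
  hat_actA : forall a b v, hat_act a (hat_act b v) = hat_act (a * b) v;
  hat_act1 : left_id 1 hat_act;
  hat_actDr : right_distributive hat_act +%R;
  hat_actDl : forall v, {morph hat_act^~ v : a b / a + b} }.

Definition hat_space (A : hat_action) : Type := E.

HB.instance Definition _ A := GRing.Zmodule.on (hat_space A).
HB.instance Definition _ A := GRing.Zmodule_isLmodule.Build (laurent k)
  (hat_space A) (@hat_actA A) (@hat_act1 A) (@hat_actDr A) (@hat_actDl A).

Record fourier_structure := FourierStructure {
  fs_action : hat_action;
  fs_dim : nat;
  fs_findim : Vector.axiom fs_dim (hat_space fs_action);
  fs_connection : is_connection (nablahat : hat_space fs_action -> _) }.

Definition fourier_space (S : fourier_structure) : Type :=
  hat_space (fs_action S).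
HB.instance Definition _ S := GRing.Lmodule.on (fourier_space S).
HB.instance Definition _ S :=
  Lmodule_hasFinDim.Build (laurent k) (fourier_space S) (fs_findim S).

Definition fourier_connection (S : fourier_structure) : connection k :=
  @Connection k (fourier_space S) nablahat (fs_connection S).

(** The structure above is unique when it exists, and it does on [C^{>1}];
    outside its domain the transform takes the value [0], so that an
    isomorphism with a nonzero connection entails that it is defined. *)
Definition local_fourier : connection k :=
  match pselectT fourier_structure with
  | inr fs => fourier_connection fs
  | inl _ => zero_connection k
  end.
End Fourier.

(** [u], in [k((zetahat^(1/d)))], is a solution for [zeta^(1/r)] of [f = z zhat],
    rewritten as [zeta f = zetahat^-1]. *)
Definition fourier_solution (k : fieldType) (r d : nat) (d_gt0 : (0 < d)%N)
    (F : laurent k) (u : ramified k d_gt0) : Prop :=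
  ramified_ord d_gt0 u = d%:R^-1 /\
  u ^+ r * lcomp F u = lexpand d_gt0 (lmonom k (-1)).

Lemma subn_pos (r s : nat) : (r < s)%N -> (0 < s - r)%N.
Proof. by rewrite subn_gt0. Qed.

(* Main.v *)
(** Let [d = s - r] and let [P = zeta^2 nabla] act on [k((t))], [t = zeta^(1/r)]. Substituting the
    solution [u] of [u^r F(u) = tau^-d] for [t] turns [P] into [tau^-d + phi D], where [D] is
    [tau d/dtau] and [phi] has order [r]. Such an operator is conjugate to multiplication by
    [tau^-d]: there is [Phi = 1 + c tau^s + ...], with coefficients polynomial in [D], such that
    [P Phi = Phi tau^-d]. Then [- Phi^-1 zeta^-1 Phi] and [tau^d D / d] have the same commutator
    with [tau^-d], so their difference is an operator with polynomial coefficients commuting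
    with [tau^-d], that is, multiplication by a series [tau^d G]; this says that [Phi] identifies
    [E_G] with the Fourier transform of [E_F]. The polynomial [c] is quadratic in [D], and
    comparing terms of relative order [s] gives [G = - F(u) + (d - r)/(2d)] modulo
    [tau k[[tau]]], where [(d - r)/(2d) = s/(2d) - r/d].

    Since the Galois group acts freely on the class of [F], a shortest relation
    [\sum_j c_j sigma_j(w) = 0] on a proper stable subspace must have a single term; hence
    [E_F] is irreducible, which gives the slopes. *)
Require Import Defs.
From HB Require Import structures.
From mathcomp Require Import all_boot all_order all_algebra.
From mathcomp Require Import boolp classical_sets fsbigop.
From mathcomp Require Import zify ring.
From mathcomp Require cyclic separable cyclotomic.

Set Implicit Arguments.
Unset Strict Implicit.
Unset Printing Implicit Defensive.

Import Order.TTheory GRing.Theory Num.Theory.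
Local Open Scope ring_scope.
Local Open Scope quotient_scope.

(** Polynomiality is what makes the normal form rigid. On monomials, commutation with [tau^-d] is a
    difference equation in the exponent [n], solvable only up to arbitrary [d]-periodic functions of
    [n]; a [d]-periodic polynomial is constant in characteristic zero, so the ambiguity shrinks to
    multiplication by a series. Hence operators are [k]-linear maps of bounded degree, known from
    their values on monomials, and [D] enters through its eigenvalue [n] on [t^n]. The class of [g]
    must also survive a change of [F]. Adding [m/r] to [F] moves [u] to [u(1 + x)] with [x] of order
    at least [s] and [d x F(u) = m/r] to leading order, so the value of [F] changes by
    [m/r - s x F(u) = - m/d], an element of [(1/d)Z]. Similar estimates show that a root of unity
    fixing the class of [g] also fixes that of [F], so freeness passes to [g]. The transform is
    chosen among all admissible structures, so constructing one is not enough: any other agrees with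
    it because the inverse of [zhat] and limits are unique. *)

Local Notation vge N v := (zero_below N (lcoef v)).

(** * Orders and leading coefficients of Laurent series *)

Section Order.
Context (k : fieldType).
Implicit Types (f g h u v w : laurent k) (N M n m : int).

(** The coefficient [c] may be zero, so that leading terms propagate without case distinctions;
    nonvanishing is assumed separately wherever the exact order matters. *)
Definition lead n (c : k) v := vge n v /\ lcoef v n = c.

Lemma lcoef_sum I (r : seq I) (P : pred I) (F : I -> laurent k) n :
  lcoef (\sum_(i <- r | P i) F i) n = \sum_(i <- r | P i) lcoef (F i) n.
Proof. exact: (big_morph (fun v => lcoef v n)). Qed.

Lemma lcoef_monom n m : lcoef (lmonom k n) m = (m == n)%:R.
Proof. by []. Qed.

Lemma lmonom0 : lmonom k 0 = 1. Proof. by []. Qed.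

Lemma lcoef1 m : lcoef (1 : laurent k) m = (m == 0)%:R.
Proof. by []. Qed.

Lemma vge0 N : vge N (0 : laurent k). Proof. by []. Qed.

Lemma vgeD N f g : vge N f -> vge N g -> vge N (f + g).
Proof. by move=> fN gN i iN; rewrite lcoefD fN // gN // addr0. Qed.

Lemma vgeN N f : vge N f -> vge N (- f).
Proof. by move=> fN i iN; rewrite lcoefN fN // oppr0. Qed.

Lemma vgeB N f g : vge N f -> vge N g -> vge N (f - g).
Proof. by move=> fN /vgeN; apply: vgeD. Qed.

Lemma vgeBC N f g : vge N (f - g) -> vge N (g - f).
Proof. by move=> /vgeN; rewrite opprB. Qed.

Lemma vge_trans N f g h : vge N (f - g) -> vge N (g - h) -> vge N (f - h).
Proof. by move=> fg /(vgeD fg); rewrite addrA subrK. Qed.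

Lemma vge_sum N I (r : seq I) (P : pred I) (F : I -> laurent k) :
  (forall i, P i -> vge N (F i)) -> vge N (\sum_(i <- r | P i) F i).
Proof. by move=> FN n nN; rewrite lcoef_sum big1 // => i /FN ->. Qed.

Lemma vge_monom n : vge n (lmonom k n).
Proof. by move=> i /lt_eqF /= ->. Qed.

Lemma vge_const (a : k) : vge 0 (lconst a).
Proof. by move=> i /lt_eqF /= ->. Qed.

Lemma vge1 : vge 0 (1 : laurent k).
Proof. exact: vge_monom. Qed.

Lemma vgeM a b c f g : vge a f -> vge b g -> c <= a + b -> vge c (f * g).
Proof. by move=> fa gb cab; apply: zero_below_le cab (zero_belowM fa gb). Qed.

Lemma vgeZ N (a : k) f : vge N f -> vge N (lconst a * f).
Proof. by move=> fN; apply: vgeM (@vge_const a) fN _; rewrite add0r. Qed.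

Lemma vge_monomM N m f : vge N (lmonom k m * f) <-> vge (N - m) f.
Proof.
split=> fN i iN; last by rewrite lcoef_monomM fN //; lia.
by have := fN (i + m); rewrite lcoef_monomM addrK; apply; lia.
Qed.

Lemma vgeS n f : vge n f -> lcoef f n = 0 -> vge (n + 1) f.
Proof.
move=> fn f0 i; rewrite ltzD1 le_eqVlt => /predU1P[-> //|]; exact: fn.
Qed.

Lemma vge_all f : (forall n, vge n f) -> f = 0.
Proof. by move=> f0; apply: laurentP => i; rewrite (f0 (i + 1)) //; lia. Qed.

Lemma vge_lord f : vge (lord f) f.
Proof. by have [->|/lordP[]] := eqVneq f 0. Qed.

Lemma lord_lead f : f != 0 -> exists2 c, c != 0 & lead (lord f) c f.
Proof. by move=> /lordP[c0 fl]; exists (lcoef f (lord f)). Qed.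

Lemma lead_neq0 n c f : lead n c f -> c != 0 -> f != 0.
Proof. by move=> [_ <-]; apply: contraNneq => ->. Qed.

Lemma lead_lord n c f : lead n c f -> c != 0 -> lord f = n.
Proof.
move=> fn c0; have := lead_neq0 fn c0; case: fn => fn <- in c0 *.
move=> /lordP[l0 fl]; apply/eqP; rewrite eq_le; apply/andP; split; rewrite leNgt.
  by apply: contra_neqN c0 => /fl.
by apply: contra_neqN l0 => /fn.
Qed.

Lemma leadP n c f : lead n c f <-> vge (n + 1) (f - lconst c * lmonom k n).
Proof.
split=> [[fn fc]|fn].
  apply: vgeS; first by apply: vgeB fn (vgeZ _ (@vge_monom n)).
  by rewrite lcoefB lcoef_constM lcoef_monom eqxx mulr1 fc subrr.
split=> [i iN|]; apply/eqP; rewrite -subr_eq0.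
  by have := fn i; rewrite lcoefB lcoef_constM lcoef_monom lt_eqF // mulr0 => ->//; lia.
by have := fn n; rewrite lcoefB lcoef_constM lcoef_monom eqxx mulr1 => ->//; lia.
Qed.

Lemma lead_add n c f g : lead n c f -> vge (n + 1) (g - f) -> lead n c g.
Proof. by move=> /leadP fn gf; apply/leadP; apply: vge_trans gf fn. Qed.

Lemma lead_monom n : lead n 1 (lmonom k n).
Proof. by split; [exact: vge_monom | rewrite lcoef_monom eqxx]. Qed.

Lemma lead_const c : lead 0 c (lconst c).
Proof. by split; [exact: vge_const|]. Qed.

Lemma lead1 : lead 0 1 (1 : laurent k).
Proof. exact: lead_monom. Qed.

Lemma leadM a b x y f g : lead a x f -> lead b y g -> lead (a + b) (x * y) (f * g).
Proof.
move=> [fa <-] [gb <-]; split; first exact: zero_belowM.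
rewrite -[a + b]addr0 -[0]/(0%:Z) lcoefM_shift // big_ord_recl big_ord0 /=.
by rewrite !addr0.
Qed.

Lemma leadN a x f : lead a x f -> lead a (- x) (- f).
Proof. by move=> [fa <-]; split; [exact: vgeN|]. Qed.

Lemma leadZ a x c f : lead a x f -> lead a (c * x) (lconst c * f).
Proof. by move=> fa; rewrite -[a]add0r; apply: leadM (lead_const c) fa. Qed.

Lemma leadV a x f : x != 0 -> lead a x f -> lead (- a) x^-1 f^-1.
Proof.
move=> x0 fa; have f0 := lead_neq0 fa x0.
have [y y0 gy] := lord_lead (invr_neq0 f0).
have := leadM fa gy; rewrite divff // => -[h0 h1].
have e : a + lord f^-1 = 0.
  apply/eqP; move: h1 (mulf_neq0 x0 y0) => <-; rewrite lcoef1.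
  by case: (a + _ == 0) => //=; rewrite eqxx.
move: h1; rewrite e lcoef1 eqxx => xy.
by rewrite -(mulKf x0 y) -xy mulr1 in gy; rewrite (_ : - a = lord f^-1) //; lia.
Qed.

Lemma leadX a x f (n : nat) : lead a x f -> lead (n%:Z * a) (x ^+ n) (f ^+ n).
Proof.
move=> fa; elim: n => [|n IHn]; first by rewrite mul0r; exact: lead1.
by rewrite !exprS intS mulrDl mul1r; apply: leadM.
Qed.

Lemma leadXz a x f n : x != 0 -> lead a x f -> lead (n * a) (x ^ n) (f ^ n).
Proof.
move=> x0 fa; case: n => n; first exact: leadX.
rewrite NegzE mulNr -!exprnN; apply: leadV; first by rewrite expf_neq0.
exact: leadX.
Qed.

Lemma leadXz1 u e n : e != 0 -> lead 1 e u -> lead n (e ^ n) (u ^ n).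
Proof. by move=> e0 /(leadXz n e0); rewrite mulr1. Qed.

Lemma lmonomV n : (lmonom k n)^-1 = lmonom k (- n).
Proof.
have n0 := lead_neq0 (lead_monom n) (oner_neq0 _).
by apply: (mulfI n0); rewrite divff // -lmonomD subrr.
Qed.

Lemma lmonomX n (m : nat) : lmonom k n ^+ m = lmonom k (n * m%:Z).
Proof.
elim: m => [|m IHm]; first by rewrite mulr0.
by rewrite exprS IHm intS mulrDr mulr1 lmonomD.
Qed.

Lemma lmonomXz n m : lmonom k n ^ m = lmonom k (n * m).
Proof.
by case: m => m; rewrite ?NegzE -?exprnP ?lmonomX // -exprnN lmonomX lmonomV -mulrN.
Qed.

Lemma lmonom_neq0 n : lmonom k n != 0.
Proof. exact: lead_neq0 (lead_monom n) (oner_neq0 _). Qed.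

End Order.
Arguments vge_lord {k} f [i] _.
Arguments vge_monom {k} n [i] _.
Arguments vge_const {k} a [i] _.

(** * Filtered operators *)

Section Filtered.
Context (k : fieldType).
Implicit Types (f g h u v w : laurent k) (N M n m : int) (A B : laurent k -> laurent k).

Definition klinear A :=
  forall a v w, A (lconst a * v + w) = lconst a * A v + A w.

Definition filtered N A := forall M v, vge M v -> vge (M + N) (A v).

Section KLinear.
Context (A : laurent k -> laurent k) (A_lin : klinear A).

Lemma klinearD v w : A (v + w) = A v + A w.
Proof. by have := A_lin 1 v w; rewrite rmorph1 !mul1r. Qed.

Lemma klinear0 : A 0 = 0.
Proof. by apply: (addrI (A 0)); rewrite -klinearD !addr0. Qed.

Lemma klinearZ a v : A (lconst a * v) = lconst a * A v.
Proof. by rewrite -[_ * v]addr0 A_lin klinear0 addr0. Qed.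

Lemma klinearN v : A (- v) = - A v.
Proof. by apply: (addrI (A v)); rewrite -klinearD !subrr klinear0. Qed.

Lemma klinearB v w : A (v - w) = A v - A w.
Proof. by rewrite klinearD klinearN. Qed.

Lemma klinear_sum I (r : seq I) (P : pred I) (F : I -> laurent k) :
  A (\sum_(i <- r | P i) F i) = \sum_(i <- r | P i) A (F i).
Proof. exact: (big_morph A klinearD klinear0). Qed.
End KLinear.

Lemma klinear_id : klinear id. Proof. by []. Qed.

Lemma klinear_comp A B : klinear A -> klinear B -> klinear (A \o B).
Proof. by move=> hA hB a v w /=; rewrite hB hA. Qed.

Lemma klinear_add A B : klinear A -> klinear B -> klinear (fun v => A v + B v).
Proof. by move=> hA hB a v w; rewrite hA hB mulrDr addrACA. Qed.

Lemma klinear_sub A B : klinear A -> klinear B -> klinear (fun v => A v - B v).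
Proof. by move=> hA hB a v w; rewrite hA hB mulrBr opprD addrACA. Qed.

Lemma klinear_mul h A : klinear A -> klinear (fun v => h * A v).
Proof. by move=> hA a v w; rewrite hA mulrDr mulrCA. Qed.

Lemma klinear_premul h A : klinear A -> klinear (fun v => A (h * v)).
Proof. by move=> hA a v w; rewrite mulrDr mulrCA hA. Qed.

Lemma filtered_id : filtered 0 id.
Proof. by move=> M v; rewrite addr0. Qed.

Lemma filtered_le N M A : M <= N -> filtered N A -> filtered M A.
Proof. by move=> MN hA m v /hA; apply: zero_below_le; rewrite lerD2l. Qed.

Lemma filtered_comp N M A B : filtered N A -> filtered M B -> filtered (M + N) (A \o B).
Proof. by move=> hA hB m v /hB /hA; rewrite addrA. Qed.

Lemma filtered_add N A B : filtered N A -> filtered N B -> filtered N (fun v => A v + B v).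
Proof. by move=> hA hB m v vm; apply: vgeD; [apply: hA|apply: hB]. Qed.

Lemma filtered_sub N A B : filtered N A -> filtered N B -> filtered N (fun v => A v - B v).
Proof. by move=> hA hB m v vm; apply: vgeB; [apply: hA|apply: hB]. Qed.

Lemma filtered_mul N M h A : vge M h -> filtered N A -> filtered (M + N) (fun v => h * A v).
Proof. by move=> hM hA m v /hA vm; apply: vgeM hM vm _; lia. Qed.

Lemma filtered_premul N M h A : vge M h -> filtered N A -> filtered (M + N) (fun v => A (h * v)).
Proof. by move=> hM hA m v vm; rewrite addrA; apply: hA; apply: vgeM hM vm _; lia. Qed.

Lemma filtered_lead N A n c v : klinear A -> filtered N A -> lead n c v ->
  lead (n + N) (c * lcoef (A (lmonom k n)) (n + N)) (A v).
Proof.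
move=> lA fA /leadP vn; rewrite -(subrK (lconst c * lmonom k n) v) (klinearD lA).
rewrite (klinearZ lA); apply: (@lead_add _ (n + N) _ (lconst c * A (lmonom k n))).
  by apply: leadZ; split=> //; apply: fA; apply: vge_monom.
by rewrite addrK addrAC; apply: fA.
Qed.

Definition partial_sum a v (J : nat) : laurent k :=
  \sum_(j < J) lconst (lcoef v (a + j%:Z)) * lmonom k (a + j%:Z).

Lemma vge_partial_sum a v J : vge a v -> vge (a + J%:Z) (v - partial_sum a v J).
Proof.
move=> va i iJ; rewrite lcoefB lcoef_sum.
under eq_bigr do rewrite lcoef_constM lcoef_monom.
have [ia|ai] := ltP i a.
  rewrite va // big1 ?subr0 // => j _; rewrite lt_eqF ?mulr0 //; lia.
have jJ : (absz (i - a) < J)%N by lia.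
rewrite (bigD1 (Ordinal jJ)) //= big1 ?addr0 => [|j jn].
  by rewrite (_ : a + _ = i) ?eqxx ?mulr1 ?subrr //; lia.
case: eqP => [ij|]; last by rewrite mulr0.
by case/eqP: jn; apply: val_inj => /=; lia.
Qed.

Arguments vge_partial_sum {a v} J _ [i] _.

(** Monomials span a dense subspace: beyond a long partial sum, the rest of [v] has order so large
    that both operators send it past any prescribed order. *)
Lemma flin_ext N M A B : klinear A -> filtered N A -> klinear B -> filtered M B ->
  (forall n, A (lmonom k n) = B (lmonom k n)) -> A =1 B.
Proof.
move=> lA fA lB fB AB v; apply/eqP; rewrite -subr_eq0; apply/eqP; apply: vge_all => n.
have va := vge_lord v; set a := lord v in va.
pose J := (`|a| + `|n| + `|N| + `|M|)%N.
have vR := vge_partial_sum J va; set P := partial_sum a v J in vR.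
have -> : A v - B v = A (v - P) - B (v - P).
  rewrite (klinearB lA) (klinearB lB).
  suff -> : A P = B P by rewrite opprB addrA subrK.
  rewrite (klinear_sum lA) (klinear_sum lB); apply: eq_bigr => j _.
  by rewrite (klinearZ lA) (klinearZ lB) AB.
by apply: vgeB; [apply: zero_below_le (fA _ _ vR)|apply: zero_below_le (fB _ _ vR)];
  rewrite /J; lia.
Qed.

Lemma flin_filtered N M A : klinear A -> filtered M A ->
  (forall n, vge (n + N) (A (lmonom k n))) -> filtered N A.
Proof.
move=> lA fA An a v va; pose J := (`|N| + `|M|)%N.
have vR := vge_partial_sum J va; set P := partial_sum a v J in vR.
rewrite -(subrK P v) (klinearD lA); apply: vgeD.
  by apply: zero_below_le (fA _ _ vR); rewrite /J; lia.
rewrite (klinear_sum lA); apply: vge_sum => j _; rewrite (klinearZ lA).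
apply: vgeZ; apply: zero_below_le (An _); lia.
Qed.

(** This is an infinite matrix whose column [n] starts at order [n + N]. Against a series of order
    [a], the coefficient at [m] only sees the columns from [a] to [m - N], so every sum is
    finite. *)
Lemma flin_exists N (b : int -> laurent k) : (forall n, vge (n + N) (b n)) ->
  exists A, [/\ klinear A, filtered N A & forall n, A (lmonom k n) = b n].
Proof.
move=> bN; pose c v m := \sum_(n \in [set: int]) lcoef v n * lcoef (b n) m.
have cE a v m (J : nat) : vge a v -> (`|a| + `|m| + `|N| <= J)%N ->
    c v m = \sum_(n <- box J) lcoef v n * lcoef (b n) m.
  move=> va mJ; apply: fsum_box => i iJ.
  have [ia|ai] := ltP i a; first by rewrite va // mul0r.
  by rewrite bN ?mulr0 //; lia.
have cB M v : vge M v -> zero_below (M + N) (c v).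
  move=> vM m mM; rewrite /c fsbig1 // => i _.
  have [ia|ai] := ltP i M; first by rewrite vM // mul0r.
  by rewrite bN ?mulr0 //; lia.
have cbd v : exists N', zero_below N' (c v).
  by have [a va] := lcoef_bounded v; exists (a + N); apply: cB.
exists (fun v => Laurent (cbd v)); split=> [a v w|M v|n].
- apply: laurentP => m; rewrite [in RHS]lcoefD [in RHS]lcoef_constM /=.
  have vl := vge_lord v; have wl := vge_lord w.
  have vwl : vge (Num.min (lord v) (lord w)) (lconst a * v + w).
    by apply: vgeD; [apply: vgeZ|]; [apply: zero_below_le vl|apply: zero_below_le wl];
      rewrite ge_min lexx ?orbT.
  pose J := (`|lord v| + `|lord w| + `|m| + `|N|)%N.
  rewrite (cE _ _ m J vwl) ?(cE _ _ m J vl) ?(cE _ _ m J wl); try (rewrite /J; lia).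
  rewrite mulr_sumr -big_split; apply: eq_bigr => i _.
  by rewrite lcoefD lcoef_constM mulrDl mulrA.
- exact: cB.
apply: laurentP => m /=; rewrite /c -(fsbig_widen [set n] setT) //=; last first.
  by move=> i [_ /= /eqP/negbTE ->]; rewrite mul0r.
by rewrite fsbig_set1 eqxx mul1r.
Qed.

Lemma laurent_complete N (w : nat -> laurent k) :
  (forall J, vge (N + J%:Z) (w J.+1 - w J)) ->
  exists l, forall J, vge (N + J%:Z) (l - w J).
Proof.
move=> wN; have wle J I : (J <= I)%N -> vge (N + J%:Z) (w I - w J).
  elim: I => [|I IHI]; first by rewrite leqn0 => /eqP ->; rewrite subrr.
  rewrite leq_eqVlt => /predU1P[->|]; first by rewrite subrr.
  rewrite ltnS => JI; apply: vge_trans (IHI JI); apply: zero_below_le (wN I); lia.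
(* The index [|m - N| + 1] exceeds [m - N], and from there on the coefficient at [m] no longer
   changes. *)
pose c m := lcoef (w (absz (m - N)).+1) m.
have cE m J : m < N + J%:Z -> c m = lcoef (w J) m.
  move=> mJ; apply/eqP; rewrite -subr_eq0 -lcoefB; apply/eqP.
  have [JI|IJ] := leqP J (absz (m - N)).+1; first exact: wle.
  by have /vgeBC := wle _ _ (ltnW IJ); apply; lia.
have [b wb] := lcoef_bounded (w 0).
have cb : exists b, zero_below b c.
  exists (Num.min b N) => m; rewrite lt_min => /andP[mb mN].
  by rewrite (cE m 0) ?wb //; lia.
exists (Laurent cb) => J m mJ; rewrite lcoefB /= (cE m J) ?subrr //.
Qed.

(** The solution is the Neumann series [\sum_j A^j v], which converges because each application of
    [A] gains one order. *)
Lemma contraction_surj A : klinear A -> filtered 1 A -> forall v, exists w, w - A w = v.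
Proof.
move=> lA fA v; pose w J := \sum_(j < J) iter j A v.
have vN := vge_lord v; set N := lord v in vN.
have itA j : vge (N + j%:Z) (iter j A v).
  by elim: j => [|j IHj]; [rewrite addr0|rewrite iterS intS addrCA addrC; apply: fA].
have [|l lw] := @laurent_complete N w.
  by move=> J; rewrite (_ : w J.+1 - w J = iter J A v) // /w big_ord_recr /= addrC addrK.
exists l; apply/eqP; rewrite -subr_eq0; apply/eqP; apply: vge_all => n.
pose J := absz (n - N); apply: (@zero_below_le _ _ (N + J%:Z)); first by rewrite /J; lia.
have -> : l - A l - v = (l - w J) - A (l - w J) - iter J A v.
  suff vE : v = w J - A (w J) + iter J A v.
    rewrite (klinearB lA) [X in _ - X]vE; set a := A l; set b := A (w J).
    by set c := iter J A v; ring.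
  rewrite /w; elim: (J) => [|I IHI]; first by rewrite big_ord0 (klinear0 lA) subrr add0r.
  rewrite !big_ord_recr /= (klinearD lA) {1}IHI; set a := \sum_(i < I) _.
  set b := iter I A v; set c := A a; set d := A b; ring.
apply: vgeB; last exact: itA.
by apply: vgeB; [|apply: zero_below_le (fA _ _ (lw J)); lia]; exact: lw.
Qed.

Lemma filteredS N A : klinear A -> filtered N A ->
  (forall n, lcoef (A (lmonom k n)) (n + N) = 0) -> filtered (N + 1) A.
Proof.
move=> lA fA A0; apply: flin_filtered (lA) (fA) _ => n.
by rewrite addrA; apply: vgeS; [apply: fA; exact: vge_monom|].
Qed.

Fact scale_coef_bounded (c : int -> k) v :
  exists N, zero_below N (fun i => c i * lcoef v i).
Proof. by have [N vN] := lcoef_bounded v; exists N => i /vN ->; rewrite mulr0. Qed.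
Definition scale_coef c v : laurent k := Laurent (scale_coef_bounded c v).

Lemma scale_coefE c v n : lcoef (scale_coef c v) n = c n * lcoef v n.
Proof. by []. Qed.

Lemma klinear_scale_coef c : klinear (scale_coef c).
Proof.
move=> a v w; apply: laurentP => n.
by rewrite !(scale_coefE, lcoefD, lcoef_constM) mulrDr mulrCA.
Qed.

Lemma filtered_scale_coef c : filtered 0 (scale_coef c).
Proof. by move=> M v vM i; rewrite addr0 => iM; rewrite scale_coefE vM // mulr0. Qed.

Section Bijective.
Context (A : laurent k -> laurent k) (A_lin : klinear A) (A_filt : filtered 0 A).
Hypothesis A_diag : forall n, lcoef (A (lmonom k n)) n != 0.

Lemma triangular_lead n c v :
  lead n c v -> lead n (c * lcoef (A (lmonom k n)) n) (A v).
Proof. by move=> /(filtered_lead A_lin A_filt); rewrite !addr0. Qed.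

Lemma triangular_vge n v : vge n (A v) -> vge n v.
Proof.
move=> Avn; have [->//|v0] := eqVneq v 0.
have [c c0 /[dup] vl [v1 _]] := lord_lead v0.
apply: zero_below_le v1; rewrite leNgt; apply/negP => /Avn.
have [_ ->] := triangular_lead vl.
by apply/eqP; rewrite mulf_neq0.
Qed.

Lemma triangular_inj : injective A.
Proof.
move=> v w /eqP; rewrite -subr_eq0 -(klinearB A_lin) => /eqP Avw.
apply/eqP; rewrite -subr_eq0; apply/eqP; apply: vge_all => n.
by apply: triangular_vge; rewrite Avw.
Qed.

(** Once the diagonal is divided out by [S], the operator [v - S (A v)] gains one order;
    [contraction_surj] then solves [S (A w) = S v], and [S] is injective. *)
Lemma triangular_surj v : exists w, A w = v.
Proof.
pose S := scale_coef (fun n => (lcoef (A (lmonom k n)) n)^-1).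
have lS : klinear S by apply: klinear_scale_coef.
have S_inj : injective S.
  move=> x y Sxy; apply: laurentP => n; move: (congr1 (fun v => lcoef v n) Sxy).
  by rewrite !scale_coefE; apply: mulfI; rewrite invr_eq0.
have lT : klinear (fun v => v - S (A v)).
  by apply: klinear_sub => //; apply: (klinear_comp lS).
have fT : filtered 1 (fun v => v - S (A v)).
  rewrite -[1]add0r; apply: (filteredS lT) => [|n].
    apply: filtered_sub; first exact: filtered_id.
    by rewrite -[0]addr0; apply: (@filtered_comp 0 0 S A) => //; apply: filtered_scale_coef.
  by rewrite addr0 lcoefB lcoef_monom eqxx scale_coefE mulVf // subrr.
have [w ww] := contraction_surj lT fT (S v); exists w; apply: S_inj.
by rewrite -ww opprB addrC subrK.
Qed.

Lemma triangular_inverse : exists B, [/\ klinear B, filtered 0 B, cancel A B & cancel B A].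
Proof.
have [B BK] := choice triangular_surj.
exists B; split=> // [a v w|M v vM|v].
- by apply: triangular_inj; rewrite BK A_lin !BK.
- by apply: triangular_vge; rewrite BK addr0.
- by apply: triangular_inj; rewrite BK.
Qed.
End Bijective.

Lemma flin_lcvg N A h a : klinear A -> filtered N A -> vge a h ->
  lcvg (fun n : nat => \sum_(j < n) lconst (lcoef h (a + j%:Z)) * A (lmonom k (a + j%:Z))) (A h).
Proof.
move=> lA fA ha m; exists (`|a| + `|m| + `|N|)%N => n mn.
have := fA _ _ (vge_partial_sum n ha).
rewrite (klinearB lA) (klinear_sum lA).
under eq_bigr do rewrite (klinearZ lA).
by move=> /vgeBC; apply: zero_below_le; lia.
Qed.

Lemma lcvg_uniq (f_ : nat -> laurent k) f g : lcvg f_ f -> lcvg f_ g -> f = g.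
Proof.
move=> cf cg; apply/eqP; rewrite -subr_eq0; apply/eqP; apply: vge_all => n.
have [a fa] := cf n; have [b gb] := cg n.
apply: vge_trans (vgeBC _) (gb (maxn a b) _); rewrite ?leq_maxr //.
by apply: fa; rewrite leq_maxl.
Qed.
End Filtered.
Arguments vge_partial_sum {k a v} J _ [i] _.

(** * The Euler operator and substitution *)

Section Euler.
Context (k : fieldType).
Implicit Types (f g h u v w : laurent k) (N M n m : int).

Definition euler : laurent k -> laurent k := scale_coef (fun n : int => n%:~R).

Lemma lcoef_euler v n : lcoef (euler v) n = n%:~R * lcoef v n.
Proof. by []. Qed.

Lemma klinear_euler : klinear euler.
Proof. exact: klinear_scale_coef. Qed.

Lemma filtered_euler : filtered 0 euler.
Proof. exact: filtered_scale_coef. Qed.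

Lemma lderivE v : lderiv v = lmonom k (-1) * euler v.
Proof. by apply: laurentP => i; rewrite lcoef_monomM opprK lcoef_euler. Qed.

Lemma eulerE v : euler v = lmonom k 1 * lderiv v.
Proof. by rewrite lderivE mulrA -lmonomD subrr mul1r. Qed.

Lemma eulerM f g : euler (f * g) = euler f * g + f * euler g.
Proof. by rewrite !eulerE lderivM mulrDr mulrA [in RHS]mulrCA. Qed.

Lemma euler_monom n : euler (lmonom k n) = lconst n%:~R * lmonom k n.
Proof.
apply: laurentP => i; rewrite lcoef_constM lcoef_euler lcoef_monom.
by case: eqP => [->|]; rewrite ?mulr0.
Qed.

Lemma euler1 : euler 1 = 0.
Proof. by rewrite -lmonom0 euler_monom rmorph0 mul0r. Qed.

Lemma vge_euler N v : vge N v -> vge N (euler v).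
Proof. by move=> /filtered_euler; rewrite addr0. Qed.

Lemma lead_euler n c v : lead n c v -> lead n (n%:~R * c) (euler v).
Proof. by move=> [vn <-]; split; [exact: vge_euler|]. Qed.

Lemma vge_euler1 v : vge 0 v -> vge 1 (euler v).
Proof. by move=> v0; apply: (@vgeS _ 0); [exact: vge_euler|rewrite lcoef_euler mul0r]. Qed.

Lemma eulerX u (n : nat) : u * euler (u ^+ n) = lconst n%:R * (u ^+ n * euler u).
Proof.
elim: n => [|n IHn]; first by rewrite euler1 rmorph0 mulr0 mul0r.
rewrite exprS eulerM mulrDr (mulrCA u u) -mulrA IHn -natr1 rmorphD rmorph1.
ring.
Qed.

Lemma eulerXz u n : u != 0 -> u * euler (u ^ n) = lconst n%:~R * (u ^ n * euler u).
Proof.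
move=> u0; case: n => n; first by rewrite -pmulrn -eulerX.
have un0 : u ^+ n.+1 != 0 by rewrite expf_neq0.
rewrite NegzE -exprnN mulrNz -pmulrn rmorphN; set U := u ^+ n.+1 in un0 *.
have : euler (U * U^-1) = 0 by rewrite divff // euler1.
rewrite eulerM => /eqP; rewrite addr_eq0 => /eqP UE.
apply: (mulfI un0); rewrite mulrCA -[U * euler _]opprK -UE mulrN mulrA eulerX.
rewrite -/U /=; move: (lconst _) => c; field.
exact: un0.
Qed.

End Euler.

Arguments lcomp {k} F u.

Section Composition.
Context (k : fieldType).
Implicit Types (f g h u v w : laurent k) (N M n m : int).

Section Substitution.
Context (u : laurent k) (e : k) (e0 : e != 0) (hu : lead 1 e u).

Let u_neq0 : u != 0. Proof. exact: lead_neq0 hu e0. Qed.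

(** [lcomp] is only specified as some limit of partial sums. The continuous operator sending [t^n]
    to [u^n] provides such a limit, and uniqueness of limits identifies the two. *)
Lemma lcomp_spec : [/\ klinear (lcomp^~ u), filtered 0 (lcomp^~ u) &
  forall n, lcomp (lmonom k n) u = u ^ n].
Proof.
have [|C [lC fC Cm]] := @flin_exists k 0 (fun n => u ^ n).
  by move=> n; rewrite addr0; have [] := leadXz1 n e0 hu.
suff CE : lcomp^~ u = C by rewrite -CE in lC fC *; split=> // n; rewrite -Cm -CE.
apply: funext => F.
have cF : lcvg (fun n : nat => \sum_(j < n) lconst (lcoef F (lord F + j%:Z)) *
    u ^ (lord F + j%:Z)) (C F).
  have := flin_lcvg lC fC (vge_lord F); congr lcvg; apply: funext => n.
  by apply: eq_bigr => j _; rewrite Cm.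
apply: (lcvg_uniq _ cF); rewrite /lcomp; set S := (X in xget _ X).
by apply: (@xgetPex _ 0 S); exists (C F).
Qed.

Lemma klinear_lcomp : klinear (lcomp^~ u). Proof. by case: lcomp_spec. Qed.
Lemma filtered_lcomp : filtered 0 (lcomp^~ u). Proof. by case: lcomp_spec. Qed.
Lemma lcomp_monom n : lcomp (lmonom k n) u = u ^ n. Proof. by case: lcomp_spec. Qed.

Lemma lcompM f g : lcomp (f * g) u = lcomp f u * lcomp g u.
Proof.
have lC := klinear_lcomp; have fC := filtered_lcomp.
suff step m h : lcomp (lmonom k m * h) u = u ^ m * lcomp h u.
  have fC' := filtered_mul (@vge_lord _ (lcomp g u)) fC.
  rewrite mulrC [RHS]mulrC.
  apply: (flin_ext (A := fun v => lcomp (g * v) u) (B := fun v => lcomp g u * lcomp v u)).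
  - exact: (klinear_premul g lC).
  - exact: filtered_premul (@vge_lord _ g) fC.
  - exact: (klinear_mul _ lC).
  - exact: fC'.
  by move=> n; rewrite mulrC step lcomp_monom mulrC.
apply: (flin_ext (A := fun v => lcomp (lmonom k m * v) u) (B := fun v => u ^ m * lcomp v u)).
- exact: (klinear_premul _ lC).
- exact: filtered_premul (vge_monom _) fC.
- exact: (klinear_mul _ lC).
- exact: filtered_mul (@vge_lord _ (u ^ m)) fC.
by move=> n; rewrite -lmonomD !lcomp_monom expfzDr.
Qed.

Lemma lcomp1 : lcomp 1 u = 1.
Proof. by rewrite -lmonom0 lcomp_monom. Qed.

Lemma lcomp_const c : lcomp (lconst c) u = lconst c.
Proof. by rewrite -[lconst c]mulr1 (klinearZ klinear_lcomp) lcomp1. Qed.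

Lemma lcompD f g : lcomp (f + g) u = lcomp f u + lcomp g u.
Proof. exact: klinearD klinear_lcomp f g. Qed.
Lemma lcompB f g : lcomp (f - g) u = lcomp f u - lcomp g u.
Proof. exact: klinearB klinear_lcomp f g. Qed.
Lemma lcompN f : lcomp (- f) u = - lcomp f u.
Proof. exact: klinearN klinear_lcomp f. Qed.

Lemma lcompX f (n : nat) : lcomp (f ^+ n) u = lcomp f u ^+ n.
Proof. by elim: n => [|n IHn]; rewrite ?lcomp1 // !exprS lcompM IHn. Qed.

Lemma lcomp_diag n : lcoef (lcomp (lmonom k n) u) n != 0.
Proof. by rewrite lcomp_monom; have [_ ->] := leadXz1 n e0 hu; rewrite expfz_neq0. Qed.

Lemma lcomp_lead n c f : lead n c f -> lead n (c * e ^ n) (lcomp f u).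
Proof.
move=> /(triangular_lead klinear_lcomp filtered_lcomp).
by rewrite lcomp_monom; have [_ ->] := leadXz1 n e0 hu.
Qed.

Lemma lcomp_inj : injective (lcomp^~ u).
Proof. exact: triangular_inj klinear_lcomp filtered_lcomp lcomp_diag. Qed.

Lemma vge_lcomp n f : vge n (lcomp f u) <-> vge n f.
Proof.
split; first exact: (triangular_vge klinear_lcomp filtered_lcomp lcomp_diag).
by move=> /filtered_lcomp; rewrite addr0.
Qed.

Lemma lcompV f : lcomp f^-1 u = (lcomp f u)^-1.
Proof.
have [->|f0] := eqVneq f 0; first by rewrite !invr0 (klinear0 klinear_lcomp) invr0.
have h : lcomp f u * lcomp f^-1 u = 1 by rewrite -lcompM divff // lcomp1.
have g0 : lcomp f u != 0.
  by apply: contra_eqN h => /eqP ->; rewrite mul0r eq_sym oner_eq0.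
by apply: (mulfI g0); rewrite h divff.
Qed.

Lemma lcompXz f n : lcomp (f ^ n) u = lcomp f u ^ n.
Proof. by case: n => n; rewrite ?NegzE -?exprnP -?exprnN ?lcompV lcompX. Qed.

(** The chain rule in logarithmic form; by density it is tested on monomials, where it is
    [eulerXz]. *)
Lemma euler_lcomp h : euler (lcomp h u) = euler u / u * lcomp (euler h) u.
Proof.
have lC := klinear_lcomp; have fC := filtered_lcomp.
apply: (flin_ext (A := fun h => euler (lcomp h u)) (B := fun h => euler u / u * lcomp (euler h) u)).
- exact: (klinear_comp (@klinear_euler k) lC).
- exact: (filtered_comp (@filtered_euler k) fC).
- exact: (klinear_mul _ (klinear_comp lC (@klinear_euler k))).
- exact: (filtered_mul (@vge_lord _ _) (filtered_comp fC (@filtered_euler k))).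
move=> n; rewrite /= euler_monom (klinearZ lC) lcomp_monom.
by apply: (mulfI u_neq0); rewrite eulerXz //; field; exact: u_neq0.
Qed.
End Substitution.

Lemma lcomp_id f : lcomp f (lmonom k 1) = f.
Proof.
have [lC fC Cm] := lcomp_spec (oner_neq0 k) (lead_monom k 1).
apply: (flin_ext lC fC (@klinear_id k) (@filtered_id k)) => n.
by rewrite Cm lmonomXz mul1r.
Qed.

Lemma lcompA f u w a b : a != 0 -> b != 0 -> lead 1 a u -> lead 1 b w ->
  lcomp (lcomp f u) w = lcomp f (lcomp u w).
Proof.
move=> a0 b0 hu hw; have [lu fu um] := lcomp_spec a0 hu.
have [lw fw wm] := lcomp_spec b0 hw.
have huw := lcomp_lead b0 hw hu.
have [|luw fuw uwm] := lcomp_spec _ huw; first by rewrite mulf_neq0.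
apply: (flin_ext (A := fun f => lcomp (lcomp f u) w) _ _ luw fuw).
- exact: (klinear_comp lw lu).
- exact: (filtered_comp fw fu).
by move=> n /=; rewrite um uwm (lcompXz b0 hw).
Qed.
End Composition.

(** * Formal integration and roots of units in characteristic zero *)

Section Roots.
Context (k : fieldType) (k_char0 : [pchar k] =i pred0).
Implicit Types (f g h u v w : laurent k) (N M n m : int).

Lemma char0_intr_eq0 n : (n%:~R == 0 :> k) = (n == 0).
Proof.
have /pcharf0P c0 := k_char0.
by case: n => n; rewrite ?NegzE ?mulrNz ?oppr_eq0 -?pmulrn c0 ?eqz_nat.
Qed.

Lemma char0_natr_eq0 (n : nat) : (n%:R == 0 :> k) = (n == 0)%N.
Proof. by have /pcharf0P := k_char0. Qed.

(** [h] is the exponential of the formal integral of [a dt/t]. With [h = 1 + w] the equation becomes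
    [w = J (a (1 + w))], a fixed-point problem for an operator that gains one order. *)
Lemma euler_ode a : vge 1 a -> exists h, lead 0 1 h /\ euler h = a * h.
Proof.
(* Formal integration; since [0^-1 = 0] it kills the constant term, which is harmless on series of
   order at least [1]. *)
move=> a1; pose J := scale_coef (fun n : int => (n%:~R : k)^-1).
have lJ : klinear J by apply: klinear_scale_coef.
have fJ : filtered 0 J by apply: filtered_scale_coef.
have JK v : vge 1 v -> euler (J v) = v.
  move=> v1; apply: laurentP => i; rewrite lcoef_euler scale_coefE mulrA.
  have [->|i0] := eqVneq i 0; first by rewrite v1 // mulr0.
  by rewrite divff ?mul1r // char0_intr_eq0.
pose T v := J (a * v).
have lT : klinear T by apply: klinear_premul.
have fT : filtered 1 T by rewrite -[1]addr0; apply: filtered_premul.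
have [w wT] := contraction_surj lT fT (J a).
have w1 : vge 1 w.
  have lU : klinear (fun v => v - T v) by apply: klinear_sub => //; exact: klinear_id.
  apply: (triangular_vge lU) => [|n|].
  - by apply: filtered_sub; [exact: filtered_id|apply: filtered_le fT].
  - rewrite lcoefB lcoef_monom eqxx (fT n) ?subr0 ?oner_neq0 //; last by lia.
    exact: vge_monom.
  by rewrite wT; have := fJ _ _ a1; rewrite addr0.
exists (1 + w); split.
  by apply: lead_add (lead1 k) _; rewrite add0r [1 + w]addrC addrK.
have wE : w = J (a * (1 + w)).
  by rewrite mulrDr mulr1 (klinearD lJ) -wT -[a * w]/(a * w) subrK.
rewrite (klinearD (@klinear_euler k)) euler1 add0r {1}wE JK //.
by apply: vgeM a1 (vgeD (@vge1 k) (zero_below_le _ w1)) _.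
Qed.

Lemma euler_eq0 v : euler v = 0 -> v = lconst (lcoef v 0).
Proof.
move=> v0; apply: laurentP => i /=; case: eqP => [->//|/eqP i0].
have /eqP := congr1 (fun f => lcoef f i) v0.
by rewrite lcoef_euler mulf_eq0 char0_intr_eq0 (negbTE i0) => /eqP.
Qed.

(** The logarithmic derivative of a [d]-th root has to be [euler v / (d v)]. A solution [y] of that
    equation makes [y^d / v] a constant, equal to [1] by its leading coefficient. *)
Lemma unit_root v (d : nat) : (0 < d)%N -> lead 0 1 v ->
  exists y, lead 0 1 y /\ y ^+ d = v.
Proof.
move=> d0 v1; have v0 := lead_neq0 v1 (oner_neq0 k).
have d0' : d%:R != 0 :> k by rewrite char0_natr_eq0 -lt0n.
have Ld0 : lconst (d%:R : k) != 0 by rewrite (lead_neq0 (lead_const _) d0').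
pose a := lconst d%:R^-1 * (euler v / v).
have [|y [y1 ya]] := @euler_ode a.
  apply: vgeZ; have [vv _] := leadV (oner_neq0 k) v1.
  apply: vgeM (vge_euler1 _) vv _ => //; by case: v1.
have y0 := lead_neq0 y1 (oner_neq0 k).
exists y; split=> //.
have zE : euler (y ^+ d / v) = 0.
  have vE : euler v^-1 = - (euler v / v ^+ 2).
    apply: (mulfI v0); have := @eulerXz k v (-1) v0.
    by rewrite -invr_expz expr1z => ->; rewrite mulrNz rmorphN rmorph1; field.
  rewrite eulerM vE; suff -> : euler (y ^+ d) = y ^+ d * (euler v / v) by field.
  apply: (mulfI y0); rewrite eulerX ya /a.
  have dd : lconst d%:R^-1 * lconst d%:R = 1 :> laurent k by rewrite -rmorphM mulVf ?rmorph1.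
  move: (lconst d%:R^-1) (lconst d%:R) dd => c c' cc'.
  by transitivity (c * c' * (y ^+ d * y * (euler v / v))); [ring|rewrite cc'; ring].
have := euler_eq0 zE.
have := leadM (leadX d y1) (leadV (oner_neq0 k) v1).
rewrite mulr0 oppr0 addr0 expr1n invr1 mulr1 => -[_ ->].
by rewrite rmorph1 => h; rewrite -(divfK v0 (y ^+ d)) h mul1r.
Qed.
End Roots.

(** * Polynomial functions on the integers and their difference equations *)

Section PolynomialFunctions.
Context (k : fieldType) (k_char0 : [pchar k] =i pred0).
Implicit Types (b c : int -> k).

Definition polyfun b := exists p : {poly k}, forall n : int, b n = p.[n%:~R].

Lemma polyfun_ext b c : b =1 c -> polyfun b -> polyfun c.
Proof. by move=> bc [p bp]; exists p => n; rewrite -bc. Qed.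

Lemma polyfun_const a : polyfun (fun _ => a).
Proof. by exists a%:P => n; rewrite hornerC. Qed.

Lemma polyfun_id : polyfun (fun n => n%:~R).
Proof. by exists 'X => n; rewrite hornerX. Qed.

Lemma polyfunD b c : polyfun b -> polyfun c -> polyfun (fun n => b n + c n).
Proof. by move=> [p bp] [q cq]; exists (p + q) => n; rewrite hornerD bp cq. Qed.

Lemma polyfunM b c : polyfun b -> polyfun c -> polyfun (fun n => b n * c n).
Proof. by move=> [p bp] [q cq]; exists (p * q) => n; rewrite hornerM bp cq. Qed.

Lemma polyfunB b c : polyfun b -> polyfun c -> polyfun (fun n => b n - c n).
Proof.
move=> pb /(polyfunM (polyfun_const (-1)))/(polyfunD pb); apply: polyfun_ext => n.
by rewrite mulN1r.
Qed.

Lemma polyfun_sum I (r : seq I) (F : I -> int -> k) :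
  (forall i, polyfun (F i)) -> polyfun (fun n => \sum_(i <- r) F i n).
Proof.
move=> pF; elim: r => [|i r IHr].
  by apply: polyfun_ext (polyfun_const 0) => n; rewrite big_nil.
by apply: polyfun_ext (polyfunD (pF i) IHr) => n; rewrite big_cons.
Qed.

Lemma polyfun_shift b (m : int) : polyfun b -> polyfun (fun n => b (n + m)).
Proof.
move=> [p bp]; exists (p \Po ('X + m%:~R%:P)) => n.
by rewrite horner_comp !hornerE bp rmorphD.
Qed.

(** Minus its value at [0], the polynomial vanishes at every [- d j], and these points are distinct
    in characteristic zero. *)
Lemma polyfun_periodic b (d : int) : d != 0 -> polyfun b ->
  (forall n, b (n - d) = b n) -> forall n, b n = b 0.
Proof.
move=> d0 [p bp] bd; suff p0 : p - (b 0)%:P = 0.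
  by move=> n; rewrite bp -(subrK (b 0)%:P p) p0 add0r hornerC.
have b0 (j : nat) : b (- (d * j%:Z)) = b 0.
  by elim: j => [|j <-]; rewrite ?mulr0 ?oppr0 // intS mulrDr mulr1 opprD addrC bd.
set q := p - _; apply/eqP; apply: contraT => q0.
pose rs : seq k := [seq (- (d * j%:Z))%:~R | j <- iota 0 (size q)].
have : (size rs < size q)%N.
  apply: max_poly_roots => //; last first.
    rewrite map_inj_uniq ?iota_uniq // => i j /eqP.
    rewrite -subr_eq0 -rmorphB /= (char0_intr_eq0 k_char0) opprK addrC subr_eq0.
    by move=> /eqP /(mulfI d0); lia.
  by apply/allP => _ /mapP[j _ ->]; rewrite rootE /q !hornerE -bp b0 subrr.
by rewrite size_map size_iota ltnn.
Qed.

(** Induction on the size: the difference of [X^(N+1)] has degree [N] and leading coefficient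
    [- d (N+1)], nonzero in characteristic zero, so a multiple of it removes the top term of [q]. *)
Lemma poly_antidiff (d : k) (q : {poly k}) : d != 0 ->
  exists p : {poly k}, forall x, p.[x - d] - p.[x] = q.[x].
Proof.
move=> d0; have [N] := ubnP (size q); elim: N => // N IHN in q *.
rewrite ltnS leq_eqVlt => /predU1P[qN|]; last exact: IHN.
case: N => [|N] in IHN qN *.
  by exists 0 => x; move/eqP: qN; rewrite size_poly_eq0 => /eqP ->; rewrite !horner0 subr0.
pose D : {poly k} := ('X - d%:P) ^+ N.+1 - 'X^(N.+1).
have DE : D = \sum_(i < N.+1) ('X^(N - i) * (- d%:P) ^+ i.+1) *+ 'C(N.+1, i.+1).
  rewrite /D exprDn big_ord_recl /= expr0 mulr1 bin0 mulr1n subn0 addrC addKr.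
  by apply: eq_bigr => i _; rewrite subSS.
have termE (i : 'I_N.+1) : ('X^(N - i) * (- d%:P) ^+ i.+1) *+ 'C(N.+1, i.+1) =
    ((- d) ^+ i.+1 *+ 'C(N.+1, i.+1)) *: 'X^(N - i).
  by rewrite -polyCN -polyC_exp mulrC mul_polyC scalerMnl.
have szD : (size D <= N.+1)%N.
  rewrite DE; apply: (leq_trans (size_sum _ _ _)); apply/bigmax_leqP => i _.
  by rewrite termE (leq_trans (size_scale_leq _ _)) // size_polyXn ltnS leq_subr.
have DN : D`_N = - d *+ N.+1.
  rewrite DE coef_sum big_ord_recl big1 => [|i _].
    by rewrite termE coefZ coefXn subn0 eqxx mulr1 expr1 bin1 addr0.
  rewrite termE coefZ coefXn /= /bump /= (_ : (N == _)%N = false) ?mulr0 //.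
  by apply/negbTE; have := ltn_ord i; lia.
have DN0 : D`_N != 0 by rewrite DN -mulr_natr mulf_neq0 ?oppr_eq0 ?(char0_natr_eq0 k_char0).
pose c := q`_N / D`_N.
have [|p pE] := IHN (q - c *: D).
  rewrite ltnS; apply/leq_sizeP => j; rewrite leq_eqVlt => /predU1P[<-|Nj].
    by rewrite coefB coefZ /c divfK // subrr.
  by rewrite coefB coefZ !nth_default ?mulr0 ?subrr ?qN // (leq_trans szD).
exists (p + c *: 'X^(N.+1)) => x.
have := pE x; rewrite /D !hornerE => pEx.
transitivity ((p.[x - d] - p.[x]) + c * ((x - d) ^+ N.+1 - x ^+ N.+1)); first by ring.
by rewrite pEx subrK.
Qed.
End PolynomialFunctions.

(** Course-of-values recursion for a step that is handed a whole sequence but reads only its earlier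
    terms; [F n] tabulates the first [n] values. *)
Lemma strong_rec (T : Type) (x0 : T) (step : nat -> (nat -> T) -> T) :
  (forall n c c', (forall j, (j < n)%N -> c j = c' j) -> step n c = step n c') ->
  exists c, forall n, c n = step n c.
Proof.
move=> step_ext.
pose F := fix F n := if n is n'.+1 then rcons (F n') (step n' (nth x0 (F n'))) else [::].
have szF n : size (F n) = n by elim: n => //= n IHn; rewrite size_rcons IHn.
have nthF m n j : (j < m)%N -> (m <= n)%N -> nth x0 (F n) j = nth x0 (F m) j.
  move=> jm; elim: n => [|n IHn]; first by rewrite leqn0 => /eqP ->.
  rewrite leq_eqVlt => /predU1P[-> //|]; rewrite ltnS => mn.
  by rewrite [F n.+1]/= nth_rcons szF (leq_trans jm mn) IHn.
exists (fun n => nth x0 (F n.+1) n) => n.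
rewrite [F n.+1]/= nth_rcons szF ltnn eqxx; apply: step_ext => j jn.
exact: nthF.
Qed.

Section PolynomialOperators.
Context (k : fieldType).
Implicit Types (f g h u v w : laurent k) (N M n m i : int) (A B : laurent k -> laurent k).

(** The operators [\sum_i t^i p_i(euler)] with [p_i] polynomials. *)
Definition poly_op B :=
  forall i, polyfun (fun n => lcoef (B (lmonom k n)) (n + i)).

Lemma poly_op_ext A B : A =1 B -> poly_op A -> poly_op B.
Proof. by move=> AB pA i; apply: polyfun_ext (pA i) => n; rewrite AB. Qed.

Lemma poly_op_sub A B : poly_op A -> poly_op B -> poly_op (fun v => A v - B v).
Proof. by move=> pA pB i; apply: polyfunB. Qed.

Lemma poly_op_mul N h B : filtered N B -> poly_op B -> poly_op (fun v => h * B v).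
Proof.
move=> fB pB i; have ha := vge_lord h; set a := lord h in ha.
pose M := (`|a| + `|i| + `|N|)%N.
apply: (@polyfun_ext _ (fun n => \sum_(l <- box M) lcoef h l * lcoef (B (lmonom k n)) (n + i - l))).
  move=> n; rewrite lcoefM (fsum_box (M := M)) // => l Ml.
  have [/ha ->|al] := ltP l a; first by rewrite mul0r.
  by rewrite (fB _ _ (vge_monom n)) ?mulr0 //; move: Ml; rewrite /M; lia.
apply: polyfun_sum => l; apply: polyfunM; first exact: polyfun_const.
by apply: polyfun_ext (pB (i - l)) => n; rewrite addrA.
Qed.

(** The coefficient at [n + i] involves the terms of [h] only up to a bound that depends on [i] and
    not on [n]. The sum thus has fixed length, and each of its terms is a shifted polynomial in
    [n]. *)
Lemma poly_op_premul N h B : klinear B -> filtered N B -> poly_op B ->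
  poly_op (fun v => B (h * v)).
Proof.
move=> lB fB pB i; have ha := vge_lord h; set a := lord h in ha.
pose J := (`|a| + `|i| + `|N|).+1%N.
apply: (@polyfun_ext _ (fun n => \sum_(j <- index_enum 'I_J)
    lcoef h (a + j%:Z) * lcoef (B (lmonom k (n + (a + j%:Z)))) (n + i))).
  move=> n; rewrite -[in RHS](subrK (partial_sum a h J) h) mulrDl (klinearD lB) lcoefD.
  rewrite (_ : lcoef (B ((h - _) * _)) _ = 0); last first.
    have := fB _ _ (zero_belowM (vge_partial_sum J ha) (vge_monom n)); apply.
    by rewrite /J; lia.
  rewrite add0r /partial_sum mulr_suml (klinear_sum lB) lcoef_sum.
  apply: eq_bigr => j _.
  by rewrite -mulrA -lmonomD (klinearZ lB) lcoef_constM [a + _ + n]addrC.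
apply: polyfun_sum => j; apply: polyfunM; first exact: polyfun_const.
apply: polyfun_ext (polyfun_shift (a + j%:Z) (pB (i - (a + j%:Z)))) => n.
by congr (lcoef _ _); ring.
Qed.

Lemma poly_op_euler B : klinear B -> poly_op B -> poly_op (fun v => B (euler v)).
Proof.
move=> lB pB i; apply: polyfun_ext (polyfunM (polyfun_id k) (pB i)) => n.
by rewrite euler_monom (klinearZ lB) lcoef_constM.
Qed.
End PolynomialOperators.

(** * The normal form *)

Section Intertwiner.
Context (k : fieldType) (k_char0 : [pchar k] =i pred0).
Implicit Types (f g h u v w : laurent k) (N M n m : int) (A B : laurent k -> laurent k).
Context (r d : nat) (r_gt0 : (0 < r)%N) (d_gt0 : (0 < d)%N).
Context (phi : laurent k) (phi_vge : vge r%:Z phi).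

Let s := (r + d)%N.
Let P v := lmonom k (- d%:Z) * v + phi * euler v.

(** Writing [Phi (t^n) = \sum_i c_i(n) t^(n+i)], the condition on [Phi] is a system of difference
    equations [c_i(n - d) - c_i(n) = ...], each solvable in polynomials in [n]. *)
Lemma intertwiner_exists : exists Phi, [/\ klinear Phi, filtered 0 Phi,
  poly_op Phi, forall v, P (Phi v) = Phi (lmonom k (- d%:Z) * v)
  & exists c : {poly k},
     [/\ forall n, lcoef (Phi (lmonom k n)) n = 1,
         filtered s%:Z (fun v => Phi v - v),
         forall n, lcoef (Phi (lmonom k n)) (n + s%:Z) = c.[n%:~R]
       & forall x, c.[x - d%:R] - c.[x] = lcoef phi r%:Z * x]].
Proof.
have dk0 : d%:R != 0 :> k by rewrite (char0_natr_eq0 k_char0) -lt0n.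
have [A AE] := choice (fun q => poly_antidiff k_char0 q dk0).
(* The zero polynomial gets the antidifference [0]: an arbitrary constant from [A] would spoil the
   vanishing of [c i] for [0 < i < s]. *)
pose A0 q := if q == 0 then 0 else A q.
have A0E q x : (A0 q).[x - d%:R] - (A0 q).[x] = q.[x].
  by rewrite /A0; case: eqP => [->|_]; rewrite ?hornerC ?subr0.
(* Only earlier indices are needed: the term [j = n] would carry the coefficient of [phi] at [- d],
   which is below its order. *)
pose rhs (n : nat) (c : nat -> {poly k}) : {poly k} :=
  \sum_(j < n) c j * ('X + j%:R%:P) * (lcoef phi (n%:Z - d%:Z - j%:Z))%:P.
have [|c cE] := @strong_rec {poly k} 0 (fun (n : nat) c => if n is 0 then 1 else A0 (rhs n c)).
  case=> // j0 c c' cc'; congr A0; apply: eq_bigr => j _.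
  by rewrite cc'.
have c0 : c 0 = 1 by rewrite cE.
have cd (i : nat) x : (c i).[x - d%:R] - (c i).[x] =
    \sum_(j < i.+1) (x + j%:R) * (c j).[x] * lcoef phi (i%:Z - d%:Z - j%:Z).
  have -> : \sum_(j < i.+1) (x + j%:R) * (c j).[x] * lcoef phi (i%:Z - d%:Z - j%:Z)
     = (rhs i c).[x].
    rewrite big_ord_recr /= phi_vge ?mulr0 ?addr0; last by lia.
    rewrite /rhs horner_sum; apply: eq_bigr => j _; rewrite !hornerE.
    by rewrite [_ * (x + _)]mulrC.
  case: i => [|i]; last by rewrite (cE i.+1) A0E.
  by rewrite c0 /rhs big_ord0 !hornerE subrr.
(* In this range the coefficients of [phi] have index [i - d - j < r], so every right-hand side is
   zero. *)
have cs (i : nat) : (0 < i < s)%N -> c i = 0.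
  move=> /andP[i0 is_]; rewrite cE; case: i i0 is_ => // i _ is_.
  have -> : rhs i.+1 c = 0; last by rewrite /A0 eqxx.
  by apply: big1 => j _; rewrite phi_vge ?mulr0 //; move: is_; rewrite /s; lia.
have bbd n : exists N, zero_below N
    (fun m : int => if n <= m then (c (absz (m - n))).[n%:~R] else 0).
  by exists n => m mn; rewrite leNgt mn.
have [|Phi [lP fP Pm]] := @flin_exists k 0 (fun n => Laurent (bbd n)).
  by move=> n m; rewrite addr0 /= leNgt => ->.
have PmE n (i : int) : lcoef (Phi (lmonom k n)) (n + i) = if 0 <= i then (c (absz i)).[n%:~R] else 0.
  by rewrite Pm /= lerDl addrAC subrr add0r.
exists Phi; split=> //.
- move=> i; case: i => i; first by exists (c i) => n; rewrite PmE.
  by exists 0 => n; rewrite PmE horner0.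
- have lE := @klinear_euler k; have fE := @filtered_euler k.
  apply: (flin_ext (N := - d%:Z + 0) (M := - d%:Z + 0)
    (A := fun v => lmonom k (- d%:Z) * Phi v + phi * euler (Phi v))
    (B := fun v => Phi (lmonom k (- d%:Z) * v))).
  + by apply: klinear_add; apply: klinear_mul => //; exact: (klinear_comp lE lP).
  + apply: filtered_add; first exact: filtered_mul (vge_monom _) fP.
    apply: filtered_mul (filtered_comp fE fP).
    by apply: zero_below_le phi_vge; lia.
  + exact: klinear_premul.
  + exact: filtered_premul (vge_monom _) fP.
  move=> n; apply: laurentP => m.
  have Pn := fP _ _ (vge_monom n); rewrite addr0 in Pn.
  have phid : vge (- d%:Z) phi by apply: zero_below_le phi_vge; lia.
  have Hn := zero_belowM (vge_euler Pn) phid.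
  rewrite -lmonomD lcoefD lcoef_monomM [phi * _]mulrC opprK.
  have [mn|nm] := ltP m (n - d%:Z).
    rewrite Hn // addr0 Pn; last by lia.
    by rewrite Pm /= ifF //; apply/negbTE; rewrite -ltNge; lia.
  (* At order [n - d + i] the identity reads [c_i(n - d) = c_i(n) + \sum_j (n + j) c_j(n)
     phi_(i-d-j)], which is [cd]. *)
  pose i := absz (m - (n - d%:Z))%R.
  have mE : m = n + - d%:Z + i%:Z by rewrite /i; lia.
  rewrite mE lcoefM_shift //; last exact: vge_euler.
  have -> : n + - d%:Z + i%:Z + d%:Z = n + i%:Z by lia.
  have -> : n + - d%:Z + i%:Z = (- d%:Z + n) + i%:Z by lia.
  rewrite !PmE /= [- d%:Z + n]addrC rmorphD /= mulrNz -pmulrn.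
  have /eqP := cd i n%:~R; rewrite subr_eq => /eqP ->; rewrite addrC.
  congr (_ + _); apply: eq_bigr => j _.
  rewrite PmE /= rmorphD /= -pmulrn; congr (_ * lcoef phi _).
  by have := ltn_ord j; lia.
exists (c s); split=> [n||n|x].
- by have := PmE n 0; rewrite addr0 c0 hornerC.
- apply: (@flin_filtered _ _ 0).
  + by apply: klinear_sub => //; exact: klinear_id.
  + by apply: filtered_sub => //; exact: filtered_id.
  move=> n m ms; rewrite lcoefB lcoef_monom.
  have -> : m = n + (m - n) by lia.
  rewrite PmE; case: ifP => [mn|mn]; last by rewrite lt_eqF ?subrr //; lia.
  have [e|e] := eqVneq (absz (m - n)) 0%N.
    by rewrite e c0 hornerC (_ : (_ == _) = true) ?subrr //; lia.
  rewrite (_ : (_ == n) = false); last by lia.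
  by rewrite cs ?horner0 ?subrr //; lia.
- by rewrite PmE.
rewrite cd big_ord_recl big1 => [|j _] /=.
  rewrite c0 hornerC mulr1 !addr0 mulrC; congr (lcoef phi _ * _).
  by rewrite /s; lia.
by rewrite phi_vge ?mulr0 // /bump /s /=; lia.
Qed.

Section Centralizer.
Context (Phi : laurent k -> laurent k) (lPhi : klinear Phi) (fPhi : filtered 0 Phi).
Hypothesis pPhi : poly_op Phi.
Hypothesis Phi_diag : forall n, lcoef (Phi (lmonom k n)) n != 0.
Hypothesis PPhi : forall v, P (Phi v) = Phi (lmonom k (- d%:Z) * v).

(** The lowest coefficient of an operator [C] with [P C = C t^-d] is a [d]-periodic polynomial,
    hence constant; so [C = 0] as soon as [C 1 = 0]. *)
Lemma centralizer N B : klinear B -> filtered N B -> poly_op B ->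
  (forall v, P (B v) = B (lmonom k (- d%:Z) * v)) ->
  exists2 g, vge N g & forall v, B v = Phi (g * v).
Proof.
move=> lB fB pB PB.
(* The value at [1] leaves no choice: [B 1 = Phi g]. *)
have [g gE] := triangular_surj lPhi fPhi Phi_diag (B 1).
have gN : vge N g.
  apply: (triangular_vge lPhi fPhi Phi_diag); rewrite gE.
  by have := fB _ _ (@vge1 k); rewrite add0r.
exists g => // v; apply/eqP; rewrite -subr_eq0; apply/eqP.
pose C v := B v - Phi (g * v); rewrite -/(C v).
have lC : klinear C by apply: klinear_sub => //; apply: klinear_premul.
have fC : filtered N C.
  by apply: filtered_sub => //; rewrite -[N]addr0; apply: filtered_premul.
have pC : poly_op C.
  by apply: poly_op_sub => //; apply: poly_op_premul fPhi pPhi.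
have PC w : P (C w) = C (lmonom k (- d%:Z) * w).
  rewrite /C -PB [g * (_ * _)]mulrCA -PPhi /P (klinearB (@klinear_euler k)).
  by set a := B w; set b := Phi _; ring.
have C1 : C 1 = 0 by rewrite /C mulr1 gE subrr.
have CN (j : nat) : filtered (N + j%:Z) C.
  elim: j => [|j IHj]; first by rewrite addr0.
  rewrite intS addrCA addrC; set M := N + j%:Z in IHj *; apply: (filteredS lC IHj).
  have d0 : d%:Z != 0 by lia.
  move=> n; rewrite (polyfun_periodic k_char0 d0 (pC M)) => [|m].
    by rewrite add0r lmonom0 C1.
  have := congr1 (fun f => lcoef f (m - d%:Z + M)) (PC (lmonom k m)).
  rewrite -lmonomD [- _ + m]addrC => <-; rewrite lcoefD lcoef_monomM opprK.
  (* The [phi] term starts [r + d] orders above the coefficient compared, so periodicity there is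
     exact. *)
  rewrite (_ : lcoef (phi * _) _ = 0) ?addr0; first by congr lcoef; lia.
  have := zero_belowM phi_vge (vge_euler (IHj _ _ (vge_monom m))); apply; lia.
apply: vge_all => n; have vv := vge_lord v.
by apply: zero_below_le (CN (absz (n - N - lord v)%R) _ _ vv); lia.
Qed.
End Centralizer.
End Intertwiner.

Section Stationary.
Context (k : fieldType) (k_char0 : [pchar k] =i pred0).
Implicit Types (f g h u v w : laurent k) (N M n m : int) (A B : laurent k -> laurent k).
Context (r d : nat) (r_gt0 : (0 < r)%N) (d_gt0 : (0 < d)%N).
Context (psi : laurent k) (e : k) (e0 : e != 0) (hpsi : lead r%:Z e psi).

(** With [zeta = psi], the operator [phi * euler] is [zeta^2 d/d zeta] in the new variable. *)
Let phi := psi ^+ 2 / euler psi.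
Let P v := lmonom k (- d%:Z) * v + phi * euler v.

(** [P psi^-1 - psi^-1 P = -1], so that [- psi^-1 Phi - Phi (t^d euler / d)] falls under [centralizer]. *)
Lemma normal_form : exists Phi G, [/\ klinear Phi, filtered 0 Phi,
  (forall n, lcoef (Phi (lmonom k n)) n = 1),
  (forall v, P (Phi v) = Phi (lmonom k (- d%:Z) * v)) /\
  (forall v, - (psi^-1 * Phi v) =
     Phi (lmonom k d%:Z * (lconst d%:R^-1 * euler v + G * v)))
  & vge 1 (G + lmonom k (- d%:Z) * psi^-1
             - lconst ((d%:R - r%:R) / (2 * d%:R)))].
Proof.
have rk0 : r%:R != 0 :> k by rewrite (char0_natr_eq0 k_char0) -lt0n.
have dk0 : d%:R != 0 :> k by rewrite (char0_natr_eq0 k_char0) -lt0n.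
have k20 : 2 != 0 :> k by rewrite (char0_natr_eq0 k_char0).
have psi0 := lead_neq0 hpsi e0.
have hpsiE := lead_euler hpsi; rewrite -pmulrn in hpsiE.
have re0 : r%:R * e != 0 by rewrite mulf_neq0.
have epsi0 := lead_neq0 hpsiE re0.
have hphi : lead r%:Z (e / r%:R) phi.
  have := leadM (leadX 2 hpsi) (leadV re0 hpsiE).
  rewrite (_ : 2%:Z * r%:Z - r%:Z = r%:Z); last by lia.
  by rewrite (_ : e ^+ 2 / _ = e / r%:R) //; field; rewrite rk0.
have [hphi1 hphi2] := hphi.
have [Phi [lP fP pP PP [c [Pdiag Ps cs cd]]]] :=
  intertwiner_exists k_char0 r_gt0 d_gt0 hphi1.
set s := (r + d)%N in Ps cs.
have hV := leadV e0 hpsi; have [hV1 _] := hV.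
have lE := @klinear_euler k.
(* With [zetahat = t^d], this is [zetahat^2 d/d zetahat]. *)
pose Q v := lmonom k d%:Z * (lconst d%:R^-1 * euler v).
pose B v := - (psi^-1) * Phi v - Phi (Q v).
have lQ : klinear Q by do 2!apply: klinear_mul; exact: klinear_euler.
have fQ : filtered 0 Q.
  apply: (@filtered_le _ (d%:Z + (0 + 0))); first by lia.
  apply: filtered_mul (vge_monom _) _; apply: filtered_mul (vge_const _) _.
  exact: filtered_euler.
have lB : klinear B.
  by apply: klinear_sub; [exact: klinear_mul|exact: (klinear_comp lP lQ)].
have fPQ : filtered 0 (fun v => Phi (Q v)) by have := filtered_comp fP fQ.
have fB : filtered (- r%:Z) B.
  apply: filtered_sub; last by apply: filtered_le fPQ; lia.
  by have := filtered_mul (vgeN hV1) fP; rewrite addr0.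
have pB : poly_op B.
  apply: poly_op_sub; first exact: (poly_op_mul _ fP pP).
  pose Phi' v := Phi (lmonom k d%:Z * (lconst d%:R^-1 * v)).
  have lP' : klinear Phi' by exact: (klinear_premul _ (klinear_premul _ lP)).
  suff pP' : poly_op Phi' by exact: (poly_op_euler lP' pP').
  have h := poly_op_premul (lmonom k d%:Z * lconst d%:R^-1) lP fP pP.
  by apply: poly_op_ext h => v; rewrite /Phi' mulrA.
have PB v : P (B v) = B (lmonom k (- d%:Z) * v).
  have dd : lmonom k d%:Z * lmonom k (- d%:Z) = 1 by rewrite -lmonomD subrr.
  have cc : lconst d%:R^-1 * lconst d%:R = 1 :> laurent k.
    by rewrite -rmorphM mulVf ?rmorph1.
  have QE : Q (lmonom k (- d%:Z) * v) = lmonom k (- d%:Z) * Q v - v.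
    rewrite /Q eulerM euler_monom mulrNz -pmulrn rmorphN /=.
    set D := lmonom k d%:Z in dd *; set D' := lmonom k _ in dd *.
    move: (lconst d%:R^-1) (lconst d%:R) cc => x y xy.
    transitivity (D' * (D * (x * euler v)) - (D * D') * (x * y) * v); first by ring.
    by rewrite dd xy !mul1r.
  have phiV : phi * euler psi^-1 = - 1.
    have := @eulerXz k psi (-1) psi0; rewrite -invr_expz expr1z mulrNz rmorphN rmorph1.
    move=> /(congr1 (fun f => psi^-1 * f)); rewrite mulKf // => ->.
    by rewrite /phi; field; rewrite epsi0 psi0.
  rewrite {2}/B QE (klinearB lP) -!PP /B /P.
  set a := Phi v; set b := Phi (Q v).
  rewrite mulNr (klinearB lE) (klinearN lE) eulerM.
  transitivity (lmonom k (- d%:Z) * (- (psi^-1 * a) - b)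
     - (phi * euler psi^-1) * a - phi * (psi^-1 * euler a) - phi * euler b); first by ring.
  by rewrite phiV; ring.
have Pd0 n : lcoef (Phi (lmonom k n)) n != 0 by rewrite Pdiag oner_neq0.
have [g gr gE] := centralizer k_char0 r_gt0 d_gt0 hphi1 lP fP pP Pd0 PP lB fB pB PB.
exists Phi, (lmonom k (- d%:Z) * g); split=> //.
  split=> // v; have := gE v; rewrite /B mulNr => /eqP.
  rewrite subr_eq -(klinearD lP) => /eqP ->; congr Phi.
  by rewrite [RHS]mulrDr !mulrA -lmonomD subrr mul1r addrC /Q !mulrA.
have lD : klinear (fun v => Phi v - v) by apply: klinear_sub => //; exact: klinear_id.
have sd : - r%:Z + s%:Z = d%:Z by rewrite /s; lia.
have dcoef n : lcoef (Phi (lmonom k n) - lmonom k n) (n + s%:Z) = c.[n%:~R].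
  rewrite lcoefB cs lcoef_monom (_ : (_ == _) = false) ?subr0 //.
  by apply/negbTE; rewrite /s; lia.
have g1 : Phi g = - (psi^-1 * Phi 1).
  have := gE 1; rewrite mulr1 => <-; rewrite /B /Q euler1 !mulr0 (klinear0 lP) subr0.
  by rewrite mulNr.
pose d0 := Phi 1 - 1; pose d1 := Phi g - g.
have hd0 : lead s%:Z (c.[0]) d0.
  have := filtered_lead lD Ps (lead1 k); rewrite add0r mul1r.
  by have := dcoef 0; rewrite add0r => ->.
(* To first order [g] is [- psi^-1]. The corrections [d0] and [d1] that [Phi] makes to [1] and to
   [g] start at orders [s] and [s - r = d], with coefficients [c(0)] and [- c(-r) / e]; this is how
   the two values of [c] enter. *)
have gd : g = - psi^-1 - psi^-1 * d0 - d1.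
  by rewrite /d0 /d1 g1; move: (Phi 1) => p; ring.
have hVd0 : lead d%:Z (e^-1 * c.[0]) (psi^-1 * d0).
  by rewrite -sd; apply: leadM.
have d1d : vge d%:Z d1 by rewrite -sd; apply: Ps.
have hg : lead (- r%:Z) (- e^-1) g.
  apply: lead_add (leadN hV) _; rewrite gd.
  have -> : - psi^-1 - psi^-1 * d0 - d1 - - psi^-1 = - (psi^-1 * d0) - d1 by ring.
  have [vd0 _] := hVd0.
  by apply: vgeB; [apply: vgeN; apply: zero_below_le vd0|apply: zero_below_le d1d]; clear -r_gt0; lia.
have hd1 : lead d%:Z (- e^-1 * c.[(- r%:Z)%:~R]) d1.
  by have := filtered_lead lD Ps hg; rewrite dcoef sd.
have hsum : lead d%:Z (- (e^-1 * c.[0]) + - (- e^-1 * c.[(- r%:Z)%:~R])) (g + psi^-1).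
  have -> : g + psi^-1 = - (psi^-1 * d0) - d1 by rewrite gd; ring.
  have [v1 e1] := hVd0; have [v2 e2] := hd1.
  split; last by rewrite lcoefB lcoefN e1 e2.
  by apply: vgeB; [apply: vgeN|].
have crE : c.[(- r%:Z)%:~R] - c.[0] = e * (d%:R - r%:R) / (2 * d%:R).
  (* [al x^2 + be x] is a particular solution of [c(x - d) - c(x) = (e / r) x]. Its difference with
     [c] is a [d]-periodic polynomial, hence a constant, which drops out of [c(-r) - c(0)]. *)
  pose al : k := - e / (2 * r%:R * d%:R); pose be := al * d%:R.
  pose q : {poly k} := c - (al *: 'X^2 + be *: 'X).
  have dz0 : d%:Z != 0 by lia.
  have h (n : int) : q.[n%:~R] = q.[0%:~R].
    apply: (polyfun_periodic (b := fun n : int => q.[n%:~R]) k_char0 dz0); first by exists q.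
    move=> {}n; apply/eqP; rewrite -subr_eq0; apply/eqP; rewrite rmorphB /= -pmulrn /q !hornerE.
    have /eqP := cd n%:~R; rewrite hphi2 subr_eq => /eqP ->.
    rewrite /=; set c1 := c.[_]; move: c1 => c1; move: (n%:~R) => x.
    by rewrite /be /al; field; rewrite dk0 rk0 k20.
  have := h (- r%:Z).
  rewrite /q !hornerE mulrNz -pmulrn mulr0z => /eqP; rewrite subr_eq => /eqP ->.
  rewrite /=; set c1 := c.[0]; move: c1 => c1.
  by rewrite /be /al; field; rewrite dk0 rk0 k20.
have := leadM (lead_monom k (- d%:Z)) hsum.
rewrite addNr mul1r mulrDr => /leadP.
rewrite add0r lmonom0 mulr1; congr (vge 1 (_ - lconst _)).
have := crE; move: (c.[_]) (c.[_]) => c1 c2 /eqP; rewrite subr_eq => /eqP ->.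
by field; rewrite e0 dk0 k20.
Qed.
End Stationary.

(** Write [t^r F(t) = w^-d] with [w = c t y], where [c^d = a^-1] exists by algebraic closedness and
    [y] is a [d]-th root of a unit with constant term [1]; then [u] is the compositional inverse of
    [w]. *)
Lemma exists_fourier_root (k : closedFieldType) (k_char0 : [pchar k] =i pred0)
    (r d : nat) (a : k) (F : laurent k) :
  (0 < d)%N -> a != 0 -> lead (- (r + d)%:Z) a F ->
  exists u e, [/\ e != 0, lead 1 e u & u ^+ r * lcomp F u = lmonom k (- d%:Z)].
Proof.
move=> d0 a0 hF.
have [c cd] : exists c : k, c ^+ d = a^-1.
  have [c hc] := solve_monicpoly (fun i => if i is 0 then a^-1 else 0) d0.
  exists c; rewrite hc; case: d d0 {hF hc} => // n _.
  by rewrite big_ord_recl mulr1 big1 ?addr0 // => i _; rewrite mul0r.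
have c0 : c != 0.
  by apply: contra_eqN cd => /eqP ->; rewrite expr0n gtn_eqF // eq_sym invr_eq0.
have F0 := lead_neq0 hF a0.
pose v := (lconst a^-1 * lmonom k (r + d)%:Z * F)^-1.
have hv : lead 0 1 v.
  rewrite /v -[1]invr1 -(oppr0 int); apply: leadV; first exact: oner_neq0.
  have := leadM (leadZ a^-1 (lead_monom k (r + d)%:Z)) hF.
  by rewrite subrr mulr1 mulVf.
have [y [hy yd]] := unit_root k_char0 d0 hv.
pose w := lconst c * lmonom k 1 * y.
have hw : lead 1 c w.
  have := leadM (leadZ c (lead_monom k 1)) hy.
  by rewrite addr0 !mulr1.
have wd : lmonom k r%:Z * F * w ^+ d = 1.
  have hu0 : lconst a^-1 * lmonom k (r + d)%:Z * F != 0.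
    by rewrite !mulf_neq0 ?lmonom_neq0 // (lead_neq0 (lead_const _)) ?invr_eq0.
  rewrite -(mulfV hu0) -/v /w !exprMn yd lmonomX mul1r -rmorphXn cd PoszD lmonomD.
  by rewrite /=; move: (lconst _) => b; ring.
have wN : w ^ (- d%:Z) = lmonom k r%:Z * F.
  have w0 : w ^+ d != 0 by rewrite expf_neq0 // (lead_neq0 hw).
  by rewrite -exprnN -[RHS]mulr1 -(mulfV w0) mulrA wd mul1r.
have [lw fw wm] := lcomp_spec c0 hw.
have [u uw] := triangular_surj lw fw (lcomp_diag c0 hw) (lmonom k 1).
have u1 : vge 1 u by apply/(vge_lcomp c0 hw); rewrite uw; exact: vge_monom.
have hu : lead 1 (lcoef u 1) u by [].
have e0 : lcoef u 1 != 0.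
  have [_] := lcomp_lead c0 hw hu; rewrite uw lcoef_monom eqxx => h.
  by apply: contraTneq isT => e0; move: h; rewrite e0 mul0r => /eqP; rewrite oner_eq0.
exists u, (lcoef u 1); split=> //.
apply: (lcomp_inj c0 hw); rewrite (lcompM c0 hw) (lcompX c0 hw).
by rewrite (lcompA _ e0 c0 hu hw) uw lcomp_id wm wN lmonomX mul1r.
Qed.

Section NormalForm.
Context (k : fieldType) (k_char0 : [pchar k] =i pred0).
Context (r d : nat) (r_gt0 : (0 < r)%N) (d_gt0 : (0 < d)%N).
Context (F u : laurent k) (e : k) (e0 : e != 0) (hu : lead 1 e u).
Hypothesis uF : u ^+ r * lcomp F u = lmonom k (- d%:Z).

(** [Psi] is [Phi], taken for [psi = u^r], followed by the inverse [D] of the substitution of [u],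
    which returns to the variable [zeta^(1/r)]. *)
Lemma fourier_normal_form : exists Psi G, [/\ klinear Psi, filtered 0 Psi,
  (forall n, lcoef (Psi (lmonom k n)) n != 0),
  (forall v, lmonom k r%:Z * (lconst r%:R^-1 * euler (Psi v) + F * Psi v) =
     Psi (lmonom k (- d%:Z) * v)) /\
  (forall v, - (lmonom k (- r%:Z) * Psi v) =
     Psi (lmonom k d%:Z * (lconst d%:R^-1 * euler v + G * v)))
  & vge 1 (G + lcomp F u - lconst ((d%:R - r%:R) / (2 * d%:R)))].
Proof.
have rk0 : r%:R != 0 :> k by rewrite (char0_natr_eq0 k_char0) -lt0n.
have u0 := lead_neq0 hu e0.
have hpsi : lead r%:Z (e ^+ r) (u ^+ r) by have := leadX r hu; rewrite mulr1.
have er0 : e ^+ r != 0 by rewrite expf_neq0.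
have [Phi [G [lP fP Pd [PP PQ] hG]]] := normal_form k_char0 r_gt0 d_gt0 er0 hpsi.
have [lC fC Cm] := lcomp_spec e0 hu.
have [D [lD fD CK DK]] := triangular_inverse lC fC (lcomp_diag e0 hu).
have Ddiag n : lcoef (D (lmonom k n)) n != 0.
  have [Dn _] : vge n (D (lmonom k n)) /\ True.
    by split=> //; have := fD _ _ (vge_monom n); rewrite addr0.
  have [_] := lcomp_lead e0 hu (conj Dn erefl : lead n _ _).
  rewrite DK lcoef_monom eqxx => h.
  by apply: contraTneq isT => D0; move: h; rewrite D0 mul0r => /eqP; rewrite oner_eq0.
have C_inj := can_inj CK.
exists (fun v => D (Phi v)), G; split.
- exact: (klinear_comp lD lP).
- exact: (filtered_comp fD fP).
- move=> n; have := filtered_lead lD fD (conj (fP _ _ (vge_monom n)) erefl : lead _ _ _).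
  by rewrite !addr0 => -[_ ->]; rewrite Pd mul1r.
- have euE : euler u != 0 by apply: lead_neq0 (lead_euler hu) _; rewrite mul1r.
  have cc : lconst r%:R^-1 * lconst r%:R = 1 :> laurent k.
    by rewrite -rmorphM mulVf ?rmorph1.
  have c0 : lconst r%:R != 0 :> laurent k by rewrite (lead_neq0 (lead_const _)).
  have euX : euler (u ^+ r) = lconst r%:R * (u ^+ r * euler u) / u.
    by apply: (mulfI u0); rewrite eulerX [RHS]mulrC divfK.
  have uX0 : u ^+ r != 0 by rewrite expf_neq0.
  split=> v; apply: C_inj; rewrite DK.
    have EP : lcomp (euler (D (Phi v))) u = u / euler u * euler (Phi v).
      by have := euler_lcomp e0 hu (D (Phi v)); rewrite DK => ->; field; rewrite euE u0.
    rewrite (lcompM e0 hu) (lcompD e0 hu) !(lcompM e0 hu) (lcomp_const e0 hu) DK Cm.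
    rewrite EP -PP -uF -exprnP euX.
    move: (lconst r%:R^-1) (lconst r%:R) cc c0 => x y xy y0.
    have -> : x = y^-1 by apply: (mulIf y0); rewrite xy mulVf.
    by field; rewrite euE u0 y0 uX0.
  rewrite (lcompN e0 hu) (lcompM e0 hu) Cm DK -exprnN; exact: PQ.
have -> : lcomp F u = lmonom k (- d%:Z) / u ^+ r.
  by rewrite -uF mulrAC mulfV ?mul1r // expf_neq0.
exact: hG.
Qed.
End NormalForm.

(** * The local Fourier transform *)

Lemma connection_isoI (k : fieldType) (E S : connection k) (f : E -> S) :
  linear f -> (forall v, f (nabla E v) = nabla S (f v)) -> bijective f ->
  connection_iso E S.
Proof.
move=> f_lin f_hor f_bij.
pose g : {linear E -> S} := HB.pack f (GRing.isLinear.Build _ _ _ _ f f_lin).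
have gE : linfun g =1 f by move=> v; rewrite lfunE.
exists (linfun g); split; first by move=> v; rewrite !gE.
by apply: eq_bij f_bij _ _ => v; rewrite gE.
Qed.

Lemma connection_iso_trans (k : fieldType) (E S U : connection k) :
  connection_iso E S -> connection_iso S U -> connection_iso E U.
Proof.
move=> [f [f_hor f_bij]] [g [g_hor g_bij]].
apply: (@connection_isoI _ _ _ (g \o f)) => [a v w|v|] /=.
- by rewrite !linearP.
- by rewrite f_hor g_hor.
- exact: bij_comp.
Qed.

Section Ramified.
Context (k : fieldType) (q : nat) (q_gt0 : (0 < q)%N).
Local Notation Kq := (@ramified k q q_gt0).

Lemma lexpand_const (c : k) : lexpand q_gt0 (lconst c) = lconst c.
Proof.
have q0 : q%:Z != 0 by lia.
apply: laurentP => n /=; case: ifP => [/dvdzP[m ->]|qn].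
  by rewrite mulzK // mulf_eq0 (negbTE q0) orbF.
by case: eqP qn => // ->; rewrite dvdz0.
Qed.

Lemma lexpand_monom n : @lexpand k q q_gt0 (lmonom k n) = lmonom k (q%:Z * n).
Proof.
have q0 : q%:Z != 0 by lia.
apply: laurentP => m /=; case: ifP => [/dvdzP[j ->]|qm].
  by rewrite mulzK // [_ * n]mulrC (inj_eq (mulIf q0)).
by case: eqP qm => // ->; rewrite dvdz_mulr.
Qed.

Lemma vge_lexpand n (h : laurent k) : vge n h -> vge (q%:Z * n) (lexpand q_gt0 h).
Proof.
move=> hn i iq /=; case: ifP => // _; apply: hn.
by rewrite ltz_divLR; lia.
Qed.

Lemma ramified_derivE (v : Kq) :
  ramified_deriv v = lmonom k (- q%:Z) * (lconst q%:R^-1 * euler v).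
Proof.
have H : lconst q%:R^-1 * lmonom k (1 - q%:Z) * (lmonom k (-1) * euler v) =
    lmonom k (- q%:Z) * (lconst q%:R^-1 * euler v).
  rewrite [in RHS](_ : - q%:Z = 1 - q%:Z + -1); last by lia.
  by rewrite [in RHS]lmonomD; ring.
by rewrite /ramified_deriv lderivE; exact: H.
Qed.

Lemma E_nablaE (f v : Kq) :
  E_nabla f v = lmonom k (- q%:Z) * (lconst q%:R^-1 * euler v + f * v).
Proof.
by rewrite /E_nabla ramified_derivE ramified_scaleE lexpand_monom mulrN1 mulrDr.
Qed.

Lemma slices_decomp (v : Kq) :
  v = \sum_(j < q) slices v 0 j *: (lmonom k j%:Z : Kq).
Proof.
apply: laurentP => n; rewrite lcoef_sum.
have q0 : q%:Z != 0 by lia.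
have jP : (absz (n %% q%:Z)%Z < q)%N.
  by have := ltz_pmod n (d := q%:Z); have := modz_ge0 n q0; lia.
have nE := divz_eq n q%:Z; have nm := modz_ge0 n q0.
rewrite (bigD1 (Ordinal jP)) // big1 ?addr0 => [|j jn].
  rewrite ramified_scaleE mulrC lcoef_monomM /= mxE /=.
  rewrite (_ : n - _ = (n %/ q%:Z)%Z * q%:Z); last by lia.
  by rewrite dvdz_mull // mulzK //= addr0; congr (lcoef v _); lia.
rewrite ramified_scaleE mulrC lcoef_monomM /=; case: ifP => // /dvdzP[m nm'].
case/eqP: jn; apply: val_inj => /=.
have -> : n = m * q%:Z + j%:Z by lia.
by rewrite modzMDl modz_small //; have := ltn_ord j; lia.
Qed.

Lemma vge_slices (v : Kq) (M : int) j : vge (q%:Z * M) v -> vge M (slices v 0 j).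
Proof. by move=> vM n nM; rewrite mxE /=; apply: vM; have := ltn_ord j; nia. Qed.

(** [vcvg] refers to an unspecified basis. A [K]-linear functional is controlled by its values on
    [1, t, ..., t^(q-1)], so each coordinate function is [t]-adically continuous. *)
Lemma functional_continuous (la : Kq -> laurent k) (N : int) : scalar la ->
  exists M, forall v, vge M v -> vge N (la v).
Proof.
move=> la_lin.
pose L : {scalar Kq} := HB.pack la (GRing.isLinear.Build _ _ _ _ la la_lin).
pose b := \sum_(j < q) `|lord (L (lmonom k j%:Z))|%N.
exists (q%:Z * (N + b%:Z)) => v vM.
rewrite -[la v]/(L v) (slices_decomp v) linear_sum; apply: vge_sum => j _.
rewrite linearZ; apply: vgeM (vge_slices j vM) (vge_lord _) _.
have : (`|lord (L (lmonom k j%:Z))|%N <= b)%N by rewrite /b (bigD1 j) //= leq_addr.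
by move: (lord _) => x; lia.
Qed.
End Ramified.

Section Limits.
Context (k : fieldType).

Lemma vcvg_uniq (V : vectType (laurent k)) (v_ : nat -> V) v w :
  vcvg v_ v -> vcvg v_ w -> v = w.
Proof.
move=> cv cw; rewrite (coord_vbasis (memvf v)) (coord_vbasis (memvf w)).
by apply: eq_bigr => i _; congr (_ *: _); apply: lcvg_uniq (cv i) (cw i).
Qed.

Lemma ramified_vcvg q (q_gt0 : (0 < q)%N) (v_ : nat -> ramified k q_gt0) v :
  lcvg v_ v -> vcvg v_ v.
Proof.
move=> cv i N.
have [|M LM] := @functional_continuous k q q_gt0 (coord (vbasis fullv) i) N.
  by move=> a x y; rewrite linearP.
have [n0 hn] := cv M; exists n0 => n /hn /LM.
by rewrite linearB.
Qed.
End Limits.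

Section Transport.
Context (k : fieldType) (k_char0 : [pchar k] =i pred0).
Context (r d : nat) (r_gt0 : (0 < r)%N) (d_gt0 : (0 < d)%N).
Context (F : ramified k r_gt0) (G : ramified k d_gt0).
Context (Psi Psi' : laurent k -> laurent k).
Hypotheses (lPsi : klinear Psi) (fPsi : filtered 0 Psi).
Hypotheses (PsiK : cancel Psi Psi') (Psi'K : cancel Psi' Psi).
Hypothesis PsiP : forall v,
  lmonom k r%:Z * (lconst r%:R^-1 * euler (Psi v) + F * Psi v) =
  Psi (lmonom k (- d%:Z) * v).
Hypothesis PsiQ : forall v, - (lmonom k (- r%:Z) * Psi v) =
  Psi (lmonom k d%:Z * (lconst d%:R^-1 * euler v + G * v)).

Let E := E_ k_char0 F.

Let lPsi' : klinear Psi'.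
Proof.
by move=> a v w; apply: (can_inj PsiK); rewrite lPsi !Psi'K.
Qed.

Lemma zhatE (v : laurent k) : zhat (v : E) = Psi (lmonom k (- d%:Z) * Psi' v).
Proof.
rewrite /zhat /= E_nablaE ramified_scaleE lexpand_monom mulrA -lmonomD.
by rewrite (_ : r%:Z * 2 + - r%:Z = r%:Z); [rewrite -PsiP Psi'K|lia].
Qed.

(** The two factors [zhat] contribute [t^(-2d)] and [- zeta^-1] contributes [t^d (euler / d + G)];
    together they form [E_nabla G]. *)
Lemma nablahatE (v : laurent k) : nablahat (v : E) = Psi (E_nabla G (Psi' v)).
Proof.
rewrite /nablahat ramified_scaleE lexpand_monom mulrN1 !zhatE PsiK.
rewrite -(klinearN lPsi) -2!mulrN -(klinearN lPsi') -{1}(Psi'K v) PsiQ PsiK.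
rewrite E_nablaE; congr Psi; rewrite !mulrA -!lmonomD.
by congr (lmonom k _ * _); clear; lia.
Qed.

Definition transport_zetahat (v : E) : E := Psi (lmonom k d%:Z * Psi' v).

Fact transport_zetahatK : cancel transport_zetahat (@zhat k E).
Proof.
by move=> v; rewrite /transport_zetahat zhatE PsiK mulrA -lmonomD addNr mul1r Psi'K.
Qed.
Fact transport_zhatK : cancel (@zhat k E) transport_zetahat.
Proof.
by move=> v; rewrite zhatE /transport_zetahat PsiK mulrA -lmonomD subrr mul1r Psi'K.
Qed.

Lemma transport_zetahat_expE i (v : E) :
  zetahat_exp transport_zetahat i v = Psi (lmonom k (d%:Z * i) * Psi' v).
Proof.
case: i => n /=.
  elim: n => [|n IHn]; first by rewrite mulr0 mul1r Psi'K.
  by rewrite iterS IHn /transport_zetahat PsiK mulrA -lmonomD intS mulrDr mulr1.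
rewrite zhatE NegzE; elim: n => [|n IHn].
  by rewrite /= mulrN1.
by rewrite iterS zhatE IHn !PsiK mulrA -lmonomD; congr (Psi (lmonom k _ * _)); clear; lia.
Qed.

Definition transport_act (h : laurent k) (v : E) : E := Psi (lexpand d_gt0 h * Psi' v).

Fact transport_act_cvg h v :
  vcvg (fun n => \sum_(j < n) lconst (lcoef h (lord h + j%:Z)) *:
                   zetahat_exp transport_zetahat (lord h + j%:Z) v)
       (transport_act h v).
Proof.
apply: ramified_vcvg => N; have vv := vge_lord (Psi' v : laurent k).
exists (`|N| + `|lord h| * d + `|lord (Psi' v : laurent k)|)%N => n nN.
have -> : \sum_(j < n) lconst (lcoef h (lord h + j%:Z)) *:
      zetahat_exp transport_zetahat (lord h + j%:Z) v =
    Psi (lexpand d_gt0 (partial_sum (lord h) h n) * Psi' v).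
  rewrite rmorph_sum mulr_suml (klinear_sum lPsi); apply: eq_bigr => j _.
  rewrite rmorphM /= lexpand_const lexpand_monom -mulrA (klinearZ lPsi).
  by rewrite transport_zetahat_expE ramified_scaleE lexpand_const.
rewrite /transport_act -(klinearB lPsi) -mulrBl -rmorphB.
have := vge_partial_sum n (vge_lord h) => /vgeBC /(vge_lexpand d_gt0) hn.
have := fPsi (zero_belowM hn vv); apply: zero_below_le.
move: nN; move: (lord h) (lord _) => x y; rewrite addr0; nia.
Qed.

Fact transport_actA a b v : transport_act a (transport_act b v) = transport_act (a * b) v.
Proof. by rewrite /transport_act PsiK rmorphM mulrA. Qed.
Fact transport_act1 : left_id 1 transport_act.
Proof. by move=> v; rewrite /transport_act rmorph1 mul1r Psi'K. Qed.
Fact transport_actDr : right_distributive transport_act +%R.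
Proof.
by move=> a v w; rewrite /transport_act (klinearD lPsi') mulrDr (klinearD lPsi).
Qed.
Fact transport_actDl v : {morph transport_act^~ v : a b / a + b}.
Proof. by move=> a b; rewrite /transport_act rmorphD mulrDl (klinearD lPsi). Qed.

Definition transport_action : hat_action E :=
  @HatAction k E transport_zetahat transport_zetahatK transport_zhatK transport_act transport_act_cvg
    transport_actA transport_act1 transport_actDr transport_actDl.

Fact transport_findim : Vector.axiom d (hat_space transport_action).
Proof.
exists (fun v => slices (Psi' v : ramified k d_gt0)).
  move=> a v w; rewrite (klinearD lPsi') /= -slices_linear; congr (slices (_ + _)).
  by rewrite -[a *: v]/(transport_act a v) /transport_act PsiK.
have [g gK Kg] := @slices_bijective k d d_gt0.
exists (fun w => Psi (g w) : hat_space transport_action) => [v|w].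
  by rewrite gK Psi'K.
by rewrite PsiK Kg.
Qed.

Fact transport_is_connection :
  is_connection (@nablahat k E : hat_space transport_action -> _).
Proof.
have [nl nZ] := E_is_connection k_char0 G.
have actE h (v : hat_space transport_action) : h *: v = Psi (lexpand d_gt0 h * Psi' v) by [].
split=> [a v w|h v].
  rewrite !actE !nablahatE (klinearD lPsi') PsiK.
  have := nl a (Psi' v) (Psi' w); rewrite !ramified_scaleE => ->.
  by rewrite PsiK (klinearD lPsi).
rewrite !actE !nablahatE !PsiK.
have := nZ h (Psi' v); rewrite !ramified_scaleE => ->.
by rewrite (klinearD lPsi).
Qed.

(** Every admissible structure has the same [zetahat], the inverse of [zhat], and the same action, a
    limit of the same partial sums; so [Psi'] is linear for whichever structure was chosen. *)
Lemma transported_fourier : connection_iso (local_fourier E) (E_ k_char0 G).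
Proof.
(* The transported structure excludes the default branch. *)
rewrite /local_fourier; case: pselectT => [/(_ _)[]|fs].
  exact: FourierStructure transport_findim transport_is_connection.
have zE : zetahat (fs_action fs) = transport_zetahat.
  apply: funext => v; apply: (can_inj transport_zhatK).
  by rewrite transport_zetahatK zetahatK.
have actE h (v : fourier_connection fs) : h *: v = Psi (lexpand d_gt0 h * Psi' v).
  apply: vcvg_uniq (hat_act_cvg (fs_action fs) h v) _.
  by rewrite zE; exact: transport_act_cvg.
apply: (@connection_isoI _ (fourier_connection fs) (E_ k_char0 G) (Psi' : E -> laurent k)).
- by move=> a v w; rewrite (klinearD lPsi') actE PsiK.
- by move=> v /=; rewrite nablahatE PsiK.
- by exists Psi.
Qed.
End Transport.

(** * Galois twists, gauge equivalence and the orbit of [g] *)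

Local Opaque lcomp.

Section Twist.
Context (k : fieldType).
Implicit Types (f g h u v w : laurent k).

Lemma lead_twist (eta : k) : lead 1 eta (lconst eta * lmonom k 1).
Proof. by have := leadZ eta (lead_monom k 1); rewrite mulr1. Qed.

(** A twist is the substitution of [eta t], so it inherits multiplicativity and the chain rule from
    [lcomp]. *)
Lemma ltwistE q (q_gt0 : (0 < q)%N) (eta : k) f : eta != 0 ->
  ltwist eta (f : ramified k q_gt0) = lcomp f (lconst eta * lmonom k 1).
Proof.
move=> eta0; have [lC fC Cm] := lcomp_spec eta0 (lead_twist eta).
have lT : klinear (@ltwist k q q_gt0 eta).
  move=> a v w; apply: laurentP => n.
  rewrite -[LHS]/(eta ^ n * lcoef (lconst a * v + w) n) !(lcoefD, lcoef_constM).
  by rewrite mulrDr mulrCA.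
have fT : filtered 0 (@ltwist k q q_gt0 eta).
  by move=> M v vM n; rewrite addr0 /= => nM; rewrite vM // mulr0.
apply: (flin_ext lT fT lC fC) => n; rewrite Cm exprzMl ?lmonomXz ?mul1r; last 2 first.
- by rewrite unitfE (lead_neq0 (lead_const _)).
- by rewrite unitfE lmonom_neq0.
have -> : lconst eta ^ n = lconst (eta ^ n).
  by case: n => n; rewrite ?NegzE -?exprnP -?exprnN ?fmorphV rmorphXn.
apply: laurentP => m; rewrite lcoef_constM lcoef_monom /= mulrC.
by case: eqP => [->|]; rewrite ?mul1r ?mulr1 ?mul0r ?mulr0.
Qed.

Lemma euler_twist (eta : k) f : eta != 0 ->
  euler (lcomp f (lconst eta * lmonom k 1)) = lcomp (euler f) (lconst eta * lmonom k 1).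
Proof.
move=> eta0; have u0 := lead_neq0 (lead_twist eta) eta0.
rewrite (euler_lcomp eta0 (lead_twist eta)) (klinearZ (@klinear_euler k)) euler_monom.
by rewrite rmorph1 mul1r mulfV // mul1r.
Qed.

Lemma twist_lexpand q (q_gt0 : (0 < q)%N) (eta : k) h : eta ^+ q = 1 ->
  ltwist eta (lexpand q_gt0 h : ramified k q_gt0) = lexpand q_gt0 h.
Proof.
move=> etaq; apply: laurentP => n /=; case: ifP => [/dvdzP[m ->]|]; last by rewrite mulr0.
by rewrite [m * _]mulrC -exprz_exp -exprnP etaq exp1rz mul1r.
Qed.

Lemma ltwist_comp q (q_gt0 : (0 < q)%N) (eta theta : k) (f : ramified k q_gt0) :
  ltwist eta (ltwist theta f) = ltwist (eta * theta) f.
Proof. by apply: laurentP => n /=; rewrite expfzMl mulrA. Qed.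

Lemma ltwist1 q (q_gt0 : (0 < q)%N) (f : ramified k q_gt0) : ltwist 1 f = f.
Proof. by apply: laurentP => n /=; rewrite exp1rz mul1r. Qed.

Lemma unity_neq0 (eta : k) q : (0 < q)%N -> eta ^+ q = 1 -> eta != 0.
Proof.
move=> q_gt0 etaq; apply: contra_eqN etaq => /eqP ->.
by rewrite expr0n gtn_eqF // eq_sym oner_eq0.
Qed.
End Twist.

Section Gauge.
Context (k : fieldType) (k_char0 : [pchar k] =i pred0) (q : nat) (q_gt0 : (0 < q)%N).
Local Notation Kq := (@ramified k q q_gt0).

Lemma gauge_iso (G1 G2 : Kq) (h : laurent k) : h != 0 ->
  lconst q%:R^-1 * euler h = (G1 - G2 : laurent k) * h ->
  connection_iso (E_ k_char0 G1) (E_ k_char0 G2).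
Proof.
move=> h0 hE; apply: (@connection_isoI _ (E_ k_char0 G1) (E_ k_char0 G2) (fun v : laurent k => h * v)).
- move=> a v w; rewrite /= !ramified_scaleE; move: (lexpand _ _) => x.
  suff H (b y z t : laurent k) : b * (y * z + t) = y * (b * z) + b * t by exact: H.
  by ring.
- move=> v /=; rewrite !E_nablaE eulerM.
  have H (c t g1 g2 h' v' x y : laurent k) : c * h' = (g1 - g2) * x ->
      x * (t * (c * y + g1 * v')) = t * (c * (h' * v' + x * y) + g2 * (x * v')).
    move=> E; transitivity (t * ((c * h') * v' + c * x * y + g2 * x * v')); last by ring.
    by rewrite E; ring.
  exact: H.
by exists (fun v : laurent k => h^-1 * v) => v; [rewrite mulKf|rewrite mulVKf].
Qed.

Lemma twist_iso (eta : k) (G : Kq) : eta ^+ q = 1 ->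
  connection_iso (E_ k_char0 G) (E_ k_char0 (ltwist eta G)).
Proof.
move=> etaq; have eta0 := unity_neq0 q_gt0 etaq.
have ht := lead_twist eta.
have TE (x : laurent k) : ltwist eta (x : Kq) = lcomp x (lconst eta * lmonom k 1).
  exact: ltwistE.
have Tq : lcomp (lmonom k (- q%:Z)) (lconst eta * lmonom k 1) = lmonom k (- q%:Z).
  rewrite (lcomp_monom eta0 ht) -exprnN exprMn -rmorphXn etaq rmorph1 mul1r.
  by rewrite lmonomX mul1r lmonomV.
apply: (@connection_isoI _ (E_ k_char0 G) (E_ k_char0 (ltwist eta G)) (@ltwist k q q_gt0 eta)).
- move=> a v w.
  have Ta := twist_lexpand q_gt0 a etaq; rewrite TE in Ta.
  have := lcompD eta0 ht (lexpand q_gt0 a * v) w.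
  rewrite (lcompM eta0 ht) Ta -!TE; exact.
- move=> v; have := E_nablaE G v; rewrite -[E_nabla G v]/(nabla (E_ k_char0 G) v) => ->.
  have := E_nablaE (ltwist eta G) (ltwist eta v).
  rewrite -[E_nabla _ _]/(nabla (E_ k_char0 (ltwist eta G)) (ltwist eta v)) => ->.
  rewrite !TE (lcompM eta0 ht) Tq (lcompD eta0 ht) !(lcompM eta0 ht) (lcomp_const eta0 ht).
  by rewrite (euler_twist _ eta0).
by exists (@ltwist k q q_gt0 eta^-1) => v; rewrite ltwist_comp ?mulVf ?mulfV // ltwist1.
Qed.

(** After the Galois twist, two gauge factors remain: [t^-m] absorbs the shift [m/q], and a solution
    of the Euler equation absorbs the part [a] in [t k[[t]]]. *)
Lemma same_orbit_iso (G1 G2 : Kq) : same_orbit_prop G1 G2 ->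
  connection_iso (E_ k_char0 G2) (E_ k_char0 G1).
Proof.
move=> [eta [m [etaq aP]]]; set a := G1 - _ - _ in aP.
have qk0 : q%:R != 0 :> k by rewrite (char0_natr_eq0 k_char0) -lt0n.
apply: connection_iso_trans (twist_iso G2 etaq) _.
have [|h1 [hl hE]] := @euler_ode k k_char0 (- (lconst q%:R * (a : laurent k))).
  by apply: vgeN; apply: vgeZ.
have h10 := lead_neq0 hl (oner_neq0 k).
apply: (@gauge_iso _ _ (lmonom k (- m) * h1)); first by rewrite mulf_neq0 ?lmonom_neq0.
rewrite eulerM euler_monom hE.
have cc : lconst q%:R^-1 * lconst q%:R = 1 :> laurent k by rewrite -rmorphM mulVf ?rmorph1.
have -> : lconst (- m)%:~R = - (lconst q%:R * lconst (m%:~R / q%:R)) :> laurent k.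
  by rewrite -rmorphM -rmorphN mulrCA divff // mulr1 mulrNz.
have -> : (ltwist eta G2 - G1 : laurent k) = - (lconst (m%:~R / q%:R) + a).
  rewrite /a; move: (ltwist _ _) => x; move: (lconst _) => y.
  have H (b c z : laurent k) : b - z = - (c + (z - b - c)) by ring.
  exact: H.
move: cc; move: (lconst q%:R^-1) (lconst q%:R) (lconst (_ / _)) (lmonom k _) => c c' z t cc.
have H (a' : laurent k) : c * (- (c' * z) * t * h1 + t * (- (c' * a') * h1)) =
    - (z + a') * (t * h1).
  by transitivity (- (c * c') * (z + a') * (t * h1)); [ring|rewrite cc; ring].
exact: H.
Qed.
End Gauge.

(** * First-order perturbation of the solutions [u] *)

Section Perturbation.
Context (k : fieldType) (k_char0 : [pchar k] =i pred0).
Implicit Types (f g h u v w x y H R : laurent k).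

Lemma vge1_unit x (M : int) : 1 <= M -> vge M x -> lead 0 1 (1 + x).
Proof.
move=> M1 xM; apply: lead_add (lead1 k) _.
by rewrite [1 + x]addrC addrK add0r; apply: zero_below_le xM.
Qed.

Lemma vge_pow1 x (M n : int) : 1 <= M -> vge M x ->
  vge (M + 1) ((1 + x) ^ n - 1 - lconst n%:~R * x).
Proof.
move=> M1 xM.
have nat_case (j : nat) : vge (M + 1) ((1 + x) ^+ j - 1 - lconst j%:R * x).
  elim: j => [|j IHj]; first by rewrite expr0 subrr rmorph0 mul0r subrr; exact: vge0.
  have -> : (1 + x) ^+ j.+1 - 1 - lconst j.+1%:R * x =
      (1 + x) * ((1 + x) ^+ j - 1 - lconst j%:R * x) + lconst j%:R * (x * x).
    by rewrite exprS -natr1 rmorphD rmorph1 /=; move: (lconst _) (_ ^+ _) => a b; ring.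
  apply: vgeD; first by have [h _] := vge1_unit M1 xM; apply: vgeM h IHj _; lia.
  by apply: vgeZ; apply: (vgeM xM xM); lia.
case: n => n; first by rewrite -pmulrn; exact: nat_case.
rewrite NegzE mulrNz -pmulrn rmorphN -exprnN mulNr opprK.
have hy := leadX n.+1 (vge1_unit M1 xM); rewrite mulr0 expr1n in hy.
have y0 := lead_neq0 hy (oner_neq0 k).
have rhoP := nat_case n.+1; set y := (1 + x) ^+ _ in hy y0 rhoP *.
set c := lconst _ in rhoP *; set rho := _ - _ - _ in rhoP.
have [yV _] := leadV (oner_neq0 k) hy; rewrite oppr0 in yV.
have cx : vge M (c * x) by apply: vgeZ.
have -> : y^-1 - 1 + c * x = y^-1 * (c * x * (c * x + rho) - rho).
  have yE : y = 1 + c * x + rho by rewrite /rho; ring.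
  by apply: (mulfI y0); rewrite mulVKf // !mulrDr mulfV // mulrN1 yE; ring.
apply: (vgeM yV _ (_ : _ <= 0 + (M + 1))); last by lia.
apply: vgeB => //; apply: (vgeM cx (_ : vge M _)); last by lia.
by apply: vgeD => //; apply: zero_below_le rhoP; lia.
Qed.

(** First-order Taylor expansion. On the leading monomial of [H] it is [vge_pow1]; the remainder has
    order [N + 1], and perturbing [u] gains [M] further orders on it. *)
Lemma lcomp_perturb u (e : k) x H (N M : int) : e != 0 -> lead 1 e u ->
  1 <= M -> vge M x -> vge N H ->
  vge (N + M + 1) (lcomp H (u * (1 + x)) - lcomp H u * (1 + lconst N%:~R * x)).
Proof.
move=> e0 hu M1 xM HN.
have hx := vge1_unit M1 xM; have u0 := lead_neq0 hu e0.
have x0 := lead_neq0 hx (oner_neq0 k).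
have hu' : lead 1 e (u * (1 + x)) by have := leadM hu hx; rewrite addr0 mulr1.
have [lC fC Cm] := lcomp_spec e0 hu; have [lD fD Dm] := lcomp_spec e0 hu'.
pose A h := lcomp h (u * (1 + x)) - lcomp h u.
have lA : klinear A by exact: klinear_sub.
have Am n : A (lmonom k n) = u ^ n * ((1 + x) ^ n - 1).
  by rewrite /A Cm Dm expfzMl mulrBr mulr1.
have fA : filtered M A.
  apply: (flin_filtered lA (filtered_sub fD fC)) => n; rewrite Am.
  have [un _] := leadXz1 n e0 hu; apply: vgeM un _ (lexx _).
  rewrite -(subrK (lconst n%:~R * x) (_ - 1)); apply: vgeD; last exact: vgeZ.
  by apply: zero_below_le (vge_pow1 n M1 xM); lia.
pose c := lcoef H N; pose H' := H - lconst c * lmonom k N.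
have H'N : vge (N + 1) H' by apply/leadP.
have HE : H = lconst c * lmonom k N + H' by rewrite /H' addrC subrK.
have -> : lcomp H (u * (1 + x)) - lcomp H u * (1 + lconst N%:~R * x) =
    lconst c * (u ^ N * ((1 + x) ^ N - 1 - lconst N%:~R * x)) + A H'
    - lcomp H' u * (lconst N%:~R * x).
  transitivity (A H - lcomp H u * (lconst N%:~R * x)).
    rewrite /A; move: (lcomp H u) (lcomp H _) (lconst _) => p q b; ring.
  have -> : A H = lconst c * A (lmonom k N) + A H' by rewrite {1}HE lA.
  have -> : lcomp H u = lconst c * lcomp (lmonom k N) u + lcomp H' u by rewrite {1}HE lC.
  rewrite Am Cm; move: (lconst c) (lconst N%:~R) (A _) (lcomp _ _) (u ^ N) => a b p q uN.
  by move: ((1 + x) ^ N) => z; ring.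
have [uN _] := leadXz1 N e0 hu.
apply: vgeB; first apply: vgeD.
- by apply: vgeZ; apply: vgeM uN (vge_pow1 N M1 xM) _; lia.
- by apply: zero_below_le (fA _ _ H'N); lia.
apply: (vgeM (a := N + 1) (b := M)); last by lia.
  by apply/(vge_lcomp e0 hu).
exact: vgeZ.
Qed.

Context (r d : nat) (r_gt0 : (0 < r)%N) (d_gt0 : (0 < d)%N).
Let s := (r + d)%N.

Let vgeZ_inv (c : k) v (M : int) : c != 0 -> vge M (lconst c * v) -> vge M v.
Proof.
by move=> c0 cv i /cv; rewrite lcoef_constM => /eqP; rewrite mulf_eq0 (negbTE c0) => /eqP.
Qed.

(** [y = u (1 + x)] with [d x F(u) = c] and [F(y) = F(u) (1 - s x)], both up to higher order. *)
Lemma solution_perturb (F R u y : laurent k) (b c : k) : b != 0 ->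
  vge (- s%:Z) F -> vge 1 R -> lead 1 b u -> lead 1 b y ->
  u ^+ r * lcomp F u = lmonom k (- d%:Z) ->
  y ^+ r * (lcomp F y + lconst c + R) = lmonom k (- d%:Z) ->
  vge 1 (lcomp F y - lcomp F u + lconst (c * s%:R / d%:R)).
Proof.
move=> b0 Fs R1 hu hy uF yF.
have dk0 : d%:R != 0 :> k by rewrite (char0_natr_eq0 k_char0) -lt0n.
have u0 := lead_neq0 hu b0.
pose x := y / u - 1.
have hyu : lead 0 1 (y / u) by have := leadM hy (leadV b0 hu); rewrite subrr mulfV.
have x1 : vge 1 x by have /leadP := hyu; rewrite rmorph1 mul1r lmonom0 add0r.
have yE : y = u * (1 + x) by rewrite /x addrC subrK mulrCA mulfV ?mulr1.
pose H := lmonom k r%:Z * F.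
have Hd : vge (- d%:Z) H by apply/vge_monomM; rewrite -opprD -PoszD addnC.
have Hu : lcomp H u = lmonom k (- d%:Z).
  by rewrite /H (lcompM b0 hu) (lcomp_monom b0 hu) -exprnP.
have yr : vge r%:Z (y ^+ r) by have [] := leadX r hy; rewrite mulr1.
have cR : vge 0 (lconst c + R).
  by apply: vgeD; [exact: vge_const|apply: zero_below_le R1].
have Hy : lcomp H y = lmonom k (- d%:Z) - y ^+ r * (lconst c + R).
  rewrite /H (lcompM b0 hy) (lcomp_monom b0 hy) -exprnP -yF; ring.
have key (M : int) : 1 <= M -> vge M x ->
    vge (- d%:Z + M + 1) (lmonom k (- d%:Z) * (lconst d%:R * x) - y ^+ r * (lconst c + R)).
  move=> M1 xM; have := lcomp_perturb b0 hu M1 xM Hd.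
  rewrite -yE Hu Hy mulrNz -pmulrn rmorphN; congr (vge _ _).
  by rewrite /=; move: (lconst _) (lconst _) => a a'; ring.
(* Bootstrap: feeding the order of [x] into [key] gains one more, until order [s], where the term
   [y^r (c + R)] of order [r = s - d] takes over. *)
have xs (j : nat) : (j < s)%N -> vge (j.+1)%:Z x.
  elim: j => [|j IHj] js; first exact: x1.
  have xj := IHj (ltnW js); have M1 : 1 <= j.+1%:Z by lia.
  have := vgeD (key _ M1 xj) (zero_below_le _ (zero_belowM yr cR)).
  rewrite subrK => h.
  have /vge_monomM : vge (- d%:Z + j.+1%:Z + 1) (lmonom k (- d%:Z) * (lconst d%:R * x)).
    by apply: h; rewrite /s in js; lia.
  by move=> /(vgeZ_inv dk0); apply: zero_below_le; lia.
have s_gt0 : (s.-1 < s)%N by rewrite /s; lia.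
have xS : vge s%:Z x by have := xs _ s_gt0; rewrite (ltn_predK s_gt0).
have s1 : 1 <= s%:Z by rewrite /s; lia.
have Fpert := lcomp_perturb b0 hu s1 xS Fs; rewrite -yE addNr add0r in Fpert.
have ur0 : u ^+ r != 0 by rewrite expf_neq0.
have FuE : lcomp F u = lmonom k (- d%:Z) / u ^+ r by rewrite -uF mulrAC mulfV ?mul1r.
(* Dividing [key] at order [s] by [u^r] leaves the precision [- d + s + 1 - r = 1]. *)
have Fx : vge 1 (lconst d%:R * (x * lcomp F u) - lconst c).
  have [urV _] := leadV (expf_neq0 r b0) (leadX r hu); rewrite mulr1 in urV.
  have h1 := vgeM (c := 1) urV (key _ s1 xS) (_ : _ <= _).
  have {h1} : vge 1 ((u ^+ r)^-1 * (lmonom k (- d%:Z) * (lconst d%:R * x) - y ^+ r * (lconst c + R))).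
    by apply: h1; rewrite /s; lia.
  have h2 : vge 1 ((1 + x) ^+ r * (lconst c + R) - lconst c).
    have := vge_pow1 r%:Z s1 xS; rewrite -exprnP -pmulrn => hx.
    have -> : (1 + x) ^+ r * (lconst c + R) - lconst c =
      ((1 + x) ^+ r - 1 - lconst r%:R * x) * (lconst c + R) +
      (lconst r%:R * x) * (lconst c + R) + R.
      by move: (lconst r%:R) => a; ring.
    apply: vgeD R1; apply: vgeD; first by apply: vgeM hx cR _; lia.
    by apply: vgeM (vgeZ _ xS) cR _; lia.
  move=> /vgeD /(_ h2); congr (vge _ _); rewrite FuE yE exprMn.
  by move: (lconst _) (lconst _) (_ ^+ r) ur0 ((1 + x) ^+ r) => a a' p p0 p'; field.
have := vgeB Fpert (vgeZ (s%:R / d%:R) Fx); congr (vge _ _).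
rewrite mulrNz -pmulrn rmorphN !rmorphM /=.
have cc : lconst d%:R^-1 * lconst d%:R = 1 :> laurent k by rewrite -rmorphM mulVf ?rmorph1.
move: cc; move: (lconst d%:R^-1) (lconst d%:R) (lconst s%:R) (lconst c) => a a' b' c' cc.
move: (lcomp F u) (lcomp F y) => z w.
transitivity (w - z + b' * x * z - (a * a') * b' * x * z + c' * b' * a); first by ring.
by rewrite cc; ring.
Qed.

(** A change of [F] within its orbit and a change of solution are handled together. With
    [y = eps u'], a twist by some [d]-th root of unity [eta] gives [u] the leading coefficient of
    [y], after which [solution_perturb] applies with [c = m/r]. *)
Lemma solutions_same_orbit (F F' u u' : laurent k) (a e e' eps : k) (m : int) :
  a != 0 -> e != 0 -> e' != 0 -> eps ^+ r = 1 -> lead (- s%:Z) a F ->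
  vge 1 (F' - lcomp F (lconst eps * lmonom k 1) - lconst (m%:~R / r%:R)) ->
  lead 1 e u -> lead 1 e' u' ->
  u ^+ r * lcomp F u = lmonom k (- d%:Z) ->
  u' ^+ r * lcomp F' u' = lmonom k (- d%:Z) ->
  exists2 eta : k, eta ^+ d = 1 &
    vge 1 (lcomp F' u' - lcomp (lcomp F u) (lconst eta * lmonom k 1) + lconst (m%:~R / d%:R)).
Proof.
move=> a0 e0 e'0 epsr hF FF' hu hu' uF uF'.
have rk0 : r%:R != 0 :> k by rewrite (char0_natr_eq0 k_char0) -lt0n.
have dk0 : d%:R != 0 :> k by rewrite (char0_natr_eq0 k_char0) -lt0n.
have eps0 := unity_neq0 r_gt0 epsr.
pose c := m%:~R / r%:R : k.
pose R0 := F' - lcomp F (lconst eps * lmonom k 1) - lconst c; rewrite -/c -/R0 in FF'.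
pose y := lconst eps * u'.
have hy : lead 1 (eps * e') y by apply: leadZ.
have ee0 : eps * e' != 0 by rewrite mulf_neq0.
have yr : y ^+ r = u' ^+ r by rewrite exprMn -rmorphXn epsr rmorph1 mul1r.
have Fy : lcomp (lcomp F (lconst eps * lmonom k 1)) u' = lcomp F y.
  rewrite (lcompA _ eps0 e'0 (lead_twist eps) hu') (lcompM e'0 hu').
  by rewrite (lcomp_const e'0 hu') (lcomp_monom e'0 hu') expr1z.
pose R := lcomp R0 u'.
have F'u : lcomp F' u' = lcomp F y + lconst c + R.
  rewrite /R /R0 !(lcompB e'0 hu') Fy (lcomp_const e'0 hu').
  by move: (lconst _) (lcomp F' u') (lcomp F y) => z p q; ring.
have R1 : vge 1 R by apply/(vge_lcomp e'0 hu').
have hFy := lcomp_lead ee0 hy hF.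
have hF'y : lead (- s%:Z) (a * (eps * e') ^ (- s%:Z)) (lcomp F y + lconst c + R).
  apply: lead_add hFy _.
  have -> : lcomp F y + lconst c + R - lcomp F y = lconst c + R.
    by move: (lcomp F y) => p; ring.
  by apply: vgeD; [apply: zero_below_le (vge_const c)|apply: zero_below_le R1]; rewrite /s; clear -r_gt0; lia.
rewrite F'u -yr in uF'.
(* Leading coefficients of solutions are [d]-th roots of [a], so the ratio of two of them is a
   [d]-th root of unity. *)
have lead_d (b : k) v w : b != 0 -> lead 1 b v -> lead (- s%:Z) (a * b ^ (- s%:Z)) w ->
    v ^+ r * w = lmonom k (- d%:Z) -> a = b ^+ d.
  move=> b0 hv hw vw; have := leadM (leadX r hv) hw; rewrite vw mulr1 => -[_].
  rewrite (_ : r%:Z + - s%:Z = - d%:Z); last by rewrite /s; clear; lia.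
  rewrite lcoef_monom eqxx -exprnN /s exprD => /(congr1 (fun z => b ^+ d * z)).
  by rewrite mulr1 => ->; field; rewrite !expf_neq0.
have ad' := lead_d _ _ _ ee0 hy hF'y uF'.
have ad := lead_d _ _ _ e0 hu (lcomp_lead e0 hu hF) uF.
pose eta := eps * e' / e.
have eta0 : eta != 0 by rewrite !mulf_neq0 ?invr_eq0.
have etad : eta ^+ d = 1 by rewrite /eta expr_div_n -ad' -ad divff.
pose u1 := lcomp u (lconst eta * lmonom k 1).
have ht := lead_twist eta.
have hu1 : lead 1 (eps * e') u1.
  by have := lcomp_lead eta0 ht hu; rewrite expr1z /eta mulrC divfK.
have Fu1 : lcomp (lcomp F u) (lconst eta * lmonom k 1) = lcomp F u1.
  exact: (lcompA _ e0 eta0 hu ht).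
have u1F : u1 ^+ r * lcomp F u1 = lmonom k (- d%:Z).
  rewrite -Fu1 -(lcompX eta0 ht) -(lcompM eta0 ht) uF (lcomp_monom eta0 ht).
  by rewrite -exprnN exprMn -rmorphXn etad rmorph1 mul1r lmonomX mul1r lmonomV.
exists eta; first exact: etad.
rewrite Fu1 F'u.
have [Fs _] := hF.
have := vgeD (solution_perturb ee0 Fs R1 hu1 hy u1F uF') R1; congr (vge _ _).
(* As [s = r + d], the shift splits into the [c] already present in [F'] and an element of
   [(1/d)Z]. *)
have -> : c * s%:R / d%:R = c + m%:~R / d%:R.
  by rewrite /c /s natrD; field; rewrite dk0 rk0.
by rewrite rmorphD /=; move: (lconst _) (lconst _) (lcomp F y) (lcomp F u1) => z z' p q; ring.
Qed.

(** The twist [u1] of [u] solves the same equation, so [(u1 / u)^r = F(u) / F(u1)] is [1] up to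
    order [s + 1]. Hence [eta^r = 1] and [u1] is so close to [eta u] that [F(eta u)] and [F(u)]
    agree modulo positive orders; cancelling [u] gives the claim. *)
Lemma solution_twist (F u : laurent k) (a e eta : k) :
  a != 0 -> e != 0 -> eta ^+ d = 1 -> lead (- s%:Z) a F ->
  lead 1 e u -> u ^+ r * lcomp F u = lmonom k (- d%:Z) ->
  vge 1 (lcomp (lcomp F u) (lconst eta * lmonom k 1) - lcomp F u) ->
  eta ^+ r = 1 /\ vge 1 (lcomp F (lconst eta * lmonom k 1) - F).
Proof.
move=> a0 e0 etad hF hu uF Feta.
have rk0 : r%:R != 0 :> k by rewrite (char0_natr_eq0 k_char0) -lt0n.
have eta0 := unity_neq0 d_gt0 etad; have ht := lead_twist eta.
pose u1 := lcomp u (lconst eta * lmonom k 1).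
have hu1 : lead 1 (e * eta) u1 by have := lcomp_lead eta0 ht hu; rewrite expr1z.
have ee0 : e * eta != 0 by rewrite mulf_neq0.
have Fu1 : lcomp (lcomp F u) (lconst eta * lmonom k 1) = lcomp F u1.
  exact: (lcompA _ e0 eta0 hu ht).
rewrite Fu1 in Feta.
have u1F : u1 ^+ r * lcomp F u1 = lmonom k (- d%:Z).
  rewrite -Fu1 -(lcompX eta0 ht) -(lcompM eta0 ht) uF (lcomp_monom eta0 ht).
  by rewrite -exprnN exprMn -rmorphXn etad rmorph1 mul1r lmonomX mul1r lmonomV.
have u0 := lead_neq0 hu e0; have u10 := lead_neq0 hu1 ee0.
have hFu := lcomp_lead e0 hu hF; have hFu1 := lcomp_lead ee0 hu1 hF.
have ae0 : a * (e * eta) ^ (- s%:Z) != 0 := mulf_neq0 a0 (expfz_neq0 _ ee0).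
have Fu10 := lead_neq0 hFu1 ae0.
have ratio : vge (s%:Z + 1) ((u1 / u) ^+ r - 1).
  have -> : (u1 / u) ^+ r - 1 = (lcomp F u1)^-1 * (lcomp F u - lcomp F u1).
    have ur : u1 ^+ r * lcomp F u1 = u ^+ r * lcomp F u by rewrite uF.
    have ur0 : u ^+ r != 0 by rewrite expf_neq0.
    move: (lcomp F u1) (lcomp F u) (u1 ^+ r) (u ^+ r) (expr_div_n u1 u r) Fu10 ur ur0.
    move=> p q v w -> p0 vp w0; have -> : v = w * q / p by rewrite -vp mulfK.
    by field; rewrite p0 w0.
  have [FV _] := leadV ae0 hFu1.
  by apply: vgeM FV (vgeBC Feta) _; clear; lia.
have hq : lead 0 eta (u1 / u).
  by have := leadM hu1 (leadV e0 hu); rewrite subrr mulrC mulKf.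
have etar : eta ^+ r = 1.
  have [_] := leadX r hq; rewrite mulr0 => <-.
  have /eqP : lcoef ((u1 / u) ^+ r - 1) 0 = 0 by apply: ratio; clear; lia.
  by rewrite lcoefB lcoef1 eqxx subr_eq0 => /eqP.
split; first exact: etar.
pose y := lconst eta * u.
have hy : lead 1 (e * eta) y by rewrite mulrC; apply: leadZ.
have y0 := lead_neq0 hy ee0.
pose x := u1 / y - 1.
have x1 : vge 1 x.
  have : lead 0 1 (u1 / y) by have := leadM hu1 (leadV ee0 hy); rewrite subrr mulfV.
  by move=> /leadP; rewrite rmorph1 mul1r lmonom0 add0r.
have u1E : u1 = y * (1 + x).
  rewrite /x; move: (u1) (y) y0 => v w w0.
  by rewrite [1 + _]addrC subrK mulrC divfK.
have xr : vge (s%:Z + 1) ((1 + x) ^+ r - 1).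
  have qE : u1 / u = lconst eta * (1 + x).
    move: u1E; rewrite {1}/y; move: (u1) (x) => v w ->.
    by rewrite mulrAC mulfK.
  by move: ratio; rewrite qE exprMn -rmorphXn etar rmorph1 mul1r.
(* An [r]-th root is extracted one order at a time, as [(1 + x)^r - 1] is [r x] to first order. *)
have xs (j : nat) : (j <= s)%N -> vge (j.+1)%:Z x.
  elim: j => [|j IHj] js; first exact: x1.
  have xj := IHj (ltnW js); have M1 : 1 <= j.+1%:Z by [].
  have := vge_pow1 r%:Z M1 xj; rewrite -exprnP -pmulrn => h.
  apply: (vgeZ_inv rk0).
  rewrite -[lconst _ * x](subKr ((1 + x) ^+ r - 1)); apply: vgeB.
    by apply: zero_below_le xr; clear -js; lia.
  by apply: zero_below_le h; clear; lia.
have xS := xs s (leqnn s); have s1 : 1 <= s.+1%:Z by [].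
have [Fs _] := hF; have [Fys _] := lcomp_lead ee0 hy hF.
have := lcomp_perturb ee0 hy s1 xS Fs; rewrite -u1E => hp.
have Fy : lcomp F y = lcomp (lcomp F (lconst eta * lmonom k 1)) u.
  rewrite (lcompA _ eta0 e0 ht hu) (lcompM e0 hu).
  rewrite (lcomp_const e0 hu) (lcomp_monom e0 hu) expr1z; reflexivity.
apply/(vge_lcomp e0 hu); rewrite (lcompB e0 hu) -Fy.
have h1 : vge 1 (lcomp F y * (lconst (- s%:Z)%:~R * x)).
  by apply: vgeM Fys (vgeZ _ xS) _; clear; lia.
have h2 : vge 1 (lcomp F u1 - lcomp F y * (1 + lconst (- s%:Z)%:~R * x)).
  by apply: zero_below_le hp; clear; lia.
have := vgeB (vgeB Feta h2) h1; congr (vge _ _).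
move: (lconst _) (lcomp F u1) (lcomp F u) (lcomp F y) => z p q p'; ring.
Qed.
End Perturbation.

(** In characteristic zero [X^n - 1] is separable, so its [n] roots are distinct and form a cyclic
    group. *)
Lemma exists_prim_root (k : closedFieldType) (k_char0 : [pchar k] =i pred0) (n : nat) :
  (0 < n)%N -> exists z : k, n.-primitive_root z.
Proof.
move=> n0; have [rs rsE] := closed_field_poly_normal ('X^n - 1 : {poly k}).
have mon : lead_coef ('X^n - 1 : {poly k}) = 1 by apply/eqP; exact: monicXnsubC.
rewrite mon scale1r in rsE.
have sz : size rs = n by apply: succn_inj; rewrite -(size_prod_XsubC rs id) -rsE size_XnsubC.
have sep : separable.separable_poly ('X^n - 1 : {poly k}).
  by apply: cyclotomic.separable_Xn_sub_1; rewrite (char0_natr_eq0 k_char0) -lt0n.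
rewrite rsE separable.separable_prod_XsubC in sep.
have un : all n.-unity_root rs.
  by apply/allP => z zr; rewrite /root_of_unity rsE root_prod_XsubC.
have := cyclic.has_prim_root n0 un sep; rewrite sz => /(_ (leqnn _))/hasP[z _ zP].
by exists z.
Qed.

Lemma pi_orbitP (k : fieldType) q (q_gt0 : (0 < q)%N) (f g : ramified k q_gt0) :
  \pi_(orbits k q_gt0) f = \pi_(orbits k q_gt0) g <-> same_orbit_prop f g.
Proof. by split=> [/eqmodP/asboolP//|fg]; apply/eqmodP/asboolP. Qed.

(** * Primitive classes and free Galois action *)

Section Primitive.
Context (k : fieldType) (q : nat) (q_gt0 : (0 < q)%N).
Local Notation Kq := (@ramified k q q_gt0).

(** [Gal(K_q/K)] acts freely on the class of [f]. *)
Definition galois_free (f : Kq) :=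
  forall eta : k, eta ^+ q = 1 -> vge 1 (ltwist eta f - f) -> eta = 1.

(** If [eta] of order [e > 1] fixed the class, all negative exponents of [f] would be divisible by
    [e], and the truncation [h] to exponents at most [0] would represent the class in [K_(q/e)]. *)
Lemma primitive_galois_free f : primitive_orbit (\pi_(orbits k q_gt0) f) -> galois_free f.
Proof.
move=> f_prim eta etaq fE.
have [e eP eq] := prim_order_exists q_gt0 etaq.
have e0 := prim_order_gt0 eP.
have [e1|e1] := eqVneq e 1%N; first by have := prim_expr_order eP; rewrite e1 expr1.
have fdvd i : i < 0 -> lcoef f i != 0 -> (e %| absz i)%N.
  move=> i0 fi; have := fE i; rewrite lcoefB /= => /(_ _)/eqP.
  rewrite subr_eq0 -{2}[lcoef f i]mul1r (inj_eq (mulIf fi)).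
  have -> : i = - (absz i)%:Z by lia.
  rewrite -exprnN invr_eq1 (prim_order_dvd eP) abszN; apply; lia.
have hbd : exists N, zero_below N (fun i : int => if i < 1 then lcoef f i else 0).
  by have [N fN] := lcoef_bounded f; exists N => i /fN ->; rewrite if_same.
pose h : Kq := Laurent hbd.
have qe0 : (0 < q %/ e < q)%N.
  by rewrite divn_gt0 // dvdn_leq //= ltn_Pdiv // ltn_neqAle eq_sym e1.
apply: (False_ind _ (f_prim _ qe0 h _ _)).
  apply/pi_orbitP; exists 1, 0; split; first by rewrite expr1n.
  move=> i i1; rewrite ltwist1 !lcoefB /= i1 subrr mul0r if_same subr0 //.
move=> i; rewrite /h /=; case: ifP => i1; last by rewrite eqxx.
have [->|i0 fi] := eqVneq i 0; first by rewrite mul0r dvdz0.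
have := fdvd i _ fi => /(_ _)/dvdnP[|j ij]; first by lia.
have /dvdnP[c cE] := eq.
have -> : (q %/ e)%N = c by rewrite cE mulnK.
rewrite dvdzE abszM /= ij cE -mulnA [(e * c)%N]mulnC; exact: dvdn_mull.
Qed.
End Primitive.

(** For a representative in [K_q'], a primitive root of unity of order [e = q / gcd(q, q')] fixes
    every exponent that occurs; freeness forces [e = 1], so [q] divides [q']. *)
Lemma galois_free_primitive (k : closedFieldType) (k_char0 : [pchar k] =i pred0)
    (q : nat) (q_gt0 : (0 < q)%N) (f : ramified k q_gt0) :
  galois_free f -> primitive_orbit (\pi_(orbits k q_gt0) f).
Proof.
move=> f_free q' /andP[q'0 q'q] h /pi_orbitP[eta [m [etaq hE]]] hq'.
have eta0 := unity_neq0 q_gt0 etaq.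
pose g := gcdn q q'; have g0 : (0 < g)%N by rewrite gcdn_gt0 q_gt0.
have gq : (g %| q)%N by apply: dvdn_gcdl.
pose e := (q %/ g)%N.
have e0 : (0 < e)%N by rewrite divn_gt0 // dvdn_leq.
have [th thP] := exists_prim_root k_char0 e0.
have the := prim_expr_order thP.
have th0 := unity_neq0 e0 the.
have thq : th ^+ q = 1.
  by rewrite -(divnK gq) exprM -/e the expr1n.
have thi i : lcoef h i != 0 -> th ^ i = 1.
  move=> /hq'; rewrite dvdzE abszM /= => qi.
  suff /dvdnP[c cE] : (e %| absz i)%N.
    by have -> : th ^ i = th ^ (e%:Z * (Num.sg i * c%:Z));
      [congr (_ ^ _); lia|rewrite -exprz_exp -exprnP the exp1rz].
  by rewrite -(dvdn_pmul2r g0) divnK // muln_gcdr dvdn_gcd dvdn_mull.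
have fi i : i < 0 -> lcoef f i = eta ^ (- i) * lcoef h i.
  move=> i0; have := hE i; rewrite !lcoefB /= => /(_ _)/eqP.
  rewrite (_ : (i == 0) = false); last by lia.
  rewrite subr0 subr_eq0 => h'; have /eqP -> : lcoef h i == eta ^ i * lcoef f i.
    by apply: h'; lia.
  by rewrite mulrA -expfzDr // addNr mul1r.
have th1 : th = 1.
  apply: f_free thq _ => i i1; rewrite lcoefB /=.
  case: (ltgtP i 0) => [i0|i0|->]; [|by lia|by rewrite expr0z mul1r subrr].
  rewrite (fi _ i0); have [->|/thi ->] := eqVneq (lcoef h i) 0; first by rewrite !mulr0 subrr.
  by rewrite mul1r subrr.
have : (e %| 1)%N by rewrite (prim_order_dvd thP) expr1 th1.
rewrite dvdn1 => /eqP e1; have : (q <= q')%N.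
  by apply: dvdn_leq => //; rewrite -(divnK gq) -/e e1 mul1n dvdn_gcdr.
by rewrite leqNgt q'q.
Qed.

(** * Irreducibility and slopes *)

Section Relations.
Context (k : fieldType) (k_char0 : [pchar k] =i pred0) (q : nat) (q_gt0 : (0 < q)%N).
Context (om : k) (om_prim : q.-primitive_root om).
Local Notation Kq := (@ramified k q q_gt0).

Let om_neq0 : om != 0. Proof. exact: unity_neq0 q_gt0 (prim_expr_order om_prim). Qed.

(** Discrete Fourier inversion over the Galois group: the sum isolates the exponents congruent to
    [i] modulo [q]. *)
Lemma sum_slices (v : Kq) (i : 'I_q) :
  \sum_(j < q) lconst (om ^ (- (i%:Z * j%:Z))) * (ltwist (om ^+ j) v : laurent k) =
  lconst q%:R * (lexpand q_gt0 (slices v 0 i) * lmonom k i%:Z).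
Proof.
have q0 : q%:Z != 0 by lia.
apply: laurentP => n; rewrite lcoef_sum [RHS]lcoef_constM [lexpand _ _ * _]mulrC [in RHS]lcoef_monomM.
under eq_bigr => j _ do rewrite lcoef_constM.
pose z := om ^ (n - i%:Z).
have -> : \sum_(j < q) om ^ (- (i%:Z * j%:Z)) * lcoef (ltwist (om ^+ j) v) n =
    lcoef v n * \sum_(j < q) z ^+ j.
  rewrite mulr_sumr; apply: eq_bigr => j _ /=.
  rewrite mulrA mulrC; congr (_ * _).
  rewrite [om ^+ j]exprnP exprz_exp -expfzDr // [RHS]exprnP exprz_exp.
  by congr (om ^ _); ring.
have z1 : (z == 1) = (q%:Z %| n - i%:Z)%Z.
  rewrite /z; case: (n - _) => m; first by rewrite dvdzE /= (prim_order_dvd om_prim).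
  by rewrite NegzE -exprnN invr_eq1 dvdzE abszN /= (prim_order_dvd om_prim).
rewrite /= -z1; case: eqP => [z1' | /eqP z1'].
  rewrite z1'; under eq_bigr => j _ do rewrite expr1n.
  rewrite sumr_const card_ord mxE /= mulrC; congr (_ * lcoef v _).
  by rewrite divzK -?z1 ?z1' // subrK.
rewrite mulr0; apply/eqP; rewrite mulf_eq0; apply/orP; right.
have zq : z ^+ q = 1.
  by rewrite /z exprnP exprz_exp mulrC -exprz_exp -exprnP (prim_expr_order om_prim) exp1rz.
have /eqP := subrX1 z q; rewrite zq subrr eq_sym mulf_eq0 subr_eq0.
by rewrite (negbTE z1').
Qed.

(** A linear map is determined by its values on the basis [t^i], and [sum_slices] expresses the
    coordinates in that basis through Galois conjugates. *)
Lemma galois_expansion (f : Kq -> Kq) : linear f ->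
  exists c : 'I_q -> laurent k, forall v,
    f v = \sum_(j < q) c j * (ltwist (om ^+ j) v : laurent k) :> laurent k.
Proof.
move=> f_lin; pose g : {linear Kq -> Kq} := HB.pack f (GRing.isLinear.Build _ _ _ _ f f_lin).
have qk0 : q%:R != 0 :> k by rewrite (char0_natr_eq0 k_char0) -lt0n.
pose b i : laurent k := lconst q%:R^-1 * lmonom k (- i%:Z) * f (lmonom k i%:Z).
exists (fun j => \sum_(i < q) b i * lconst (om ^ (- (i%:Z * j%:Z)))) => v.
transitivity (\sum_(i < q) lexpand q_gt0 (slices v 0 i) * (f (lmonom k i%:Z) : laurent k)).
  rewrite -[f v]/(g v) {1}(slices_decomp v) linear_sum; apply: eq_bigr => i _.
  by rewrite linearZ.
under [RHS]eq_bigr => j _ do rewrite mulr_suml.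
rewrite exchange_big; apply: eq_bigr => i _ /=.
under [RHS]eq_bigr => j _ do rewrite -mulrA.
rewrite -mulr_sumr sum_slices /b.
have cc : lconst q%:R^-1 * lconst q%:R = 1 :> laurent k by rewrite -rmorphM mulVf ?rmorph1.
have tt : lmonom k (- i%:Z) * lmonom k i%:Z = 1 by rewrite -lmonomD addNr.
move: cc tt; move: (lconst q%:R^-1) (lconst q%:R) (lmonom k (- _)) (f _ : laurent k) => c c' t y.
move: (lmonom k _) (lexpand _ _) => t' x cc tt.
transitivity ((c * c') * (t * t') * (x * y)); first by rewrite cc tt !mul1r.
ring.
Qed.

Context (F : Kq) (F_free : galois_free F).
Let D (v : laurent k) : laurent k := lconst q%:R^-1 * euler v + F * v.
Let sg (j : 'I_q) (v : laurent k) : laurent k := ltwist (om ^+ j) (v : Kq).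

(** Induction on the support of the relation: after normalizing one coefficient to [1], the
    relation commutes with [D] up to a relation with smaller support. *)
Lemma no_relation (W : laurent k -> Prop) (c : 'I_q -> laurent k) :
  (forall w, W w -> W (D w)) -> (exists j, c j != 0) ->
  (forall w, W w -> \sum_j c j * sg j w = 0) -> forall w, W w -> w = 0.
Proof.
move=> WD; have [n] := ubnP #|[pred j | c j != 0]|.
have omj0 (j : 'I_q) : om ^+ j != 0 by rewrite expf_neq0.
have sgE (j : 'I_q) v : sg j v = lcomp v (lconst (om ^+ j) * lmonom k 1) by exact: ltwistE.
have sgM j x y : sg j (x * y) = sg j x * sg j y.
  by rewrite !sgE; exact: (lcompM (omj0 j) (lead_twist _)).
have sgD j x y : sg j (x + y) = sg j x + sg j y.
  by rewrite !sgE; exact: (lcompD (omj0 j) (lead_twist _)).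
have sgc j a : sg j (lconst a) = lconst a.
  by rewrite !sgE; exact: (lcomp_const (omj0 j) (lead_twist _)).
have sge j x : sg j (euler x) = euler (sg j x).
  by rewrite !sgE; symmetry; exact: (euler_twist _ (omj0 j)).
have lE := @klinear_euler k.
elim: n => // n IHn in c *; rewrite ltnS => cn [j0 cj0] cW.
pose b j := c j / c j0.
have b1 : b j0 = 1 by rewrite /b divff.
have bW w : W w -> \sum_j b j * sg j w = 0.
  move=> /cW /(congr1 (fun v => (c j0)^-1 * v)); rewrite mulr0 mulr_sumr => E.
  by rewrite -[RHS]E; apply: eq_bigr => j _; rewrite /b mulrA [c j * _]mulrC.
have bsupp j : (b j != 0) = (c j != 0) by rewrite /b mulf_eq0 invr_eq0 (negbTE cj0) orbF.
(* Coefficients of the relation at [D w], minus [euler / q] of the relation at [w], minus [sg j0 F]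
   times it; the derivatives of [w] cancel and the term [j0] disappears. *)
pose b' j := b j * (sg j F - sg j0 F) - lconst q%:R^-1 * euler (b j).
have b'W w : W w -> \sum_j b' j * sg j w = 0.
  move=> Ww; have E1 := bW _ (WD _ Ww).
  have := congr1 (fun v => lconst q%:R^-1 * euler v) (bW _ Ww).
  rewrite (klinear_sum lE) (klinear0 lE) mulr0 mulr_sumr => E2.
  have E3 := congr1 (fun v => sg j0 F * v) (bW _ Ww); rewrite mulr0 mulr_sumr in E3.
  have := congr2 (fun x y => x - y) (congr2 (fun x y => x - y) E1 E2) E3.
  rewrite !subr0 -!sumrB => E; rewrite -[RHS]E; apply: eq_bigr => j _; rewrite /b' /D sgD !sgM sgc sge eulerM.
  by move: (sg j w) (sg j F) (sg j0 F) (b j) => x y z t; move: (euler _) (euler _) (lconst _) => u v l; ring.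
have b'0 : b' j0 = 0 by rewrite /b' subrr mulr0 b1 euler1 mulr0 subrr.
case: (pselect (exists j, b' j != 0)) => [b'n|b'z].
  apply: (IHn b') => //; apply: leq_trans cn; apply: proper_card; apply/properP.
  split; last by exists j0; rewrite !inE ?cj0 // b'0 eqxx.
  apply/fintype.subsetP => j; rewrite !inE -bsupp; apply: contraNneq => bj.
  by rewrite /b' bj mul0r (klinear0 lE) mulr0 subrr.
have only j : j != j0 -> b j = 0.
  move=> jj0; apply/eqP; apply: contraT => bj; case/negP: jj0; apply/eqP.
  have [a a0 hl] := lord_lead bj.
  have : b' j = 0 by apply/eqP; apply: contraT => h; case: b'z; exists j.
  move=> /eqP; rewrite subr_eq0 => /eqP bE.
  (* The difference is a logarithmic derivative divided by [q], so it has order at least [0]; its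
     constant term vanishes because twists fix constant terms. Freeness therefore applies. *)
  have hdiff : vge 1 (sg j F - sg j0 F).
    have -> : sg j F - sg j0 F = (b j)^-1 * (lconst q%:R^-1 * euler (b j)).
      by rewrite -bE mulKf.
    apply: (@vgeS _ 0); last first.
      by rewrite -bE mulKf // /sg !lcoefB /= !expr0z !mul1r subrr.
    have [bV _] := leadV a0 hl; have [bl _] := hl.
    by apply: vgeM bV (vgeZ _ (vge_euler bl)) _; rewrite addNr.
  pose eta := om ^ (j%:Z - j0%:Z).
  have etaq : eta ^+ q = 1.
    by rewrite /eta exprnP exprz_exp mulrC -exprz_exp -exprnP (prim_expr_order om_prim) exp1rz.
  have : eta = 1.
    apply: F_free etaq _ => i i1; have := hdiff i i1; rewrite /sg !lcoefB /= => h.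
    have : (om ^+ j0) ^ i * (eta ^ i * lcoef F i - lcoef F i) = 0.
      rewrite -h mulrBr mulrA; congr (_ * _ - _).
      by rewrite -expfzMl /eta exprnP -expfzDr // addrC subrK.
    by move=> /eqP; rewrite mulf_eq0 expfz_eq0 (negbTE (omj0 j0)) andbF => /eqP.
  rewrite /eta expfzDr // -exprnN -exprnP => E; apply: val_inj => /=.
  have /eqP : om ^+ j = om ^+ j0.
    by rewrite -[LHS](divfK (omj0 j0)) E mul1r.
  by rewrite (eq_prim_root_expr om_prim) !modn_small // => /eqP.
move=> w /bW; rewrite (bigD1 j0) //= big1 => [|j jj0]; last by rewrite only // mul0r.
rewrite b1 mul1r addr0 => h.
have := congr1 (ltwist (om ^+ j0)^-1) (h : sg j0 w = 0 :> Kq).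
rewrite ltwist_comp mulVf // ltwist1 => ->; apply: laurentP => i /=.
by rewrite mulr0.
Qed.

(** The complementary projection [v - projv W v] is [K]-linear, kills [W], and is nonzero when [W]
    is proper; expanded in Galois conjugates it is a nontrivial relation on [W], which [no_relation]
    forbids unless [W = 0]. *)
Lemma E_stable_subspace (W : {vspace E_ k_char0 F}) :
  (forall v, v \in W -> nabla (E_ k_char0 F) v \in W) -> W = 0%VS \/ W = fullv.
Proof.
move=> Wst; case: (eqVneq W fullv) => [->|Wfull]; first by right.
left; pose f (v : Kq) : Kq := v - projv W v.
have f_lin : linear f.
  by move=> a v w; rewrite /f linearP scalerBr opprD addrACA.
have [c cE] := galois_expansion f_lin.
have [v vW] : exists v, v \notin W.
  case: (pselect (exists v, v \notin W)) => // nW; case/eqP: Wfull.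
  apply/eqP; rewrite eqEsubv subvf; apply/subvP => v _.
  by apply: contraT => vW; case: nW; exists v.
have fv : f v != 0.
  by apply: contraNneq vW => /eqP; rewrite subr_eq0 => /eqP ->; exact: memv_proj.
have c_ex : exists j, c j != 0.
  case: (pselect (exists j, c j != 0)) => // nc; case/eqP: fv.
  rewrite cE big1 // => j _; suff -> : c j = 0 by rewrite mul0r.
  by apply/eqP; apply: contraT => cj; case: nc; exists j.
have W0 := @no_relation (fun w => (w : E_ k_char0 F) \in W) c _ c_ex _.
apply/eqP; rewrite -subv0; apply/subvP => w wW; rewrite memv0; apply/eqP; apply: W0 wW => {w}w wW.
  have /(memvZ (lmonom k 1)) := Wst _ wW; rewrite ramified_scaleE lexpand_monom mulr1 /=.
  by rewrite E_nablaE mulrA -lmonomD subrr mul1r.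
by have := cE w; rewrite /f projv_id // subrr.
Qed.
End Relations.

Lemma nabla0 (k : fieldType) (E : connection k) : nabla E 0 = 0.
Proof.
have [_ nZ] := nablaP E; have := nZ 0 0; rewrite !scale0r scaler0 addr0; exact.
Qed.

(** The image of [i] and the kernel of [p] are stable, and [S] is nonzero; so [i] is onto, [p] is
    injective, and the isomorphism is [i] after the inverse of [p]. *)
Lemma irreducible_component_iso (k : fieldType) (E S : connection k) :
  (forall W : {vspace E}, (forall v, v \in W -> nabla E v \in W) -> W = 0%VS \/ W = fullv) ->
  irreducible_component S E -> connection_iso S E.
Proof.
move=> E_irr [[S0 _] [U [i [p [i_hor i_inj p_hor p_surj]]]]].
have U_irr (X : {vspace U}) : (forall v, v \in X -> nabla U v \in X) -> X = 0%VS \/ X = fullv.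
  move=> Xst; case: (E_irr (i @: X)%VS) => [v /memv_imgP[x xX ->]|X0|Xf].
  - by rewrite -i_hor memv_img // Xst.
  - left; apply/eqP; rewrite -subv0; apply/subvP => x xX; rewrite memv0.
    by have := memv_img i xX; rewrite X0 memv0 -(linear0 i) (inj_eq i_inj).
  right; apply/eqP; rewrite eqEsubv subvf; apply/subvP => u _.
  have : i u \in (i @: X)%VS by rewrite Xf memvf.
  by move=> /memv_imgP[x xX /i_inj ->].
have p_ne0 : ~ (forall u, p u = 0).
  move=> p0; case/eqP: S0; apply/eqP; rewrite -subv0; apply/subvP => s _.
  by have [u <-] := p_surj s; rewrite p0 mem0v.
have p_inj : injective p.
  apply/lker0P; case: (U_irr (lker p)) => [u|->//|pf].
    by rewrite !memv_ker p_hor => /eqP ->; rewrite nabla0.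
  by case: p_ne0 => u; apply/eqP; rewrite -memv_ker pf memvf.
have i_surj e : exists u, i u = e.
  case: (E_irr (limg i)) => [v /memv_imgP[x _ ->]|i0|iF].
  - by rewrite -i_hor memv_img // memvf.
  - case: p_ne0 => u; have := memv_img i (memvf u); rewrite i0 memv0 -(linear0 i) (inj_eq i_inj).
    by move=> /eqP ->; rewrite linear0.
  by have : e \in limg i; [rewrite iF memvf|move=> /memv_imgP[u _ ->]; exists u].
have [g gK] := choice p_surj; have pK : cancel p g by move=> u; apply: p_inj; rewrite gK.
have [h hK] := choice i_surj; have iK : cancel i h by move=> u; apply: i_inj; rewrite hK.
apply: (@connection_isoI _ _ _ (fun s => i (g s))) => [a s t|s|].
- by rewrite -(linearP i); congr (i _); apply: p_inj; rewrite gK linearD linearZ /= !gK.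
- by rewrite -i_hor; congr (i _); apply: p_inj; rewrite gK p_hor gK.
by exists (fun e => p (h e)) => [s|e]; rewrite ?iK ?gK // pK hK.
Qed.

Lemma lord0 (k : fieldType) : lord (0 : laurent k) = 0.
Proof. by apply: xgetPN => n [/=]; rewrite eqxx. Qed.

Lemma fourier_solutionP (k : fieldType) (r d : nat) (d_gt0 : (0 < d)%N)
    (F : laurent k) (u : ramified k d_gt0) :
  fourier_solution r F u <->
  (exists e, e != 0 /\ lead 1 e u) /\ (u : laurent k) ^+ r * lcomp F u = lmonom k (- d%:Z).
Proof.
rewrite /fourier_solution lexpand_monom mulrN1 /ramified_ord.
have d0 : d%:R != 0 :> rat by rewrite pnatr_eq0 -lt0n.
split=> [[uo uF]|[[e [e0 hu]] uF]]; split=> //.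
  have u1 : lord u = 1.
    apply/eqP; rewrite -(eqr_int rat); apply/eqP.
    by move/(congr1 (fun x => x * d%:R)): uo; rewrite divfK // mulVf.
  have [|e e0 hu] := @lord_lead _ (u : laurent k); last by exists e; rewrite -u1.
  (* The default [lord 0 = 0] differs from [1], which excludes [u = 0]. *)
  by apply: contra_eqN u1 => /eqP ->; rewrite lord0.
by rewrite (lead_lord hu e0) div1r.
Qed.

(** Since [n < 0], neither the constant shift nor the terms of positive order reach the leading
    term; the twist only rescales it by [eta^n]. *)
Lemma lead_same_orbit (k : fieldType) (r : nat) (r_gt0 : (0 < r)%N)
    (F F' : ramified k r_gt0) (n : int) (a : k) : n < 0 ->
  a != 0 -> lead n a F -> same_orbit_prop F' F ->
  exists2 a', a' != 0 & lead n a' F'.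
Proof.
move=> n0 a0 hF [eta [m [etar E]]]; have eta0 := unity_neq0 r_gt0 etar.
have ht := lead_twist eta.
exists (a * eta ^ n); first by rewrite mulf_neq0 // expfz_neq0.
have := lcomp_lead eta0 ht hF; rewrite -(ltwistE r_gt0) // => /lead_add; apply.
rewrite -(subrK (lconst (m%:~R / r%:R)) (_ - _)); apply: vgeD.
  by apply: zero_below_le E; lia.
by apply: zero_below_le (vge_const _); lia.
Qed.

(** * The class of [g] and the final assembly *)

Section Orbits.
Context (k : closedFieldType) (k_char0 : [pchar k] =i pred0).
Context (r d : nat) (r_gt0 : (0 < r)%N) (d_gt0 : (0 < d)%N).
Let s := (r + d)%N.
Let dual_rep (F u : laurent k) : ramified k d_gt0 :=
  - lcomp F u + lconst (s%:R / (2 * d%:R)).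

Lemma ltwist_dual_rep (eta : k) (F u : laurent k) : eta != 0 ->
  ltwist eta (dual_rep F u) =
  - lcomp (lcomp F u) (lconst eta * lmonom k 1) + lconst (s%:R / (2 * d%:R)) :> laurent k.
Proof.
move=> eta0; have ht := lead_twist eta.
rewrite ltwistE // (lcompD eta0 ht) (lcompN eta0 ht) (lcomp_const eta0 ht); reflexivity.
Qed.

Lemma dual_same_orbit (F F' : ramified k r_gt0) (u u' : ramified k d_gt0) (a : k) :
  a != 0 -> lead (- s%:Z) a F -> same_orbit_prop F' F ->
  fourier_solution r F u -> fourier_solution r F' u' ->
  \pi_(orbits k d_gt0) (dual_rep F' u') = \pi_(orbits k d_gt0) (dual_rep F u).
Proof.
move=> a0 hF [eps [m [epsr FF']]] /fourier_solutionP[[e [e0 hu]] uF].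
move=> /fourier_solutionP[[e' [e'0 hu']] u'F']; apply/pi_orbitP.
rewrite ltwistE in FF'; last exact: unity_neq0 r_gt0 epsr.
have [eta etad E] := solutions_same_orbit k_char0 r_gt0 d_gt0 a0 e0 e'0 epsr hF FF' hu hu' uF u'F'.
exists eta, m; split; first exact: etad.
have -> : dual_rep F' u' - ltwist eta (dual_rep F u) - lconst (m%:~R / d%:R) =
    - (lcomp F' u' - lcomp (lcomp F u) (lconst eta * lmonom k 1) + lconst (m%:~R / d%:R))
    :> laurent k.
  have H (x y z c : laurent k) : - x + c - (- y + c) - z = - (x - y + z) by ring.
  rewrite (ltwist_dual_rep F u (unity_neq0 d_gt0 etad)); exact: H.
exact: vgeN E.
Qed.

Lemma dual_primitive (F : ramified k r_gt0) (u : ramified k d_gt0) (a : k) :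
  a != 0 -> lead (- s%:Z) a F -> galois_free F -> fourier_solution r F u ->
  primitive_orbit (\pi_(orbits k d_gt0) (dual_rep F u)).
Proof.
move=> a0 hF F_free /fourier_solutionP[[e [e0 hu]] uF].
apply: (galois_free_primitive k_char0) => eta etad E.
have eta0 := unity_neq0 d_gt0 etad.
have E' : vge 1 (lcomp (lcomp F u) (lconst eta * lmonom k 1) - lcomp F u).
  have H (x y c : laurent k) : x - y = - ((- x + c) - (- y + c)) by ring.
  rewrite (H _ _ (lconst (s%:R / (2 * d%:R)))).
  rewrite (ltwist_dual_rep F u eta0) in E; exact: vgeN E.
have [etar FE] := solution_twist k_char0 r_gt0 d_gt0 a0 e0 etad hF hu uF E'.
by apply: F_free etar _; rewrite ltwistE.
Qed.

Lemma dual_fourier (F : ramified k r_gt0) (u G : ramified k d_gt0) :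
  fourier_solution r F u ->
  \pi_(orbits k d_gt0) G = \pi_(orbits k d_gt0) (dual_rep F u) ->
  connection_iso (local_fourier (E_ k_char0 F)) (E_ k_char0 G).
Proof.
move=> /fourier_solutionP[[e [e0 hu]] uF] GE.
have dk0 : d%:R != 0 :> k by rewrite (char0_natr_eq0 k_char0) -lt0n.
have k20 : 2 != 0 :> k by rewrite (char0_natr_eq0 k_char0).
have [Psi [G' [lP fP Pd [PP PQ] hG]]] := fourier_normal_form k_char0 r_gt0 d_gt0 e0 hu uF.
have [Psi' [_ _ PK P'K]] := triangular_inverse lP fP Pd.
have iso := @transported_fourier k k_char0 r d r_gt0 d_gt0 F G' Psi Psi' lP fP PK P'K PP PQ.
apply: connection_iso_trans iso _.
apply: same_orbit_iso; apply/pi_orbitP; rewrite GE; symmetry; apply/pi_orbitP.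
(* The normal form yields the constant [(d - r)/(2d)], which is [s/(2d) - r/d]; the shift [- r/d] is
   invisible in the orbit. *)
exists 1, (- r%:Z); split; first exact: expr1n.
rewrite ltwist1.
have -> : G' - dual_rep F u - lconst ((- r%:Z)%:~R / d%:R) =
    G' + lcomp F u - lconst ((d%:R - r%:R) / (2 * d%:R)) :> laurent k.
  have -> : (d%:R - r%:R) / (2 * d%:R) = s%:R / (2 * d%:R) + (- r%:Z)%:~R / d%:R :> k.
    by rewrite mulrNz -pmulrn natrD; field; rewrite dk0 k20.
  have H (x y z t : laurent k) : x - (- y + z) - t = x + y - (z + t) by ring.
  rewrite rmorphD /=; exact: H.
exact: hG.
Qed.
End Orbits.

Theorem theorem3p4 (k : closedFieldType) (k_char0 : [pchar k] =i pred0)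
    (r s : nat) (r_gt0 : (0 < r)%N) (rs : (r < s)%N)
    (f : orbits k r_gt0) (f_prim : primitive_orbit f)
    (f_ord : orbit_ord f = - (s%:R / r%:R)) :
  exists g : orbits k (subn_pos rs),
    primitive_orbit g /\
    forall F : ramified k r_gt0, \pi_(orbits k r_gt0) F = f ->
      [/\ slopes_gt1 k_char0 (E_ k_char0 F),
          exists u : ramified k (subn_pos rs), fourier_solution r F u,
          forall u : ramified k (subn_pos rs), fourier_solution r F u ->
            g = \pi_(orbits k (subn_pos rs))
                  (- lcomp F u + lconst (s%:R / (2 * (s - r)%:R)))
        & forall G : ramified k (subn_pos rs), \pi_(orbits k (subn_pos rs)) G = g ->
            connection_iso (local_fourier (E_ k_char0 F)) (E_ k_char0 G)].
Proof.
have rs' := subnKC (ltnW rs); set d_gt0 := subn_pos rs; set d := (s - r)%N in d_gt0 rs' *.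
have r0 : r%:R != 0 :> rat by rewrite pnatr_eq0 -lt0n.
have s0 : - s%:Z < 0 by lia.
(* [orbit_ord] speaks of this representative only; [lead_same_orbit] carries the order over to all
   others. *)
pose F0 := repr f; have F0f : \pi_(orbits k r_gt0) F0 = f by rewrite /F0 reprK.
have lF0 : lord F0 = - s%:Z.
  move: f_ord; rewrite /orbit_ord /ramified_ord -/F0 => /(congr1 (fun x => x * r%:R)).
  by rewrite mulNr !divfK // => h; apply/eqP; rewrite -(eqr_int rat) h mulrNz.
have [|a0 a00 hF0] := @lord_lead k F0.
  by apply: contra_eqN lF0 => /eqP ->; rewrite lord0; lia.
rewrite lF0 in hF0.
have leadF F : \pi_(orbits k r_gt0) F = f -> exists2 a, a != 0 & lead (- (r + d)%:Z) a F.
  move=> Ff; rewrite rs'; apply: (lead_same_orbit s0 a00 hF0).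
  by apply/pi_orbitP; rewrite F0f.
have solF F : \pi_(orbits k r_gt0) F = f ->
    exists u : ramified k d_gt0, fourier_solution r F u.
  move=> /leadF[a a_0 hF].
  have [u [e [e0 hu uF]]] := exists_fourier_root k_char0 d_gt0 a_0 hF.
  by exists u; apply/fourier_solutionP; split=> //; exists e.
have freeF F : \pi_(orbits k r_gt0) F = f -> galois_free F.
  by move=> Ff; apply: primitive_galois_free; rewrite Ff.
have [u0 u0P] := solF _ F0f; rewrite -rs' in hF0.
have [om omP] := exists_prim_root k_char0 r_gt0.
have gE F (u : ramified k d_gt0) : \pi_(orbits k r_gt0) F = f -> fourier_solution r F u ->
    \pi_(orbits k d_gt0) (- lcomp F u + lconst (s%:R / (2 * d%:R))) =
    \pi_(orbits k d_gt0) (- lcomp F0 u0 + lconst (s%:R / (2 * d%:R))).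
  rewrite -F0f => /pi_orbitP FF0 uP.
  by have := dual_same_orbit k_char0 a00 hF0 FF0 u0P uP; rewrite rs'.
exists (\pi_(orbits k d_gt0) (- lcomp F0 u0 + lconst (s%:R / (2 * d%:R)))); split.
  by have := dual_primitive k_char0 a00 hF0 (freeF _ F0f) u0P; rewrite rs'.
move=> F Ff; split.
- move=> S SF; exists r, r_gt0, F; split.
    apply: irreducible_component_iso SF => W.
    exact: (E_stable_subspace omP (freeF _ Ff)).
  have [a a_0 /lead_lord/(_ a_0) lF] := leadF _ Ff.
  rewrite /ramified_ord lF rs' mulrNz mulNr ltrN2 ltr_pdivlMr ?ltr0n //.
  by rewrite mul1r ltr_nat.
- exact: solF.
- move=> u uP; exact: esym (gE F u Ff uP).
move=> G GE; have [u uP] := solF _ Ff.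
by apply: (dual_fourier k_char0 uP); rewrite GE -(gE F u Ff uP) rs'; reflexivity.
Qed.
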